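(* Let $q,p\in\{1,2,3,\ldots\}$, and let $\mathbb{G}_{qp}=\mathbb{R}^{q\times p}\times\mathbb{R}^p\times\mathbb{R}^q$ be the Reiter--Heisenberg group with projections $\pi_j:\mathbb{G}_{qp}\to\mathbb{R}^{qp+p+q-1}$, $1\le j\le (q+1)p$ (as defined in the context). Then for all nonnegative measurable functions $f_1,\ldots,f_{(q+1)p}$ on $\mathbb{R}^{qp+p+q-1}$, $$\int_{\mathbb{G}_{qp}} \prod_{j = 1}^{(q + 1)p} f_j(\pi_j(x,y,t))\,dx\,dy\,dt \le \|\mathbf{R}\|_{\frac{3}{2} \to 3}^{\frac{3q}{qp + p + 2q - 1}} \prod_{j = 1}^{qp} \|f_j\|_{\frac{p(qp + p + 2q - 1)}{1 + p}} \prod_{j = qp + 1}^{(q + 1)p} \|f_j\|_{\frac{p(qp + p + 2q - 1)}{q + p}},$$ where $\|\mathbf{R}\|_{\frac32\to3}<+\infty$ denotes the operator norm of the Radon transform $\mathbf{R}:L^{\frac32}(\mathbb{R}^2)\to L^3(\mathbb{S}^1\times\mathbb{R})$.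
   Context: For $q,p\in\{1,2,\ldots\}$, $\mathbb{R}^{q\times p}$ is the space of real $q\times p$ matrices. The Reiter--Heisenberg group $\mathbb{G}_{qp}$ is $\mathbb{R}^{q\times p}\times\mathbb{R}^p\times\mathbb{R}^q$ with the group law $$(x,y,t)\cdot(x',y',t')=\left(x+x',\,y+y',\,t+t'+\tfrac12(xy'-x'y)\right),$$ where $xy'$ and $x'y$ are matrix-vector products. The integral over $\mathbb{G}_{qp}$ is with respect to Lebesgue measure $dx\,dy\,dt$. Identify $\mathbb{R}^{q\times p}$ with $\mathbb{R}^{qp}$ column by column: $x=(x_{kl})_{1\le k\le q,\,1\le l\le p}$ is written $x=(x_{11},\ldots,x_{q1},\ldots,x_{1p},\ldots,x_{qp})$, so that the entry $x_{kl}$ is the coordinate with index $i=(l-1)q+k$. For $1\le l\le p$ let $x(l):=(x_{1l},\ldots,x_{ql})\in\mathbb{R}^q$ be the $l$-th column, and for $1\le k\le q$ let $e_k$ be the $k$-th standard basis vector of $\mathbb{R}^q$. For a vector $v$, $\hat v_i$ denotes the vector obtained from $v$ by deleting its $i$-th coordinate. The projections are $$\pi_i(x,y,t):=\begin{cases}\left(\hat x_i,\,y,\,t+\frac{x_{kl}\,y_l}{2}e_k\right), & 1\le i\le qp,\ i=(l-1)q+k \text{ with } 1\le k\le q,\ 1\le l\le p,\\[4pt] \left(x,\,\hat y_{i-qp},\,t-\frac{y_{i-qp}\,x(i-qp)}{2}\right), & qp<i\le (q+1)p,\end{cases}$$ regarded as maps into $\mathbb{R}^{qp+p+q-1}$.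 $\|f\|_r=\left(\int |f|^r\right)^{1/r}$ is the $L^r$ norm with respect to Lebesgue measure (possibly $+\infty$), with the usual convention $0\cdot\infty=0$. The Radon transform (X-ray transform) on $\mathbb{R}^2$ is $$\mathbf{R}f(\sigma,s):=\int_{\{z\in\mathbb{R}^2:\,\langle z,\sigma\rangle=s\}}f(z)\,dz,\qquad(\sigma,s)\in\mathbb{S}^1\times\mathbb{R},$$ where $\langle\cdot,\cdot\rangle$ is the Euclidean inner product and $dz$ is one-dimensional Lebesgue measure on the line. Here $\mathbb{S}^1\times\mathbb{R}$ carries the product of arc-length measure and Lebesgue measure. It is a known fact (Oberlin--Stein) that $\mathbf{R}$ is bounded from $L^{3/2}(\mathbb{R}^2)$ to $L^3(\mathbb{S}^1\times\mathbb{R})$. *)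

(* Defs.v *)
From HB Require Import structures.
From mathcomp Require Import all_boot all_order all_algebra.
From mathcomp Require Import all_classical all_reals all_analysis.
From mathcomp Require Import measurable_realfun ring.

Set Implicit Arguments.
Unset Strict Implicit.
Unset Printing Implicit Defensive.

Import Order.TTheory GRing.Theory Num.Theory.
Import numFieldNormedType.Exports.

Local Open Scope classical_set_scope.
Local Open Scope ring_scope.

(* The sigma-algebra of ['M[T]_(m, n)] is the one generated by the entries; over
   the reals it is the Borel sigma-algebra of R^(m * n). *)
Definition measure_matrix_display : measure_display -> measure_display.
Proof. exact. Qed.

Section measurable_matrix.
Context {d} {T : measurableType d} (m n : nat).

Definition matrix_cylinders : set (set 'M[T]_(m, n)) :=
  \bigcup_(ij in [set: 'I_m * 'I_n])
    preimage_set_system setT (fun M : 'M[T]_(m, n) => M ij.1 ij.2) measurable.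

HB.instance Definition _ := @isMeasurable.Build (measure_matrix_display d)
  'M[T]_(m, n) <<s matrix_cylinders >>
  (@sigma_algebra0 _ _ _) (@sigma_algebraC _ _) (@sigma_algebra_bigcup _ _ _).

Lemma measurable_entry (i : 'I_m) (j : 'I_n) :
  measurable_fun setT (fun M : 'M[T]_(m, n) => M i j).
Proof.
move=> _ Y mY; rewrite setTI; apply: sub_sigma_algebra.
by exists (i, j) => //; exists Y => //; rewrite setTI.
Qed.

Lemma measurable_fun_mx d' (S : measurableType d') (f : S -> 'M[T]_(m, n)) :
  (forall i j, measurable_fun setT (fun s => f s i j)) -> measurable_fun setT f.
Proof.
move=> mf.
apply: (@measurability _ _ _ _ _ _ matrix_cylinders) => //.
move=> _ [_ [[i j] _ [Y mY <-]] <-].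
rewrite !setTI -comp_preimage -[X in measurable X]setTI.
exact: (mf i j).
Qed.

End measurable_matrix.

Section measure_lemmas.
Variable R : realType.

Lemma sigma_finite_product d1 d2 (T1 : measurableType d1)
    (T2 : measurableType d2) (mu : {sigma_finite_measure set T1 -> \bar R})
    (nu : {sigma_finite_measure set T2 -> \bar R}) :
  sigma_finite setT (mu \x nu)%E.
Proof.
have /sigma_finiteP[F [TF ndF Foo]] := sigma_finiteT mu.
have /sigma_finiteP[G [TG ndG Goo]] := sigma_finiteT nu.
exists (fun n => F n `*` G n).
  rewrite -setXTT TF TG predeqE => -[x y]; split.
    move=> [/= [n _ Fnx] [k _ Gky]]; exists (maxn n k) => //; split.
    - by move: x Fnx; exact/subsetPset/ndF/leq_maxl.
    - by move: y Gky; exact/subsetPset/ndG/leq_maxr.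
  by move=> [n _ []/= ? ?]; split; exists n.
move=> k; have [? ?] := Foo k; have [? ?] := Goo k.
split; first exact: measurableX.
by rewrite product_measure1E// lte_mul_pinfty// ge0_fin_numE.
Qed.

Section pushforward_lemmas.
Context d1 d2 (T1 : measurableType d1) (T2 : measurableType d2).
Variables (mu : {measure set T1 -> \bar R}) (f : T1 -> T2).

Lemma pushforward0 : pushforward mu f set0 = 0%E.
Proof. by rewrite /pushforward preimage_set0 measure0. Qed.

Lemma pushforward_ge0 : measurable_fun setT f ->
  forall A, (0 <= pushforward mu f A)%E.
Proof. by move=> mf A; exact: measure_ge0. Qed.

Lemma pushforward_sigma_additive : measurable_fun setT f ->
  semi_sigma_additive (pushforward mu f).
Proof. by move=> mf; exact: measure_semi_sigma_additive. Qed.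

End pushforward_lemmas.

Lemma sigma_finite_pushforward d1 d2 (T1 : measurableType d1)
    (T2 : measurableType d2) (mu : set T1 -> \bar R)
    (f : T1 -> T2) (g : T2 -> T1) :
  sigma_finite setT mu -> measurable_fun setT g -> cancel f g ->
  sigma_finite setT (pushforward mu f).
Proof.
move=> [F TF Foo] mg fK; exists (fun n => g @^-1` F n).
  by rewrite -preimage_bigcup -TF preimage_setT.
move=> n; have [mF muF] := Foo n; split.
  by rewrite -[X in measurable X]setTI; exact: mg.
rewrite /pushforward -comp_preimage.
by rewrite (_ : g \o f = id) ?preimage_id//; apply/funext => x /=.
Qed.

Lemma sigma_finite_measureP d (T : measurableType d)
    (mu : {measure set T -> \bar R}) : sigma_finite setT mu ->
  exists nu : {sigma_finite_measure set T -> \bar R}, mu = nu :> (set T -> \bar R).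
Proof.
case: mu => m [c1 c2] sf.
pose M := @Measure.Pack d T R m (@Measure.Class d T R m c1 c2).
pose F := Measure_isSigmaFinite.Build _ _ _ M sf.
by exists (HB.pack_for {sigma_finite_measure set T -> \bar R} m c1 c2 F).
Qed.

End measure_lemmas.
Arguments pushforward0 {R d1 d2 T1 T2} mu f.
Arguments pushforward_ge0 {R d1 d2 T1 T2} mu f mf.
Arguments pushforward_sigma_additive {R d1 d2 T1 T2} mu f mf.

(* Column-by-column numbering: with all indices starting from 0, the entry
   (k, l) of an m x n matrix has number [l * m + k]. *)
Section column_index.
Variables m n : nat.

Lemma row_index_subproof (i : 'I_(n * m)) : (i %% m < m)%N.
Proof.
by case: (posnP m) i => [->|m0] [i /=]; rewrite ?muln0// ltn_mod.
Qed.

Lemma col_index_subproof (i : 'I_(n * m)) : (i %/ m < n)%N.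
Proof.
by case: (posnP m) i => [->|m0] [i /=]; rewrite ?muln0// ltn_divLR.
Qed.

Lemma entry_index_subproof (k : 'I_m) (l : 'I_n) : (l * m + k < n * m)%N.
Proof.
apply: (@leq_trans (l.+1 * m)); last by rewrite leq_mul2r (ltn_ord l) orbT.
by rewrite mulSn addnC ltn_add2r.
Qed.

Definition row_index (i : 'I_(n * m)) : 'I_m := Ordinal (row_index_subproof i).
Definition col_index (i : 'I_(n * m)) : 'I_n := Ordinal (col_index_subproof i).
Definition entry_index (k : 'I_m) (l : 'I_n) : 'I_(n * m) :=
  Ordinal (entry_index_subproof k l).

Lemma row_entry_index k l : row_index (entry_index k l) = k.
Proof. by apply: val_inj; rewrite /= modnMDl modn_small. Qed.

Lemma col_entry_index k l : col_index (entry_index k l) = l.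
Proof.
apply: val_inj; rewrite /= divnMDl ?divn_small ?addn0//.
exact: leq_ltn_trans (ltn_ord k).
Qed.

Lemma entry_indexK i : entry_index (row_index i) (col_index i) = i.
Proof. by apply: val_inj; rewrite /= -divn_eq. Qed.

End column_index.

Section lebesgue_Rn.
Variable R : realType.

(* [lebesgue_measure], with domain [R] itself rather than its alias
   [measurableTypeR R] *)
Definition lebR : set R -> \bar R := @lebesgue_measure R.

Let lebR0 : lebR set0 = 0%E. Proof. exact: measure0. Qed.
Let lebR_ge0 A : (0 <= lebR A)%E. Proof. exact: measure_ge0. Qed.
Let lebR_sigma_additive : semi_sigma_additive lebR.
Proof. exact: (@measure_semi_sigma_additive _ _ _ (@lebesgue_measure R)). Qed.

HB.instance Definition _ := isMeasure.Build _ _ _ lebR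
  lebR0 lebR_ge0 lebR_sigma_additive.

Let lebR_sigma_finite : sigma_finite setT lebR.
Proof. exact: (@sigma_finiteT _ _ _ (@lebesgue_measure R)). Qed.

HB.instance Definition _ :=
  Measure_isSigmaFinite.Build _ _ _ lebR lebR_sigma_finite.

Definition rV_cons n (z : R * 'rV[R]_n) : 'rV[R]_(1 + n) :=
  row_mx z.1%:M z.2.

Fixpoint lebesgue_rV (n : nat) : set 'rV[R]_n -> \bar R :=
  match n with
  | 0 => dirac (0 : 'rV[R]_0)
  | n'.+1 => pushforward (lebR \x @lebesgue_rV n')%E (@rV_cons n')
  end.

Lemma measurable_rV_cons n : measurable_fun setT (@rV_cons n).
Proof.
apply: measurable_fun_mx => i j; rewrite -[j]splitK /rV_cons.
case: (fintype.split j) => k /=.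
- rewrite (_ : (fun _ => _) = fst) //; apply/funext => z.
  by rewrite row_mxEl mxE !ord1 eqxx.
- rewrite (_ : (fun _ => _) = (fun M : 'rV[R]_n => M i k) \o snd); last first.
    by apply/funext => z /=; rewrite row_mxEr.
  exact: measurableT_comp (measurable_entry i k) measurable_snd.
Qed.

Let lebesgue_rV_measure n :
  exists mu : {sigma_finite_measure set 'rV[R]_n -> \bar R},
    @lebesgue_rV n = mu.
Proof.
elim: n => [|n [mu /= ->]]; first by exists (dirac (0 : 'rV[R]_0)).
pose nu : {measure set (R * 'rV[R]_n)%type -> \bar R} := (lebR \x mu)%E.
have [m1 m1E] : exists m1 : {measure set 'rV[R]_(1 + n) -> \bar R},
    pushforward nu (@rV_cons n) = m1 :> (set 'rV[R]_(1 + n) -> \bar R).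
  unshelve (by eexists (pushforward nu (@rV_cons n))).
  exact: measurable_rV_cons.
have sf1 : sigma_finite setT m1.
  pose uncons (v : 'rV[R]_(1 + n)) : R * 'rV[R]_n :=
    (v 0 (lshift n 0), rsubmx v).
  rewrite -m1E; apply: (@sigma_finite_pushforward _ _ _ _ _ _ _ uncons).
  - exact: sigma_finite_product.
  - apply: measurable_fun_pair; first exact: measurable_entry.
    apply: measurable_fun_mx => i j.
    rewrite (_ : (fun _ => _) = fun v : 'rV[R]_(1 + n) => v i (rshift 1 j)).
      exact: measurable_entry.
    by apply/funext => v; rewrite mxE.
  - move=> [a v]; rewrite /uncons /= /rV_cons /=; congr (_, _).
      by rewrite row_mxEl mxE eqxx.
    by rewrite row_mxKr.
by rewrite m1E; exact: sigma_finite_measureP.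
Qed.

Let lebesgue_rV0 n : @lebesgue_rV n set0 = 0%E.
Proof. by have [mu ->] := lebesgue_rV_measure n; exact: measure0. Qed.
Let lebesgue_rV_ge0 n A : (0 <= @lebesgue_rV n A)%E.
Proof. by have [mu ->] := lebesgue_rV_measure n; exact: measure_ge0. Qed.
Let lebesgue_rV_sigma_additive n : semi_sigma_additive (@lebesgue_rV n).
Proof.
by have [mu ->] := lebesgue_rV_measure n; exact: measure_semi_sigma_additive.
Qed.

HB.instance Definition _ n := isMeasure.Build _ _ _ (@lebesgue_rV n)
  (@lebesgue_rV0 n) (@lebesgue_rV_ge0 n) (@lebesgue_rV_sigma_additive n).

Let lebesgue_rV_sigma_finite n : sigma_finite setT (@lebesgue_rV n).
Proof. by have [mu ->] := lebesgue_rV_measure n; exact: sigma_finiteT. Qed.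

HB.instance Definition _ n := Measure_isSigmaFinite.Build _ _ _
  (@lebesgue_rV n) (@lebesgue_rV_sigma_finite n).

Definition colvec m n (x : 'M[R]_(m, n)) : 'rV[R]_(n * m) :=
  \row_i x (row_index i) (col_index i).
Definition mx_of_colvec m n (v : 'rV[R]_(n * m)) : 'M[R]_(m, n) :=
  \matrix_(k, l) v 0 (entry_index k l).

Lemma colvecK m n : cancel (@colvec m n) (@mx_of_colvec m n).
Proof.
by move=> x; apply/matrixP => k l; rewrite !mxE row_entry_index col_entry_index.
Qed.

Lemma mx_of_colvecK m n : cancel (@mx_of_colvec m n) (@colvec m n).
Proof. by move=> v; apply/rowP => i; rewrite !mxE entry_indexK. Qed.

Lemma measurable_colvec m n : measurable_fun setT (@colvec m n).
Proof.
apply: measurable_fun_mx => i j.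
rewrite (_ : (fun _ => _) =
  fun x : 'M[R]_(m, n) => x (row_index j) (col_index j)).
  exact: measurable_entry.
by apply/funext => x; rewrite mxE.
Qed.

Lemma measurable_mx_of_colvec m n : measurable_fun setT (@mx_of_colvec m n).
Proof.
apply: measurable_fun_mx => k l.
rewrite (_ : (fun _ => _) = fun v : 'rV[R]_(n * m) => v 0 (entry_index k l)).
  exact: measurable_entry.
by apply/funext => v; rewrite mxE.
Qed.

Definition lebesgue_mx m n : set 'M[R]_(m, n) -> \bar R :=
  pushforward (@lebesgue_rV (n * m)) (@mx_of_colvec m n).

HB.instance Definition _ m n := isMeasure.Build _ _ _ (@lebesgue_mx m n)
  (pushforward0 _ _) (pushforward_ge0 _ _ (@measurable_mx_of_colvec m n))
  (pushforward_sigma_additive _ _ (@measurable_mx_of_colvec m n)).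

Let lebesgue_mx_sigma_finite m n : sigma_finite setT (@lebesgue_mx m n).
Proof.
apply: (@sigma_finite_pushforward _ _ _ _ _ _ _ (@colvec m n)).
- exact: sigma_finiteT.
- exact: measurable_colvec.
- exact: mx_of_colvecK.
Qed.

HB.instance Definition _ m n := Measure_isSigmaFinite.Build _ _ _
  (@lebesgue_mx m n) (@lebesgue_mx_sigma_finite m n).

End lebesgue_Rn.
Arguments lebR {R}.
Arguments lebesgue_rV {R} n.
Arguments lebesgue_mx {R} m n.

(* Measurability with respect to the completion of the sigma-algebra under
   [mu]. The library integral of a nonnegative function is the supremum of the
   integrals of the simple functions below it, measurable for the original
   sigma-algebra; on completion-measurable functions this is the integral
   against the completed measure, so [\int[mu]] and ['N[mu]_r] keep their usual
   meaning for them. *)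
Definition completed_measurable_fun d (T : measurableType d) (R : realType)
    (mu : set T -> \bar R) (f : T -> \bar R) :=
  forall Y : set (\bar R), measurable Y -> completed_algebra_gen mu (f @^-1` Y).

Definition lebesgue_measurable_fun (R : realType) n (f : 'rV[R]_n -> \bar R) :=
  completed_measurable_fun (lebesgue_rV n) f.

Section radon.
Variable R : realType.

Definition unit_circle_pt (theta : R) : R * R := (cos theta, sin theta).

Lemma measurable_unit_circle_pt : measurable_fun setT unit_circle_pt.
Proof.
apply: measurable_fun_pair; apply: continuous_measurable_fun.
- exact: continuous_cos.
- exact: continuous_sin.
Qed.

(* Arc length on the unit circle, as a measure on the plane concentrated on
   the circle: [unit_circle_pt] parametrizes the circle by arc length,
   bijectively on [0, 2 pi[. *)
Definition arc_length : set (R * R) -> \bar R :=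
  pushforward (mrestr lebR (measurable_itv `[0%R, (2 * pi)%R[)) unit_circle_pt.

HB.instance Definition _ := isMeasure.Build _ _ _ arc_length
  (pushforward0 _ _) (pushforward_ge0 _ _ measurable_unit_circle_pt)
  (pushforward_sigma_additive _ _ measurable_unit_circle_pt).

(* For a unit vector [sigma], [r |-> s sigma + r sigma^perp], with
   [sigma^perp = (- sigma.2, sigma.1)], is an isometric parametrization of the
   line [<z, sigma> = s]; values at other [sigma] lie outside the support of
   [arc_length]. *)
Definition radon (f : R * R -> R) (w : (R * R) * R) : \bar R :=
  let sigma := w.1 in let s := w.2 in
  \int[lebR]_r
    (f (s * sigma.1 - r * sigma.2, s * sigma.2 + r * sigma.1))%:E.

Definition leb2 : set (R * R) -> \bar R := (lebR \x lebR)%E.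
HB.instance Definition _ := Measure.on leb2.

Definition circle_line_measure : set ((R * R) * R) -> \bar R :=
  (arc_length \x lebR)%E.
HB.instance Definition _ := Measure.on circle_line_measure.

(* The operator norm from L^(3/2) to L^3, as an element of [0, +oo]. [radon] is
   only almost everywhere meaningful on L^(3/2): where [f] is not integrable
   along the line [radon f] has the default value of the library integral. *)
Definition radon_norm : \bar R :=
  ereal_sup [set ('N[circle_line_measure]_(3%:E)[radon f])%E | f in
    [set f : R * R -> R | f \in Lfun leb2 (3 / 2)%:E
       /\ ('N[leb2]_((3 / 2)%:E)[EFin \o f] <= 1)%E]].

End radon.
Arguments radon_norm R : clear implicits.

Section reiter_heisenberg.
Variables (R : realType) (q p : nat).

Notation G := ('M[R]_(q, p) * 'cV[R]_p * 'cV[R]_q)%type.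

Definition rh_mul (g h : G) : G :=
  let: (x, y, t) := g in let: (x', y', t') := h in
  (x + x', y + y', t + t' + 2^-1 *: (x *m y' - x' *m y)).

Definition rh_measure : set G -> \bar R :=
  ((lebesgue_mx q p \x lebesgue_mx p 1) \x lebesgue_mx q 1)%E.
HB.instance Definition _ := Measure.on rh_measure.

Definition rh_coord (x : 'M[R]_(q, p)) (y : 'cV[R]_p) (t : 'cV[R]_q) :
    'rV[R]_(p * q + p + q) :=
  row_mx (row_mx (colvec x) y^T) t^T.

Definition rh_proj (j : 'I_(p * q + p)) (g : G) :
    'rV[R]_(p * q + p + q).-1 :=
  let: (x, y, t) := g in
  col' (lshift q j)
    match fintype.split j with
    | inl i => let k := row_index i in let l := col_index i in
        rh_coord x y (t + (x k l * y l 0 / 2) *: delta_mx k 0)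
    | inr l => rh_coord x y (t - (y l 0 / 2) *: col l x)
    end.

(* [rh_proj j] is constant along the left cosets of the one-parameter subgroup
   of the [j]-th coordinate. *)
Lemma rh_proj_coset (j : 'I_(p * q + p)) (s : R) (g : G) :
  let e : G := match fintype.split j with
    | inl i => (s *: delta_mx (row_index i) (col_index i), 0, 0)
    | inr l => (0, s *: delta_mx l 0, 0)
    end in
  rh_proj j (rh_mul g e) = rh_proj j g.
Proof.
case: g => [[x y] t]; case E: (fintype.split j) => [i|l] /=.
all: have jE : j = fintype.unsplit (fintype.split j) by rewrite splitK.
all: rewrite E /= in jE.
all: rewrite ?E; apply/rowP => c; rewrite [LHS]mxE [RHS]mxE.
all: have := neq_lift (lshift q j) c; move: (lift _ _) => d jd.
all: rewrite /rh_coord -[d]splitK; case: (fintype.split d) (splitK d) => [e|k] /= dE.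
- rewrite !row_mxEl -[e]splitK; case: (fintype.split e) (splitK e) => [i'|l] /= eE.
  + rewrite !row_mxEl !mxE.
    case: eqP => [rE|]; case: eqP => [cE|]; rewrite /= ?mulr0 ?addr0//.
    case/eqP: jd; rewrite jE -dE -eE; congr (lshift _ (lshift _ _)).
    by rewrite -[i]entry_indexK -rE -cE entry_indexK.
  + by rewrite !row_mxEr !mxE addr0.
- rewrite !row_mxEr !mxE !eqxx /= !mulr1.
  rewrite big1; last by move=> l _; rewrite mxE mulr0.
  rewrite (bigD1 (col_index i)) //= big1 => [|l lE]; last first.
    by rewrite !mxE (negbTE lE) andbF mulr0 mul0r.
  by rewrite !mxE eqxx !andbT; case: (k == row_index i) => /=; field.
- rewrite !row_mxEl -[e]splitK; case: (fintype.split e) (splitK e) => [i'|l'] /= eE.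
  + by rewrite !row_mxEl !mxE addr0.
  + rewrite !row_mxEr !mxE.
    case: eqP => [lE|]; rewrite /= ?mulr0 ?addr0//.
    by case/eqP: jd; rewrite jE -dE -eE lE.
- rewrite !row_mxEr !mxE !eqxx /= !mulr1.
  rewrite [X in _ * (_ - X)]big1; last by move=> l' _; rewrite mxE mul0r.
  rewrite (bigD1 l) //= big1 => [|l' lE]; last first.
    by rewrite !mxE (negbTE lE) /= !mulr0.
  by rewrite !mxE eqxx /=; field.
Qed.

End reiter_heisenberg.
Arguments rh_measure R q p : clear implicits.

(* Main.v *)
(** Writing f_j = P_j^(a_j) with 1 / a_j the exponent of f_j in the theorem, one
    has to bound the integral of the product of the (P_j o pi_j)^(a_j) by
    |R|^(3q/D) prod_j (int P_j)^(a_j). The exponents (a_j) are the average over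
    l = 1, ..., p of the exponents that equal 2/D at the variables x_kl,
    (q+1)/D at y_l and 1/D elsewhere, so by Hoelder each l can be treated alone.
    One integrates first in the l-th column, y_l and t. Hoelder splits off the
    functions of the other columns, whose shears are translations in t, and
    leaves the case p = 1; Finner's inequality handles the other variables.

    For p = 1 a shear in t removes the dependence on x_k y of the function
    attached to y and turns the one attached to x_k into a function of
    (y, t_k + x_k y). After Hoelder in y one is left with q X-ray transforms,
    the k-th acting in the plane (x_k, t_k), to which one applies the
    L^(3/2) -> L^3 bound; a Loomis-Whitney inequality with an L^2 norm in the
    block (x_k, t_k) of the k-th function concludes.

    The X-ray transform is bounded because Hoelder in (x, t) bounds its L^3 norm
    cubed by the trilinear form with kernel
    |y1 - y2|^(-1/3) |y1 - y3|^(-1/3) |y2 - y3|^(-1/3) at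
    g(y) = (int h(y, u)^(3/2) du)^(2/3); where the third value of g is the
    smallest, two one-dimensional integrations give the estimate. *)

From HB Require Import structures.
Require Import Defs.
From mathcomp Require Import all_boot all_order all_algebra.
From mathcomp Require Import all_classical all_reals all_analysis.
From mathcomp Require Import measurable_realfun ring lra.

Set Implicit Arguments.
Unset Strict Implicit.
Unset Printing Implicit Defensive.

Import Order.TTheory GRing.Theory Num.Theory.
Import numFieldNormedType.Exports.

Local Open Scope classical_set_scope.
Local Open Scope ring_scope.
Local Open Scope ereal_scope.

(** * Affine changes of variables on the line *)

(** The number D comes from the balance of exponents at one l. With weights 2 at x_kl, q+1 at y_l
    and 1 elsewhere, the column l contributes 3q+1 and the other columns (p-1)(q+1), in all D+1. A
    coordinate x or y of another column is missed by exactly one function, of weight 1, so after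
    division by D the exponents of the functions that see it add up to 1, as Finner's inequality
    requires. In the column l the case p = 1, where D is 3q, carries the constant |R| to the power
    1; it is used with exponent 3q/D.

    Nothing is assumed integrable, so the estimates are made for functions with values in [0, +oo],
    with 0 * +oo = 0. A division by an integral that may be 0 or +oo is avoided by a case
    distinction, a truncation or, for Minkowski, an expanded square. Partial integrals remain
    functions of one long vector, so that shears, Tonelli and Hoelder in some of the variables all
    concern functions on the same space. The f_j are only Lebesgue measurable: they are replaced by
    Borel majorants with no larger norms. *)

Section le_ge0_integral.
Import HBNNSimple.

(** The integral of a nonnegative function is a supremum over the simple functions below it, so
    enlarging the function enlarges the set of competitors. Measurability does not enter, which
    matters when Lebesgue-measurable functions are compared with Borel ones. *)
Lemma le_ge0_integral d (T : measurableType d) (R : realType)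
    (mu : {measure set T -> \bar R}) (f g : T -> \bar R) :
  (forall x, 0 <= f x) -> (forall x, f x <= g x) ->
  \int[mu]_x f x <= \int[mu]_x g x.
Proof.
move=> f0 fg; have g0 x : 0 <= g x by exact: le_trans (fg x).
rewrite !ge0_integralTE//; apply: ereal_sup_le => _ [h hf <-].
by exists h => // x; exact: le_trans (fg x).
Qed.

End le_ge0_integral.

Section lebR.
Variable R : realType.
Implicit Types (f : R -> \bar R) (a : R).

(** Changes of variables reduce to this: an image measure is recognized by its values on half-open
    intervals. The measure is first carried over to the alias [measurableTypeR R], on which
    uniqueness of Lebesgue measure is stated. *)
Lemma lebR_unique (mu : {measure set R -> \bar R}) :
  (forall a b : R, (a < b)%R -> mu `]a, b]%classic = (b - a)%:E) ->
  forall A, measurable A -> mu A = lebR A.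
Proof.
move=> muE A mA; apply/esym.
pose nu : set (measurableTypeR R) -> \bar R := mu.
have nu0 : nu set0 = 0 by exact: (@measure0 _ _ _ mu).
have nu_ge0 B : 0 <= nu B by exact: (@measure_ge0 _ _ _ mu).
have nu_sigma : semi_sigma_additive nu.
  exact: (@measure_semi_sigma_additive _ _ _ mu).
pose nuM := isMeasure.Build _ _ _ nu nu0 nu_ge0 nu_sigma.
pose nu' : {measure set (measurableTypeR R) -> \bar R} := HB.pack nu nuM.
apply: (@lebesgue_measure_unique R nu') => // _ [[a b]] _ <- /=.
rewrite lebesgue_measure_itv/= lte_fin.
case: ltP => ab; first by rewrite -[nu _]/(mu _) muE// EFinB.
by rewrite set_itv_ge ?measure0// bnd_simp -leNgt.
Qed.

Lemma integral_lebR_shift a f : measurable_fun setT f -> (forall x, 0 <= f x) ->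
  \int[lebR]_x f (x + a)%R = \int[lebR]_x f x.
Proof.
move=> mf f0.
have ma : measurable_fun [set: R] (fun x : R => x + a)%R.
  exact: measurable_funD.
rewrite -[LHS](@ge0_integral_pushforward _ _ _ _ _ _ ma lebR setT f)//.
apply: eq_measure_integral => A mA _.
apply: lebR_unique => // x y xy; rewrite /= /pushforward.
rewrite (_ : _ @^-1` _ = `](x - a)%R, (y - a)%R]%classic); last first.
  by apply/seteqP; split=> z /=; rewrite !in_itv/= ltrBlDr lerBrDr.
rewrite [lebR _]lebesgue_measure_itv/= lte_fin ltrD2r xy -EFinB; congr EFin; ring.
Qed.

Lemma integral_lebR_scale a f : a != 0%R ->
  measurable_fun setT f -> (forall x, 0 <= f x) ->
  \int[lebR]_x f (a * x)%R = `|a|^-1%:E * \int[lebR]_x f x.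
Proof.
move=> a0 mf f0.
have ma : measurable_fun [set: R] (fun x : R => a * x)%R.
  exact: measurable_funM.
have na0 : (0 < `|a|)%R by rewrite normr_gt0.
rewrite -[LHS](@ge0_integral_pushforward _ _ _ _ _ _ ma lebR setT f)//.
(* Multiplied by |a|, the image of [lebR] under the dilation gives each interval its length, so
   [lebR_unique] applies. *)
pose k : {nonneg R} := NngNum (ltW na0).
have kE : (k%:num^-1 * k%:num = 1)%R by rewrite mulVf// gt_eqF.
rewrite -[LHS]mul1e -[X in X * _ = _]/(1%R%:E) -kE EFinM -muleA; congr (_ * _).
rewrite -ge0_integral_mscale//.
apply: eq_measure_integral => A mA _.
apply: lebR_unique => // x y xy.
rewrite -[LHS]/(k%:num%:E * lebR ((fun z => a * z)%R @^-1` `]x, y]%classic)).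
have [a_gt0|a_lt0|//] := ltgtP 0%R a; last by move=> aa; rewrite aa eqxx in a0.
- rewrite (_ : _ @^-1` _ = `](x / a)%R, (y / a)%R]%classic); last first.
    by apply/seteqP; split=> z /=; rewrite !in_itv/= ltr_pdivrMr// ler_pdivlMr// mulrC.
  rewrite [lebR _]lebesgue_measure_itv/= lte_fin ltr_pM2r ?invr_gt0// xy -EFinB -EFinM.
  by congr EFin; rewrite gtr0_norm//; field.
- rewrite (_ : _ @^-1` _ = `[(y / a)%R, (x / a)%R[%classic); last first.
    by apply/seteqP; split=> z /=; rewrite !in_itv/= ler_ndivrMr// ltr_ndivlMr// [(z * a)%R]mulrC andbC.
  rewrite [lebR _]lebesgue_measure_itv/= lte_fin ltr_nM2r ?invr_lt0// xy -EFinB -EFinM.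
  by congr EFin; rewrite ltr0_norm//; field.
Qed.

Lemma integral_lebR_affine a b f : a != 0%R ->
  measurable_fun setT f -> (forall x, 0 <= f x) ->
  \int[lebR]_x f (a * x + b)%R = `|a|^-1%:E * \int[lebR]_x f x.
Proof.
move=> a0 mf f0; rewrite (integral_lebR_scale (f := fun x => f (x + b)%R))//.
  by rewrite integral_lebR_shift.
by apply: measurableT_comp => //; exact: measurable_funD.
Qed.

End lebR.

(** * Hoelder's inequality for extended real functions *)

Section nnmeasurable.
Context d (T : measurableType d) (R : realType).
Implicit Types (f g : T -> \bar R).

Definition nnmeasurable f := measurable_fun setT f /\ forall x, 0 <= f x.

Lemma nnmeasurable_cst (c : \bar R) : 0 <= c -> nnmeasurable (cst c).
Proof. by move=> c0; split. Qed.

Lemma nnmeasurableM f g : nnmeasurable f -> nnmeasurable g ->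
  nnmeasurable (fun x => f x * g x).
Proof.
move=> [mf f0] [mg g0]; split; first exact: emeasurable_funM.
by move=> x; exact: mule_ge0.
Qed.

Lemma nnmeasurableD f g : nnmeasurable f -> nnmeasurable g ->
  nnmeasurable (fun x => f x + g x).
Proof.
move=> [mf f0] [mg g0]; split; first exact: emeasurable_funD.
by move=> x; exact: adde_ge0.
Qed.

Lemma nnmeasurable_poweR f (a : R) : nnmeasurable f ->
  nnmeasurable (fun x => f x `^ a).
Proof.
move=> [mf f0]; split; last by move=> x; exact: poweR_ge0.
exact: (measurableT_comp (measurable_poweR _)).
Qed.

Lemma nnmeasurable_prod (I : Type) (r : seq I) (P : pred I)
    (f : I -> T -> \bar R) :
  (forall i, P i -> nnmeasurable (f i)) ->
  nnmeasurable (fun x => \big[mule/1]_(i <- r | P i) f i x).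
Proof.
move=> mf; elim: r => [|i r IH].
  under eq_fun do rewrite big_nil.
  exact: (@nnmeasurable_cst 1).
under eq_fun do rewrite big_cons.
by case: (boolP (P i)) => Pi //; apply: nnmeasurableM => //; exact: mf.
Qed.

End nnmeasurable.

Lemma nnmeasurable_comp d d' (T : measurableType d) (S : measurableType d')
    (R : realType) (h : S -> T) (f : T -> \bar R) :
  measurable_fun setT h -> nnmeasurable f -> nnmeasurable (fun s => f (h s)).
Proof. by move=> mh [mf f0]; split => //; exact: measurableT_comp. Qed.

Section nnintegral.
Context d (T : measurableType d) (R : realType) (mu : {measure set T -> \bar R}).
Implicit Types (f g : T -> \bar R).

Lemma nnintegral_ge0 f : nnmeasurable f -> 0 <= \int[mu]_x f x.
Proof. by move=> [_ f0]; exact: integral_ge0. Qed.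

Lemma nnintegralZl (c : \bar R) f : 0 <= c -> nnmeasurable f ->
  \int[mu]_x (c * f x) = c * \int[mu]_x f x.
Proof. by move=> c0 [mf f0]; rewrite ge0_integralZl. Qed.

Lemma nnintegralD f g : nnmeasurable f -> nnmeasurable g ->
  \int[mu]_x (f x + g x) = \int[mu]_x f x + \int[mu]_x g x.
Proof. by move=> [mf f0] [mg g0]; rewrite ge0_integralD. Qed.

Lemma nnintegral_eq0 f : nnmeasurable f -> \int[mu]_x f x = 0 ->
  ae_eq mu setT f (cst 0).
Proof.
move=> mf f0; apply/(ae_eq_integral_abs mu measurableT mf.1).
by rewrite -[RHS]f0; apply: eq_integral => x _; rewrite gee0_abs// mf.2.
Qed.

End nnintegral.

Section powers.
Variable R : realType.
Implicit Types (a b : R) (x y : \bar R).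

Lemma le_poweR x y a : (0 <= a)%R -> 0 <= x -> x <= y -> x `^ a <= y `^ a.
Proof.
move=> a0 x0 xy; apply: gt0_ler_poweR => //; rewrite in_itv/= leey andbT//.
exact: le_trans xy.
Qed.

Lemma poweRD_ge0 x a b : (0 <= a)%R -> (0 <= b)%R -> x `^ (a + b) = x `^ a * x `^ b.
Proof.
move=> a0 b0; have [->|an0] := eqVneq a 0%R; first by rewrite add0r poweRe0 mul1e.
apply: poweRD; rewrite /poweRD_def; apply/implyP => /eqP ab0.
by exfalso; move/eqP: an0; apply; lra.
Qed.

Lemma prode_ge0 (I : Type) (r : seq I) (P : pred I) (f : I -> \bar R) :
  (forall i, P i -> 0 <= f i) -> 0 <= \big[mule/1]_(i <- r | P i) f i.
Proof. by move=> f0; elim/big_rec: _ => // i x /f0 ? ?; exact: mule_ge0. Qed.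

Lemma le_prode (I : Type) (r : seq I) (P : pred I) (f g : I -> \bar R) :
  (forall i, P i -> 0 <= f i) -> (forall i, P i -> f i <= g i) ->
  \big[mule/1]_(i <- r | P i) f i <= \big[mule/1]_(i <- r | P i) g i.
Proof.
move=> f0 fg; elim: r => [|i r IH]; first by rewrite !big_nil.
rewrite !big_cons; case: ifPn => // Pi; apply: lee_pmul => //.
- exact: f0.
- exact: prode_ge0.
- exact: fg.
Qed.

Lemma poweR_prod (I : Type) (r : seq I) (P : pred I) (f : I -> \bar R) a :
  (forall i, P i -> 0 <= f i) ->
  (\big[mule/1]_(i <- r | P i) f i) `^ a = \big[mule/1]_(i <- r | P i) (f i `^ a).
Proof.
move=> f0; elim: r => [|i r IH]; first by rewrite !big_nil poweR1r.
rewrite !big_cons; case: ifPn => // Pi.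
by rewrite poweRM ?IH//; [exact: f0|exact: prode_ge0].
Qed.

Lemma poweR_sum (I : Type) (r : seq I) (P : pred I) (w : I -> R) x : 0 <= x ->
  (forall i, P i -> 0 <= w i)%R ->
  \big[mule/1]_(i <- r | P i) (x `^ w i) = x `^ (\sum_(i <- r | P i) w i)%R.
Proof.
move=> x0 w0; elim: r => [|i r IH]; first by rewrite !big_nil poweRe0.
rewrite !big_cons; case: ifPn => // Pi.
by rewrite poweRD_ge0 ?IH//; [exact: w0|exact: sumr_ge0].
Qed.

(** Young's inequality with conjugate exponents 1/a and 1/b, applied to x^a and y^b. If x or y is
    infinite, so is the right-hand side. *)
Lemma young_poweR x y a b : 0 <= x -> 0 <= y -> (0 < a)%R -> (0 < b)%R ->
  (a + b = 1)%R -> x `^ a * y `^ b <= a%:E * x + b%:E * y.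
Proof.
move=> x0 y0 a0 b0 ab1.
case: x x0 => [x x0| _|//]; last first.
  by rewrite gt0_muley ?lte_fin// addye ?leey// gt_eqF// (lt_le_trans ltNy0)// mule_ge0// lee_fin ltW.
case: y y0 => [y y0| _|//]; last first.
  by rewrite gt0_muley ?lte_fin// addey ?leey.
rewrite !lee_fin in x0 y0; rewrite !poweR_EFin -!EFinM -EFinD lee_fin.
have := @conjugate_powR _ (powR x a) (powR y b) a^-1%R b^-1%R (powR_ge0 _ _) (powR_ge0 _ _).
rewrite !invr_gt0 => /(_ a0 b0); rewrite !invrK => /(_ ab1).
rewrite -!powRrM !divff ?gt_eqF// !powRr1//.
by rewrite mulrC [(y * b)%R]mulrC [(x * a)%R]mulrC; rewrite mulrC.
Qed.

End powers.

Section hoelder.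
Context d (T : measurableType d) (R : realType) (mu : {measure set T -> \bar R}).
Implicit Types (f g : T -> \bar R).

(** [f] vanishes almost everywhere, hence so does the product, even where [g] is infinite, because 0
    * +oo = 0. *)
Lemma hoelder_zero f g (a b : R) : nnmeasurable f -> nnmeasurable g ->
  (0 < a)%R -> \int[mu]_x f x = 0 -> \int[mu]_x (f x `^ a * g x `^ b) = 0.
Proof.
move=> mf mg a0 f0.
have mfg : nnmeasurable (fun x => f x `^ a * g x `^ b).
  by apply: nnmeasurableM; exact: nnmeasurable_poweR.
have fae := nnintegral_eq0 mf f0.
rewrite -[RHS](integral0 mu setT).
apply: ge0_ae_eq_integral => //; [exact: mfg.1|by move=> x _; exact: mfg.2|].
apply: filterS fae => x /= /(_ I) -> _.
by rewrite poweR0r ?mul0e// gt_eqF.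
Qed.

(** Once the integrals equal to 0 or +oo are set aside, both functions are normalized to integral 1
    and Young's inequality is integrated. *)
Lemma hoelder_poweR f g (a b : R) : nnmeasurable f -> nnmeasurable g ->
  (0 < a)%R -> (0 < b)%R -> (a + b = 1)%R ->
  \int[mu]_x (f x `^ a * g x `^ b) <=
  (\int[mu]_x f x) `^ a * (\int[mu]_x g x) `^ b.
Proof.
move=> mf mg a0 b0 ab1.
set F := \int[mu]_x f x; set G := \int[mu]_x g x.
have F0 : 0 <= F by apply: integral_ge0 => x _; exact: mf.2.
have G0 : 0 <= G by apply: integral_ge0 => x _; exact: mg.2.
have RHS0 : 0 <= F `^ a * G `^ b by rewrite mule_ge0// poweR_ge0.
have [Fz|Fn0] := eqVneq F 0; first by rewrite hoelder_zero.
have [Gz|Gn0] := eqVneq G 0.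
  under eq_integral do rewrite muleC.
  by rewrite hoelder_zero.
have Fgt0 : 0 < F by rewrite lt0e Fn0.
have Ggt0 : 0 < G by rewrite lt0e Gn0.
have [Fy|Fny] := eqVneq F +oo.
  by rewrite Fy poweRyr ?gt_eqF// gt0_mulye ?leey// poweR_gt0.
have [Gy|Gny] := eqVneq G +oo.
  by rewrite Gy poweRyr ?gt_eqF// gt0_muley ?leey// poweR_gt0.
have Ffin : F \is a fin_num by rewrite ge0_fin_numE// ltey.
have Gfin : G \is a fin_num by rewrite ge0_fin_numE// ltey.
have fF0 : (0 < fine F)%R by rewrite fine_gt0// Fgt0 ltey.
have fG0 : (0 < fine G)%R by rewrite fine_gt0// Ggt0 ltey.
pose u x := (fine F)^-1%:E * f x; pose v x := (fine G)^-1%:E * g x.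
have fE x : f x = F * u x.
  by rewrite /u muleA -{1}(fineK Ffin) -EFinM divff ?gt_eqF// mul1e.
have gE x : g x = G * v x.
  by rewrite /v muleA -{1}(fineK Gfin) -EFinM divff ?gt_eqF// mul1e.
have mu_ : nnmeasurable u.
  by apply: nnmeasurableM mf; apply: nnmeasurable_cst; rewrite lee_fin invr_ge0 ltW.
have mv_ : nnmeasurable v.
  by apply: nnmeasurableM mg; apply: nnmeasurable_cst; rewrite lee_fin invr_ge0 ltW.
under eq_integral => x _.
  rewrite fE gE (@poweRM _ F (u x) a F0 (mu_.2 x)).
  rewrite (@poweRM _ G (v x) b G0 (mv_.2 x)) muleACA; over.
have muv : nnmeasurable (fun x => u x `^ a * v x `^ b).
  by apply: nnmeasurableM; exact: nnmeasurable_poweR.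
rewrite nnintegralZl//.
rewrite -[leRHS]mule1; apply: lee_wpmul2l => //.
apply: (@le_trans _ _ (\int[mu]_x (a%:E * u x + b%:E * v x))).
  apply: le_ge0_integral => x; first exact: muv.2.
  by apply: young_poweR => //; [exact: mu_.2|exact: mv_.2].
have c0 (c : R) : (0 < c)%R -> 0 <= c%:E by move=> ?; rewrite lee_fin ltW.
rewrite nnintegralD ?nnintegralZl ?c0 ?invr_gt0//; first last.
- by apply: nnmeasurableM mv_; apply: nnmeasurable_cst; exact: c0.
- by apply: nnmeasurableM mu_; apply: nnmeasurable_cst; exact: c0.
rewrite -/F -/G -{2}(fineK Ffin) -{2}(fineK Gfin) -!EFinM.
by rewrite !mulVf ?gt_eqF// !mulr1 -EFinD ab1.
Qed.

(** Induction on the list: the head has exponent w_i, the rest is a product with exponents w_j / (1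
    - w_i) raised to the power 1 - w_i. The case w_i = 1, where this rescaling is impossible, forces
    the remaining exponents to be 0. *)
Lemma hoelder_prod (I : Type) (r : seq I) (P : pred I) (w : I -> R)
    (f : I -> T -> \bar R) :
  (forall i, P i -> nnmeasurable (f i)) -> (forall i, P i -> 0 <= w i)%R ->
  (\sum_(i <- r | P i) w i = 1)%R ->
  \int[mu]_x \big[mule/1]_(i <- r | P i) (f i x `^ w i) <=
  \big[mule/1]_(i <- r | P i) ((\int[mu]_x f i x) `^ w i).
Proof.
move=> mf; elim: r w => [w _|i r IH w w0].
  by rewrite big_nil => /eqP; rewrite eq_sym oner_eq0.
rewrite !big_cons; under eq_integral do rewrite big_cons.
case: ifPn => Pi; last by move=> w1; exact: IH.
have [w1|w1] := eqVneq (w i) 1%R; last first => wE.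
  have wi0 := w0 _ Pi.
  have s0 : (0 <= \sum_(j <- r | P j) w j)%R by exact: sumr_ge0.
  have wi_lt1 : (w i < 1)%R by rewrite lt_neqAle w1/=; lra.
  have s_gt0 : (0 < 1 - w i)%R by lra.
  have sE : (\sum_(j <- r | P j) w j = 1 - w i)%R by lra.
  have sum1 : (\sum_(j <- r | P j) (w j / (1 - w i)) = 1)%R.
    by rewrite -mulr_suml sE divff// gt_eqF.
  pose g x := \big[mule/1]_(j <- r | P j) (f j x `^ (w j / (1 - w i))).
  have mg : nnmeasurable g.
    by apply: nnmeasurable_prod => j Pj; apply: nnmeasurable_poweR; exact: mf.
  have gE x : \big[mule/1]_(j <- r | P j) (f j x `^ w j) = g x `^ (1 - w i).
    rewrite /g poweR_prod; last by move=> j Pj; exact: poweR_ge0.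
    by apply: eq_bigr => j Pj; rewrite -poweRrM divfK// gt_eqF.
  under eq_integral do rewrite gE.
  have Ig0 : 0 <= \int[mu]_x g x by apply: integral_ge0 => x _; exact: mg.2.
  have IHg : (\int[mu]_x g x) `^ (1 - w i) <=
      \big[mule/1]_(j <- r | P j) (\int[mu]_x f j x) `^ w j.
    apply: (@le_trans _ _ ((\big[mule/1]_(j <- r | P j)
        (\int[mu]_x f j x) `^ (w j / (1 - w i))) `^ (1 - w i))).
      apply: le_poweR => //; [exact: ltW|apply: IH => // j Pj].
      by rewrite divr_ge0 ?w0// ltW.
    rewrite poweR_prod; last by move=> j Pj; exact: poweR_ge0.
    by under eq_bigr => j Pj do rewrite -poweRrM divfK ?gt_eqF//.
  have [wi00|wi00] := eqVneq (w i) 0%R.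
    rewrite wi00 poweRe0 mul1e.
    under eq_integral do rewrite poweRe0 mul1e subr0 poweRe1 ?mg.2//.
    by move: IHg; rewrite wi00 subr0 poweRe1.
  apply: (le_trans (hoelder_poweR _ mg _ _ _)) => //.
  - exact: mf.
  - by rewrite lt_neqAle eq_sym wi00.
  - by lra.
  - by apply: lee_wpmul2l => //; exact: poweR_ge0.
have s0 : (\sum_(j <- r | P j) w j = 0)%R by lra.
have all0 (h : I -> \bar R) : \big[mule/1]_(j <- r | P j) (h j `^ w j) = 1.
  elim: {IH wE} r s0 => [|j r IHr]; first by rewrite !big_nil.
  rewrite !big_cons; case: ifPn => // Pj s0.
  have wj0 := w0 _ Pj.
  have s0' : (0 <= \sum_(j <- r | P j) w j)%R by exact: sumr_ge0.
  have -> : w j = 0%R by lra.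
  by rewrite poweRe0 mul1e IHr//; lra.
rewrite all0 mule1 w1; under eq_integral do rewrite all0 mule1.
rewrite poweRe1; last by apply: integral_ge0 => x _; exact: (mf _ Pi).2.
by under eq_integral do rewrite poweRe1 ?(mf _ Pi).2//.
Qed.

End hoelder.

(** * Iterated integrals over coordinates *)

Lemma nnfubini d1 d2 (T1 : measurableType d1) (T2 : measurableType d2)
    (R : realType) (m1 : {sigma_finite_measure set T1 -> \bar R})
    (m2 : {sigma_finite_measure set T2 -> \bar R}) (f : T1 -> T2 -> \bar R) :
  nnmeasurable (fun z => f z.1 z.2) ->
  \int[m1]_x \int[m2]_y f x y = \int[m2]_y \int[m1]_x f x y.
Proof. by move=> [mf f0]; rewrite (fubini_tonelli (fun z => f z.1 z.2)). Qed.

Lemma nnintegral_pushforward d1 d2 (T1 : measurableType d1)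
    (T2 : measurableType d2) (R : realType) (mu : {measure set T1 -> \bar R})
    (phi : T1 -> T2) (f : T2 -> \bar R) :
  measurable_fun setT phi -> nnmeasurable f ->
  \int[pushforward mu phi]_y f y = \int[mu]_x f (phi x).
Proof.
move=> mphi [mf f0].
by rewrite (ge0_integral_pushforward mphi)// preimage_setT.
Qed.

Lemma integral_rV_cons (R : realType) n (F : 'rV[R]_(1 + n) -> \bar R) :
  nnmeasurable F ->
  \int[lebesgue_rV n.+1]_w F w =
  \int[lebR]_s \int[lebesgue_rV n]_w F (rV_cons (s, w)).
Proof.
move=> mF.
rewrite -(fubini_tonelli1 (fun z => F (rV_cons z))).
- exact: (nnintegral_pushforward (lebR \x lebesgue_rV n)%E (@measurable_rV_cons R n) mF).
- exact: (nnmeasurable_comp (@measurable_rV_cons R n) mF).1.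
- by move=> z; exact: mF.2.
Qed.

Section coordinates.
Variables (R : realType) (N : nat).
Implicit Types (v w : 'rV[R]_N) (i j : 'I_N) (F G : 'rV[R]_N -> \bar R).
Implicit Types (l : seq 'I_N).

Definition upd v i (s : R) : 'rV[R]_N := \row_j (if j == i then s else v 0%R j).

Lemma updE v i s j : upd v i s 0%R j = if j == i then s else v 0%R j.
Proof. by rewrite mxE. Qed.

Lemma upd_id v i s s' : upd (upd v i s) i s' = upd v i s'.
Proof. by apply/rowP => j; rewrite !updE; case: eqP. Qed.

Lemma updC v i j s s' : i != j -> upd (upd v i s) j s' = upd (upd v j s') i s.
Proof.
move=> ij; apply/rowP => k; rewrite !updE.
by case: (eqVneq k j) => // ->; rewrite eq_sym (negbTE ij).
Qed.

Lemma measurable_upd i :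
  measurable_fun setT (fun z : 'rV[R]_N * R => upd z.1 i z.2).
Proof.
apply: measurable_fun_mx => k j.
under eq_fun do rewrite mxE.
case: (j == i); first exact: measurable_snd.
exact: (measurableT_comp (measurable_entry 0%R j) measurable_fst).
Qed.

Lemma measurable_updr v i : measurable_fun setT (upd v i).
Proof. exact: (measurableT_comp (measurable_upd i) (measurable_pair1 v)). Qed.

(** The result of a partial integration is kept as a function of the whole vector, constant in the
    integrated coordinates. Tonelli then becomes a permutation of a list of coordinates
    ([pints_perm]), and a function that misses a variable is simply one that is [indep] of it. *)
Definition indep i F := forall v s, F (upd v i s) = F v.

Definition pint i F : 'rV[R]_N -> \bar R := fun v => \int[lebR]_s F (upd v i s).

Definition pints l F : 'rV[R]_N -> \bar R := foldr pint F l.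

Lemma pints_cons i l F : pints (i :: l) F = pint i (pints l F).
Proof. by []. Qed.

Lemma nnmeasurable_upd F v i : nnmeasurable F -> nnmeasurable (fun s => F (upd v i s)).
Proof. by move=> mF; apply: nnmeasurable_comp mF; exact: measurable_updr. Qed.

Lemma nnmeasurable_pint i F : nnmeasurable F -> nnmeasurable (pint i F).
Proof.
move=> mF; split; last first.
  by move=> v; apply: nnintegral_ge0; exact: nnmeasurable_upd.
have [mf f0] := nnmeasurable_comp (measurable_upd i) mF.
exact: (@measurable_fun_fubini_tonelli_F _ _ _ _ _ lebR
  (fun z : 'rV[R]_N * R => F (upd z.1 i z.2))).
Qed.

Lemma nnmeasurable_pints l F : nnmeasurable F -> nnmeasurable (pints l F).
Proof. by move=> mF; elim: l => //= i l; exact: nnmeasurable_pint. Qed.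

Lemma pintC i j F : nnmeasurable F -> pint i (pint j F) = pint j (pint i F).
Proof.
move=> mF; have [->//|ij] := eqVneq i j.
apply/funext => v; rewrite /pint.
have mup : measurable_fun setT (fun z : R * R => upd (upd v i z.1) j z.2).
  apply: (measurableT_comp (measurable_upd j)
    (g := fun z : R * R => (upd v i z.1, z.2))).
  apply: measurable_fun_pair; last exact: measurable_snd.
  exact: (measurableT_comp (measurable_updr v i) measurable_fst).
have := nnmeasurable_comp mup mF.
move/(nnfubini lebR lebR (f := fun s s' => F (upd (upd v i s) j s'))).
move=> ->.
by apply: eq_integral => s _; apply: eq_integral => s' _; rewrite updC.
Qed.

Lemma le_pint i F G : nnmeasurable F -> (forall v, F v <= G v) ->
  forall v, pint i F v <= pint i G v.
Proof. by move=> [_ F0] FG v; apply: le_ge0_integral. Qed.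

Lemma le_pints l F G : nnmeasurable F -> (forall v, F v <= G v) ->
  forall v, pints l F v <= pints l G v.
Proof.
move=> mF FG; elim: l => //= i l IH v.
by apply: le_pint => //; exact: nnmeasurable_pints.
Qed.

Lemma pintD i F G : nnmeasurable F -> nnmeasurable G ->
  pint i (fun v => F v + G v) = fun v => pint i F v + pint i G v.
Proof.
move=> mF mG; apply/funext => v; rewrite /pint.
by rewrite -nnintegralD//; exact: nnmeasurable_upd.
Qed.

Lemma pintsD l F G : nnmeasurable F -> nnmeasurable G ->
  pints l (fun v => F v + G v) = fun v => pints l F v + pints l G v.
Proof.
move=> mF mG; elim: l => //= i l ->.
by rewrite pintD//; exact: nnmeasurable_pints.
Qed.

Lemma pints_ge0 l F v : nnmeasurable F -> 0 <= pints l F v.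
Proof. by move=> mF; have [] := nnmeasurable_pints l mF. Qed.

Lemma pints_cat l l' F : pints (l ++ l') F = pints l (pints l' F).
Proof. by rewrite /pints foldr_cat. Qed.

Lemma pint_pints i l F : nnmeasurable F -> pint i (pints l F) = pints l (pint i F).
Proof.
move=> mF; elim: l => //= j l IH.
by rewrite pintC ?IH//; exact: nnmeasurable_pints.
Qed.

Lemma pints_perm l l' F : nnmeasurable F -> perm_eq l l' -> pints l F = pints l' F.
Proof.
move=> mF; elim: l l' => [|i l IH] l'.
  by move=> /perm_size /esym/size0nil ->.
move=> ill'; have il' : i \in l' by rewrite -(perm_mem ill') mem_head.
have ll' : perm_eq l (rem i l').
  by rewrite -(perm_cons i) (perm_trans ill')// perm_to_rem.
rewrite /= (IH _ ll') {IH ill' ll' l}.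
elim: l' il' => //= j l' IH; rewrite inE eq_sym.
have [->//|ji /= il'] := eqVneq j i.
by rewrite /= pintC ?IH//; exact: nnmeasurable_pints.
Qed.

Lemma indep_pint_same i F : indep i (pint i F).
Proof. by move=> v s; rewrite /pint; apply: eq_integral => s' _; rewrite upd_id. Qed.

Lemma indep_pint i j F : indep i F -> indep i (pint j F).
Proof.
move=> iF; have [->|ij] := eqVneq i j; first exact: indep_pint_same.
by move=> v s; apply: eq_integral => s' _; rewrite updC.
Qed.

Lemma indep_pints i l F : indep i F -> indep i (pints l F).
Proof. by move=> iF; elim: l => //= j l; exact: indep_pint. Qed.

Lemma pintZl i (C : 'rV[R]_N -> \bar R) F : indep i C -> (forall v, 0 <= C v) ->
  nnmeasurable F -> pint i (fun v => C v * F v) = fun v => C v * pint i F v.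
Proof.
move=> iC C0 mF; apply/funext => v; rewrite /pint.
under eq_integral do rewrite iC.
by rewrite nnintegralZl//; exact: nnmeasurable_upd.
Qed.

Lemma pintsZl l (C : 'rV[R]_N -> \bar R) F : (forall i, i \in l -> indep i C) ->
  (forall v, 0 <= C v) ->
  nnmeasurable F -> pints l (fun v => C v * F v) = fun v => C v * pints l F v.
Proof.
move=> iC C0 mF; elim: l iC => //= i l IH iC.
rewrite IH; last by move=> j jl; apply: iC; rewrite inE jl orbT.
by apply: pintZl => //; [apply: iC; rewrite mem_head|exact: nnmeasurable_pints].
Qed.

Lemma pint_indep_cst i F : indep i F -> nnmeasurable F ->
  forall (C : 'rV[R]_N -> \bar R), nnmeasurable C ->
  pint i (fun v => C v * F v) = fun v => pint i C v * F v.
Proof.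
move=> iF mF C mC; under eq_fun do rewrite muleC.
by rewrite pintZl// ?mF.2//; [apply/funext => v; rewrite muleC|exact: mF.2].
Qed.

Lemma hoelder_pint i (I : Type) (r : seq I) (P : pred I) (p : I -> R)
    (f : I -> 'rV[R]_N -> \bar R) v :
  (forall k, P k -> nnmeasurable (f k)) -> (forall k, P k -> 0 <= p k)%R ->
  (\sum_(k <- r | P k) p k = 1)%R ->
  pint i (fun v => \big[mule/1]_(k <- r | P k) (f k v `^ p k)) v <=
  \big[mule/1]_(k <- r | P k) (pint i (f k) v `^ p k).
Proof.
move=> mf p0 p1.
apply: (hoelder_prod lebR (f := fun k s => f k (upd v i s))) => // k Pk.
by apply: nnmeasurable_upd; exact: mf.
Qed.

Lemma hoelder_pints l (I : Type) (r : seq I) (P : pred I) (p : I -> R)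
    (f : I -> 'rV[R]_N -> \bar R) v :
  (forall k, P k -> nnmeasurable (f k)) -> (forall k, P k -> 0 <= p k)%R ->
  (\sum_(k <- r | P k) p k = 1)%R ->
  pints l (fun v => \big[mule/1]_(k <- r | P k) (f k v `^ p k)) v <=
  \big[mule/1]_(k <- r | P k) (pints l (f k) v `^ p k).
Proof.
move=> mf p0 p1; elim: l v => //= i l IH v.
apply: (@le_trans _ _ (pint i
    (fun v => \big[mule/1]_(k <- r | P k) (pints l (f k) v `^ p k)) v)).
  apply: le_pint => //; apply: nnmeasurable_pints; apply: nnmeasurable_prod => k Pk.
  by apply: nnmeasurable_poweR; exact: mf.
by apply: hoelder_pint => // k Pk; apply: nnmeasurable_pints; exact: mf.
Qed.

Lemma hoelder_pints3 l (f g h : 'rV[R]_N -> \bar R) v (a b c : R) :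
  nnmeasurable f -> nnmeasurable g -> nnmeasurable h ->
  (0 <= a)%R -> (0 <= b)%R -> (0 <= c)%R -> (a + b + c = 1)%R ->
  pints l (fun v => f v `^ a * (g v `^ b * h v `^ c)) v <=
  pints l f v `^ a * (pints l g v `^ b * pints l h v `^ c).
Proof.
move=> mf mg mh a0 b0 c0 abc.
(* The third function and its exponent are the default values of [nth], so that every index from 2
   on is harmless. *)
pose F (k : nat) := nth h [:: f; g] k; pose p (k : nat) := nth c [:: a; b] k.
have mF k : nnmeasurable (F k) by case: k => [|[|k]] //; rewrite /F /= nth_nil.
have p0 k : (0 <= p k)%R by case: k => [|[|k]] //; rewrite /p /= nth_nil.
have p1 : (\sum_(k <- iota 0 3) p k = 1)%R by rewrite !big_cons big_nil /p/= addr0 addrA.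
have := @hoelder_pints l _ (iota 0 3) xpredT p F v (fun k _ => mF k) (fun k _ => p0 k) p1.
rewrite !big_cons big_nil mule1; apply: le_trans; rewrite le_eqVlt; apply/orP; left.
by apply/eqP; congr (pints _ _ _); apply/funext => w; rewrite !big_cons big_nil mule1.
Qed.

Lemma eq_pints l F G v :
  (forall w, (forall j, j \notin l -> w 0%R j = v 0%R j) -> F w = G w) ->
  pints l F v = pints l G v.
Proof.
elim: l v => [|i l IH] v FG /=; first by apply: FG.
apply: eq_integral => s _; apply: IH => w wv; apply: FG => j.
rewrite inE negb_or => /andP[ji jl]; rewrite wv// updE (negbTE ji)//.
Qed.

Lemma measurable_addmx (c : 'rV[R]_N) : measurable_fun setT (fun v => v + c)%R.
Proof.
apply: measurable_fun_mx => k j.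
under eq_fun do rewrite mxE.
by apply: measurable_funD => //; exact: measurable_entry.
Qed.

Lemma pint_translate i (c : 'rV[R]_N) F : (forall j, j != i -> c 0%R j = 0%R) ->
  nnmeasurable F -> pint i (fun v => F (v + c)%R) = pint i F.
Proof.
move=> c0 mF; apply/funext => v; rewrite /pint.
have [mf f0] := nnmeasurable_upd v i mF.
rewrite -[RHS](@integral_lebR_shift _ (c 0%R i) _ mf f0).
apply: eq_integral => s _; congr F; apply/rowP => j; rewrite !mxE.
by case: eqVneq => [->//|ji]; rewrite c0// addr0.
Qed.

Lemma pints_translate l (c : 'rV[R]_N) F : (forall j, j \notin l -> c 0%R j = 0%R) ->
  nnmeasurable F -> pints l (fun v => F (v + c)%R) = pints l F.
Proof.
elim: l c F => [|i l IH] c F c0 mF.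
  have -> : c = 0%R by apply/rowP => j; rewrite mxE c0.
  by under eq_fun do rewrite addr0.
pose c1 : 'rV[R]_N := \row_j (if j == i then c 0%R i else 0%R).
have -> : (fun v => F (v + c)%R) = (fun v => (fun v => F (v + c1)%R) (v + (c - c1))%R).
  by apply/funext => v /=; rewrite -addrA subrK.
have mF1 : nnmeasurable (fun v => F (v + c1)%R).
  by apply: nnmeasurable_comp mF; exact: measurable_addmx.
rewrite !pints_cons (IH (c - c1)%R (fun v => F (v + c1)%R))//; last first.
  move=> j jl; rewrite !mxE; have [->|ji] := eqVneq j i; first by rewrite subrr.
  by rewrite subr0 c0// inE negb_or ji.
rewrite pint_pints// pint_translate -?pint_pints//.
by move=> j ji; rewrite mxE (negbTE ji).
Qed.

(** While the coordinates in [l] are integrated the others stay frozen, so the shift [a] is a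
    constant vector supported in [l], and translation invariance applies. *)
Lemma pints_shear l (a : 'rV[R]_N -> 'rV[R]_N) F :
  (forall v j, j \notin l -> a v 0%R j = 0%R) ->
  (forall v w, (forall j, j \notin l -> w 0%R j = v 0%R j) -> a w = a v) ->
  nnmeasurable F -> pints l (fun v => F (v + a v)%R) = pints l F.
Proof.
move=> a0 aE mF; apply/funext => v.
rewrite (@eq_pints _ _ (fun w => F (w + a v)%R)); last first.
  by move=> w /aE ->.
by rewrite pints_translate//; exact: a0.
Qed.

(** [phi] writes [w] into the coordinates [h] of the base point [v]. The base point is general
    because in the induction the coordinate integrated first is absorbed into it. *)
Lemma integral_lebesgue_rV n (h : 'I_n -> 'I_N) (phi : 'rV[R]_n -> 'rV[R]_N) v F :
  (forall (w : 'rV_n) k, phi w 0%R (h k) = w 0%R k) ->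
  (forall (w : 'rV_n) j, j \notin codom h -> phi w 0%R j = v 0%R j) ->
  nnmeasurable F ->
  \int[lebesgue_rV n]_w F (phi w) = pints [seq h k | k <- enum 'I_n] F v.
Proof.
elim: n h phi v => [|n IH] h phi v phih phiv mF.
  rewrite enum_ord0 /=.
  have phiE (w : 'rV_0) : phi w = v.
    apply/rowP => j; rewrite phiv//; apply/codomP => -[[k klt] _].
    by rewrite ltn0 in klt.
  under eq_integral do rewrite phiE.
  by rewrite (@integral_dirac _ _ (0%R : 'rV[R]_0) R setT)// diracT mul1e.
have mphi : measurable_fun setT phi.
  apply: measurable_fun_mx => i j; rewrite ord1.
  have [/codomP[k ->]|jh] := boolP (j \in codom h).
    by under eq_fun do rewrite phih; exact: measurable_entry.
  rewrite (_ : (fun _ => _) = cst (v 0%R j))//.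
  by apply/funext => w /=; rewrite phiv.
have mFphi := nnmeasurable_comp mphi mF.
rewrite (integral_rV_cons (F := fun w : 'rV_(1 + n) => F (phi w)))//.
rewrite enum_ordSl /= -map_comp /pint.
apply: eq_integral => s _.
pose h' (k : 'I_n) := h (lift ord0 k); pose phi' (w : 'rV[R]_n) := phi (rV_cons (s, w)).
have phi'h (w : 'rV[R]_n) (k : 'I_n) : phi' w 0%R (h' k) = w 0%R k.
  rewrite /phi' /h' phih /rV_cons /=.
  have -> : lift ord0 k = rshift 1 k :> 'I_(1 + n) by apply: val_inj.
  exact: (row_mxEr s%:M w 0%R k).
have phi'v (w : 'rV[R]_n) j : j \notin codom h' -> phi' w 0%R j = upd v (h ord0) s 0%R j.
  move=> jh; rewrite /phi' updE; have [->|jh0] := eqVneq j (h ord0).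
    rewrite phih /rV_cons /=.
    have -> : ord0 = lshift n ord0 :> 'I_(1 + n) by apply: val_inj.
    by rewrite [LHS](row_mxEl s%:M w 0%R ord0) mxE.
  rewrite phiv//; apply/codomP => -[k jk].
  case: (unliftP ord0 k) => [k' kk'|k0].
    by move/negP: jh; apply; apply/codomP; exists k'; rewrite jk kk'.
  by move/eqP: jh0; apply; rewrite jk k0.
exact: (IH h' phi' _ phi'h phi'v mF).
Qed.

End coordinates.

(** * Boundedness of the X-ray transform *)

Lemma ge0_integral_lebRE (R : realType) (D : set R) (f : R -> \bar R) :
  measurable D -> measurable_fun D f -> (forall x, D x -> 0 <= f x) ->
  \int[lebR]_(x in D) f x = \int[lebesgue_measure]_(x in D) f x.
Proof.
move=> mD mf f0.
have mid : measurable_fun setT (id : measurableTypeR R -> R).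
  by move=> _ A mA; rewrite setTI.
have f0' : {in D, forall x, 0 <= f x} by move=> x /set_mem; exact: f0.
exact: (ge0_integral_pushforward mid (@lebesgue_measure R) mD mf f0').
Qed.

Section kernel.
Variable R : realType.
Implicit Types (s r m : R) (G : R -> \bar R).

(* Junk value: [rkernel 0 = 0] instead of [+oo]; the diagonal is negligible. *)
Definition rkernel r : R := (`|r| `^ (- 3^-1))%R.

Lemma rkernel_ge0 r : (0 <= rkernel r)%R. Proof. exact: powR_ge0. Qed.

Lemma rkernelN r : rkernel (- r)%R = rkernel r.
Proof. by rewrite /rkernel normrN. Qed.

Lemma rkernelM r s : rkernel (r * s)%R = (rkernel r * rkernel s)%R.
Proof. by rewrite /rkernel normrM powRM. Qed.

Lemma rkernel_cube r : (rkernel r ^+ 3 = `|r|^-1)%R.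
Proof.
rewrite -powR_mulrn ?rkernel_ge0// /rkernel -powRrM mulNr mulVf// powR_inv1//.
Qed.

Lemma measurable_rkernel : measurable_fun setT rkernel.
Proof.
apply: (measurableT_comp (measurable_powR _)).
exact: normr_measurable.
Qed.

(** For s nonzero this is |s|^(-2/3) when |s| <= 1 and |s|^(-2) otherwise, integrable both at 0 and
    at infinity. Written with integer powers of [rkernel], it makes the estimates of
    [hkernel_bounds] polynomial. *)
Definition hkernel s : R :=
  if (1 <= rkernel s)%R then (rkernel s ^+ 2)%R else (rkernel s ^+ 6)%R.

Lemma hkernel_ge0 s : (0 <= hkernel s)%R.
Proof. by rewrite /hkernel; case: ifP => _; rewrite exprn_ge0// rkernel_ge0. Qed.

Lemma measurable_hkernel : measurable_fun setT hkernel.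
Proof.
apply: measurable_fun_ifT.
- by apply: measurable_fun_ler => //; exact: measurable_rkernel.
- exact: measurable_funX measurable_rkernel.
- exact: measurable_funX measurable_rkernel.
Qed.

(** The primitive is 3 x^(1/3). As the integrand is singular at 0, the interval is exhausted by
    [1/(n+2), 1]; starting at n+2 keeps these intervals nondegenerate. *)
Lemma integral_powR_near0 :
  \int[lebR]_(x in `]0%R, 1%R]) (x `^ (- (2 / 3)))%:E <= 3%:E :> \bar R.
Proof.
pose a (n : nat) : R := (n.+2%:R^-1)%R.
have a0 n : (0 < a n)%R by rewrite invr_gt0.
have a1 n : (a n < 1)%R by rewrite invf_lt1// ltr1n.
have -> : `]0%R, 1%R]%classic = \bigcup_n `[a n, 1%R]%classic.
  apply/seteqP; split => x /=; last first.
    by move=> [n _ /=]; rewrite !in_itv/= => /andP[ax ->]; rewrite (lt_le_trans (a0 n) ax).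
  rewrite in_itv/= => /andP[x0 x1].
  exists (Num.truncn x^-1)%R => //=; rewrite in_itv/= x1 andbT /a.
  rewrite -[leRHS]invrK lef_pV2 ?posrE ?invr_gt0//.
  by rewrite (le_trans (ltW (truncnS_gt _)))// ler_nat.
have mf n : measurable_fun `[a n, 1%R]%classic (fun x : R => (x `^ (- (2 / 3)))%:E).
  by apply/measurable_EFinP; apply: measurable_funTS; exact: measurable_powR.
have nd : nondecreasing_seq (fun n => `[a n, 1%R]%classic).
  move=> n k nk; apply/subsetPset => x /=; rewrite !in_itv/= => /andP[ax ->].
  by rewrite andbT (le_trans _ ax)// /a lef_pV2 ?posrE// ler_nat.
have cv := ge0_nondecreasing_set_cvg_integral (mu := @lebR R) nd
  (fun n => measurable_itv _) mf (fun n x _ => powR_ge0 x _).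
rewrite -(cvg_lim _ cv)//; apply: lime_le; first exact: cvgP cv.
apply: nearW => n.
rewrite ge0_integral_lebRE//; last by move=> x _; rewrite lee_fin powR_ge0.
rewrite (@continuous_FTC2 R _ (fun x => 3 * x `^ 3^-1)%R (a n) 1%R)//.
- by rewrite -EFinB lee_fin powR1 mulr1 lerBlDr lerDl mulr_ge0// powR_ge0.
- apply: derivable_within_continuous => x; rewrite in_itv/= => /andP[ax _].
  by apply: derivable_powR; rewrite in_itv/= andbT (lt_le_trans _ ax).
- have dF x : (0 < x)%R -> derivable (fun x : R => 3 * x `^ 3^-1)%R x 1.
    by move=> x0; apply: derivableM => //; apply: derivable_powR; rewrite in_itv/= andbT.
  have cF (x : R) : (0 < x)%R -> {for x, continuous (fun x : R => 3 * x `^ 3^-1)%R}.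
    by move=> x0; apply: differentiable_continuous; apply/derivable1_diffP; exact: dF.
  split => [x|  |].
  + by rewrite in_itv/= => /andP[ax _]; apply: dF; exact: lt_trans ax.
  + by apply: cvg_at_right_filter; exact: cF.
  + by apply: cvg_at_left_filter; exact: cF.
- move=> x; rewrite in_itv/= => /andP[ax _].
  have x0 : (0 < x)%R by exact: lt_trans ax.
  rewrite derive1E deriveM//; last by apply: derivable_powR; rewrite in_itv/= andbT.
  rewrite derive_cst scaler0 addr0 -derive1E powR_derive1 ?in_itv/= ?andbT//.
  rewrite /GRing.scale/= mulrA divff// mul1r; congr (_ `^ _)%R; lra.
Qed.

Lemma integral_far :
  \int[lebR]_(x in `[1%R, +oo[) (x `^ (- 2))%:E <= 1 :> \bar R.
Proof.
rewrite ge0_integral_lebRE//; first last.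
- by move=> x _; rewrite lee_fin powR_ge0.
- by apply/measurable_EFinP; apply: measurable_funTS; exact: measurable_powR.
rewrite (@ge0_continuous_FTC2y R _ (fun x => - x `^ (-1))%R 1%R 0%R).
- by rewrite powR1 sub0e -EFinN opprK.
- by move=> x _; exact: powR_ge0.
- apply: derivable_within_continuous => x; rewrite in_itv/= andbT => x1.
  by apply: derivable_powR; rewrite in_itv/= andbT (lt_le_trans _ x1).
- rewrite -oppr0; apply: cvgN.
  apply: (@cvg_trans _ ((fun x : R => x^-1%R) @ +oo%R)).
    apply: near_eq_cvg; near=> x; rewrite powR_inv1//.
  by apply/gtr0_cvgV0; [exact: nbhs_pinfty_gt|exact: cvg_id].
- move=> x x1; apply: derivableN; apply: derivable_powR; rewrite in_itv/= andbT.
  exact: lt_trans x1.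
- apply: cvg_at_right_filter; apply: cvgN.
  have : {for 1%R, continuous (@powR R ^~ (-1)%R)}.
    apply: differentiable_continuous; apply/derivable1_diffP.
    by apply: derivable_powR; rewrite in_itv/= andbT.
  by [].
- move=> x; rewrite in_itv/= andbT => x1.
  have x0 : (0 < x)%R by exact: lt_trans x1.
  have d : derivable (@powR R ^~ (-1)%R) x 1 by apply: derivable_powR; rewrite in_itv/= andbT.
  rewrite derive1E deriveN// -derive1E powR_derive1 ?in_itv/= ?andbT//.
  rewrite mulN1r opprK; congr (_ `^ _)%R; lra.
Unshelve. all: by end_near. Qed.

Lemma integral_hkernel_lty : \int[lebR]_s (hkernel s)%:E < +oo.
Proof.
pose A s : \bar R := ((fun x : R => (x `^ (- (2 / 3)))%:E) \_ `]0%R, 1%R]) s.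
pose B s : \bar R := ((fun x : R => (x `^ (- 2))%:E) \_ `[1%R, +oo[) s.
have mA : nnmeasurable A.
  split; last by move=> s; apply: erestrict_ge0 => x _; rewrite lee_fin powR_ge0.
  apply/(measurable_restrictT _ _).1 => //.
  by apply/measurable_EFinP; apply: measurable_funTS; exact: measurable_powR.
have mB : nnmeasurable B.
  split; last by move=> s; apply: erestrict_ge0 => x _; rewrite lee_fin powR_ge0.
  apply/(measurable_restrictT _ _).1 => //.
  by apply/measurable_EFinP; apply: measurable_funTS; exact: measurable_powR.
have mAB : nnmeasurable (fun s => A s + B s) by exact: nnmeasurableD.
have mABN : nnmeasurable (fun s => A (-1 * s)%R + B (-1 * s)%R).
  by apply: nnmeasurable_comp mAB; exact: measurable_funM.
have IAB : \int[lebR]_s (A s + B s) <= 4%:E.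
  rewrite nnintegralD// (_ : 4 = 3 + 1)%R; last by ring.
  by rewrite EFinD leeD// -integral_mkcond ?integral_powR_near0 ?integral_far.
apply: (@le_lt_trans _ _ (4%:E + 4%:E)); last by rewrite -EFinD ltry.
apply: (@le_trans _ _ (\int[lebR]_s ((A s + B s) + (A (-1 * s)%R + B (-1 * s)%R)))).
  apply: le_ge0_integral => s; first by rewrite lee_fin hkernel_ge0.
  have pos (t : R) : (0 < t)%R -> (hkernel t)%:E <= A t + B t.
    move=> t0.
    have rE : rkernel t = (t `^ (- 3^-1))%R by rewrite /rkernel gtr0_norm.
    have r2 : (rkernel t ^+ 2 = t `^ (- (2 / 3)))%R.
      by rewrite rE -powR_mulrn ?powR_ge0// -powRrM; congr (_ `^ _)%R; lra.
    have r6 : (rkernel t ^+ 6 = t `^ (- 2))%R.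
      by rewrite rE -powR_mulrn ?powR_ge0// -powRrM; congr (_ `^ _)%R; lra.
    rewrite /hkernel; case: ifPn => [r1|].
      suff t1 : (t <= 1)%R.
        apply: (@le_trans _ _ (A t)); last by rewrite leeDl// mB.2.
        by rewrite /A patchE mem_setE in_itv/= t0 t1 r2.
      have := rkernel_cube t; rewrite gtr0_norm// => r3.
      rewrite -[leLHS]invrK -r3 invf_le1 ?exprn_ege1// exprn_gt0//.
      exact: lt_le_trans r1.
    rewrite -ltNge => r1.
    suff t1 : (1 <= t)%R.
      apply: (@le_trans _ _ (B t)); last by rewrite leeDr// mA.2.
      by rewrite /B patchE mem_setE in_itv/= t1 r6.
    have := rkernel_cube t; rewrite gtr0_norm// => r3.
    rewrite -[leRHS]invrK -r3 invf_ge1 ?exprn_ile1 ?rkernel_ge0 ?ltW//.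
    by rewrite exprn_gt0// rE powR_gt0.
  have AB0 t : 0 <= A t + B t by exact: mAB.2.
  have [s0|s0|<-] := ltgtP 0%R s.
  - by apply: (le_trans (pos _ s0)); rewrite leeDl.
  - have : (0 < - s)%R by rewrite oppr_gt0.
    move=> /pos; rewrite {1}/hkernel rkernelN => /le_trans; apply.
    by rewrite mulN1r leeDr.
  - rewrite /hkernel /rkernel normr0 powR0 ?oppr_eq0 ?invr_eq0//.
    by rewrite ler10 expr0n/= adde_ge0.
rewrite (nnintegralD _ mAB mABN); 
apply: leeD; first exact: IAB.
rewrite (integral_lebR_scale (f := fun s => A s + B s) (a := -1)%R)//; first last.
- exact: mAB.2.
- exact: mAB.1.
by rewrite normrN1 invr1 mul1e.
Qed.

(** The integral of the bound G + M hkernel(M (c - a)): the 1 stands for the integral of [G], and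
    the scaling makes the second term independent of M. *)
Definition hconst : \bar R := 1 + \int[lebR]_s (hkernel s)%:E.

Lemma nnmeasurable_hkernel : nnmeasurable (fun s => (hkernel s)%:E).
Proof.
split; last by move=> s; rewrite lee_fin hkernel_ge0.
by apply/measurable_EFinP; exact: measurable_hkernel.
Qed.

Lemma hconst_ge1 : 1 <= hconst.
Proof. by rewrite leeDl// nnintegral_ge0//; exact: nnmeasurable_hkernel. Qed.

Lemma hconst_lty : hconst < +oo.
Proof. by rewrite lte_add_pinfty ?ltry// integral_hkernel_lty. Qed.

(* With [u], [m], [p] the cube roots of [g], [M], [1 / r]: the bounds of
   [g^(2/3) / r^(2/3)] and [g / r^(1/3)] by [M^(1/3) (g + M hkernel (M r))] for
   [g <= M]. *)
Lemma hkernel_bounds (u m r : R) : (0 <= u)%R -> (u <= m)%R -> (0 < m)%R ->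
  (u ^+ 2 * rkernel r ^+ 2 <= m * (u ^+ 3 + m ^+ 3 * hkernel (m ^+ 3 * r)))%R /\
  (u ^+ 3 * rkernel r <= m * (u ^+ 3 + m ^+ 3 * hkernel (m ^+ 3 * r)))%R.
Proof.
move=> u0 um m0; have m0' := ltW m0; set p := rkernel r.
have p0 : (0 <= p)%R by exact: rkernel_ge0.
have rm : rkernel (m ^+ 3 * r) = (m^-1 * p)%R.
  rewrite rkernelM; congr (_ * _)%R.
  rewrite /rkernel ger0_norm ?exprn_ge0// -powR_mulrn// -powRrM.
  by rewrite mulrN divff// powR_inv1.
rewrite /hkernel rm; set t := (m^-1 * p)%R.
have pE : p = (m * t)%R by rewrite /t mulrA divff ?mul1r// gt_eqF.
have t0 : (0 <= t)%R by rewrite mulr_ge0// invr_ge0.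
rewrite pE {pE rm}; clearbody t; case: ifPn => [t1|]; last rewrite -ltNge => t1.
- split.
  + rewrite mulrDr; apply: ler_wpDl; first by rewrite mulr_ge0 ?exprn_ge0.
    rewrite [leLHS](_ : _ = (u ^+ 2 * m ^+ 2 * t ^+ 2)%R); last by ring.
    rewrite [leRHS](_ : _ = (m ^+ 2 * m ^+ 2 * t ^+ 2)%R); last by ring.
    rewrite ler_wpM2r ?exprn_ge0// ler_wpM2r ?exprn_ge0//.
    by rewrite lerXn2r ?nnegrE.
  + rewrite mulrDr; apply: ler_wpDl; first by rewrite mulr_ge0 ?exprn_ge0.
    rewrite [leRHS](_ : _ = (m ^+ 3 * (m * (t * t)))%R); last by ring.
    apply: ler_pM; rewrite ?exprn_ge0 ?(mulr_ge0 m0' t0)//.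
      by rewrite lerXn2r ?nnegrE.
    by rewrite ler_pM2l// ler_peMl.
- split; last first.
    rewrite mulrDr; apply: ler_wpDr; first by rewrite !mulr_ge0 ?exprn_ge0.
    by rewrite mulrC ler_wpM2r ?exprn_ge0// ler_piMr// ltW.
  (* The two terms on the right balance at u = m t^2: the first suffices above this value, the
     second below it. *)
  have [h|h] := leP (m * t ^+ 2)%R u.
  + rewrite mulrDr; apply: ler_wpDr; first by rewrite !mulr_ge0 ?exprn_ge0.
    rewrite [leLHS](_ : _ = (m * (u ^+ 2 * (m * t ^+ 2)))%R); last by ring.
    rewrite [X in (_ <= m * X)%R]exprSr ler_pM2l//.
    by rewrite ler_wpM2l ?exprn_ge0.
  + rewrite mulrDr; apply: ler_wpDl; first by rewrite mulr_ge0 ?exprn_ge0.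
    rewrite [leRHS](_ : _ = ((m * t ^+ 2) ^+ 2 * (m * t) ^+ 2)%R); last by ring.
    rewrite ler_wpM2r ?exprn_ge0 ?mulr_ge0//.
    by rewrite lerXn2r ?nnegrE ?(ltW h)// mulr_ge0 ?exprn_ge0.
Qed.

(** Common part of [hkernel_integral1] and [hkernel_integral2]: the pointwise bound of
    [hkernel_bounds], with m^3 = M, is integrated by an affine substitution. For M = +oo the
    right-hand side is infinite, and for M = 0 the function [F] vanishes. *)
Lemma hkernel_integral G (M : \bar R) (a : R) (F : R -> \bar R) :
  nnmeasurable G -> \int[lebR]_c G c <= 1 -> 0 <= M -> (forall c, 0 <= F c) ->
  (forall c, M < G c -> F c = 0) -> (forall c, G c = 0 -> F c = 0) ->
  (forall (u m : R) c, (0 <= u)%R -> (u <= m)%R -> (0 < m)%R -> G c = (u ^+ 3)%:E ->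
    F c <= (m * (u ^+ 3 + m ^+ 3 * hkernel (m ^+ 3 * (c - a))))%:E) ->
  \int[lebR]_c F c <= hconst * M `^ (3^-1).
Proof.
move=> mG G1 M0 F0 FM FG Fb.
have hc0 : 0 < hconst by rewrite (lt_le_trans _ hconst_ge1).
case: M M0 FM => [M M0 FM|_ _|//]; last first.
  by rewrite poweRyr ?invr_eq0// gt0_muley// leey.
rewrite lee_fin le_eqVlt in M0; case/predU1P: M0 FM => [<- FM|M0 FM].
  rewrite poweR0r ?invr_eq0// mule0 integral0_eq// => c _.
  have [Gc|Gc] := ltP 0 (G c); first exact: FM.
  by apply: FG; apply/eqP; rewrite eq_le Gc mG.2.
pose m := (M `^ 3^-1)%R.
have m0 : (0 < m)%R by exact: powR_gt0.
have m0' := ltW m0.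
have cK (x : R) : (0 <= x)%R -> ((x `^ 3^-1) ^+ 3 = x)%R.
  by move=> x0; rewrite -powR_mulrn ?powR_ge0// -powRrM mulVf// powRr1.
have m3 : (m ^+ 3 = M)%R by rewrite cK// ltW.
have mh : nnmeasurable (fun c => (hkernel (m ^+ 3 * c + - (m ^+ 3 * a)))%:E).
  apply: nnmeasurable_comp nnmeasurable_hkernel.
  by apply: measurable_funD => //; exact: measurable_funM.
apply: (@le_trans _ _ (\int[lebR]_c (m%:E * (G c + (m ^+ 3)%:E *
    (hkernel (m ^+ 3 * c + - (m ^+ 3 * a)))%:E)))).
  apply: le_ge0_integral => // c.
  have [GM|GM] := leP (G c) M%:E; last first.
    by rewrite FM// mule_ge0 ?lee_fin// adde_ge0 ?mG.2// mule_ge0 ?lee_fin ?hkernel_ge0// exprn_ge0.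
  have := mG.2 c; move: GM (Fb); case GcE : (G c) => [g| |]// + Fbb.
  rewrite !lee_fin => gM g0.
  rewrite -[leRHS]/(m * (g + m ^+ 3 * hkernel (m ^+ 3 * c + - (m ^+ 3 * a))))%:E.
  rewrite -(cK _ g0).
  rewrite -mulrBr; apply: Fbb => //; first exact: powR_ge0.
    by apply: ge0_ler_powR; rewrite ?nnegrE ?invr_ge0// ltW.
  by rewrite GcE cK.
have m30 : 0 <= (m ^+ 3)%:E by rewrite lee_fin exprn_ge0.
have mh' : nnmeasurable (fun c => (m ^+ 3)%:E * (hkernel (m ^+ 3 * c + - (m ^+ 3 * a)))%:E).
  by apply: nnmeasurableM mh; exact: nnmeasurable_cst.
rewrite nnintegralZl ?lee_fin//; last exact: nnmeasurableD.
rewrite nnintegralD// nnintegralZl//.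
rewrite (integral_lebR_affine _ (f := fun s => (hkernel s)%:E)); first last.
- exact: nnmeasurable_hkernel.2.
- exact: nnmeasurable_hkernel.1.
- by rewrite expf_neq0// gt_eqF.
rewrite muleA -EFinM ger0_norm ?exprn_ge0// divff ?expf_neq0 ?gt_eqF// mul1e.
rewrite muleC; apply: lee_wpmul2r; first by rewrite lee_fin.
by rewrite leeD2r.
Qed.

Lemma hkernel_integral2 G (M : \bar R) (a : R) :
  nnmeasurable G -> \int[lebR]_c G c <= 1 -> 0 <= M ->
  \int[lebR]_c (if G c <= M then G c `^ (2 / 3) * (rkernel (c - a) ^+ 2)%:E else 0)
  <= hconst * M `^ (3^-1).
Proof.
move=> mG G1 M0; apply: (hkernel_integral (G := G) (a := a)) => //.
- by move=> c; case: ifP => // _; rewrite mule_ge0 ?poweR_ge0 ?lee_fin ?exprn_ge0 ?rkernel_ge0.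
- by move=> c; rewrite ltNge => /negbTE ->.
- by move=> c ->; rewrite poweR0r ?mul0e ?if_same// mulf_neq0// invr_eq0.
move=> u m c u0 um m0 ->; have m0' := ltW m0; case: ifP => _; last first.
  by rewrite lee_fin mulr_ge0// addr_ge0 ?mulr_ge0 ?exprn_ge0 ?hkernel_ge0.
have u2 : ((u ^+ 3) `^ (2 / 3) = u ^+ 2)%R.
  by rewrite -!powR_mulrn// -powRrM; congr (_ `^ _)%R; lra.
by rewrite poweR_EFin u2 -EFinM lee_fin; exact: (hkernel_bounds (c - a) u0 um m0).1.
Qed.

Lemma hkernel_integral1 G (M : \bar R) (a : R) :
  nnmeasurable G -> \int[lebR]_c G c <= 1 -> 0 <= M ->
  \int[lebR]_c (if G c <= M then G c * (rkernel (c - a))%:E else 0)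
  <= hconst * M `^ (3^-1).
Proof.
move=> mG G1 M0; apply: (hkernel_integral (G := G) (a := a)) => //.
- by move=> c; case: ifP => // _; rewrite mule_ge0 ?mG.2 ?lee_fin ?rkernel_ge0.
- by move=> c; rewrite ltNge => /negbTE ->.
- by move=> c ->; rewrite mul0e if_same.
move=> u m c u0 um m0 ->; have m0' := ltW m0; case: ifP => _; last first.
  by rewrite lee_fin mulr_ge0// addr_ge0 ?mulr_ge0 ?exprn_ge0 ?hkernel_ge0.
by rewrite -EFinM lee_fin; exact: (hkernel_bounds (c - a) u0 um m0).2.
Qed.

End kernel.

Lemma nnmeasurable_if_le d (T : measurableType d) (R : realType)
    (f g h : T -> \bar R) : nnmeasurable f -> nnmeasurable g -> nnmeasurable h ->
  nnmeasurable (fun x => if f x <= g x then h x else 0).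
Proof.
move=> [mf f0] [mg g0] [mh h0]; split; last by move=> x; case: ifP.
apply: measurable_fun_ifT => //.
apply: (measurable_fun_bool true).
(* Where both values are +oo, the difference is +oo + -oo = -oo, so the point is correctly
   counted. *)
have -> : (fun x => f x <= g x) @^-1` [set true] = [set x | f x - g x <= 0].
  apply/seteqP; split => x /=.
    have := f0 x; have := g0 x; case: (f x) => [a| |]; case: (g x) => [b| |]//=.
    by rewrite -EFinB !lee_fin subr_le0.
  have := f0 x; have := g0 x; case: (f x) => [a| |]; case: (g x) => [b| |]//=; rewrite ?leey//.
  by rewrite -EFinB !lee_fin subr_le0.
apply: emeasurable_fun_infty_c => //.
exact: emeasurable_funB.
Qed.

(** * Triple integrals and permutations of their variables *)

Section three_variables.
Variable R : realType.

Definition nn3 (f : R -> R -> R -> \bar R) :=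
  nnmeasurable (fun z : R * R * R => f z.1.1 z.1.2 z.2).

Lemma nn3_env N (i j k : 'I_N) f : nn3 f ->
  nnmeasurable (fun v : 'rV[R]_N => f (v 0%R i) (v 0%R j) (v 0%R k)).
Proof.
move=> mf.
apply: (nnmeasurable_comp (h := fun v : 'rV[R]_N =>
  ((v 0%R i, v 0%R j), v 0%R k)) _ mf).
apply: measurable_fun_pair; last exact: measurable_entry.
by apply: measurable_fun_pair; exact: measurable_entry.
Qed.

Lemma pints3E N (i j k : 'I_N) f v : i != j -> i != k -> j != k ->
  pints [:: i; j; k] (fun v : 'rV[R]_N => f (v 0%R i) (v 0%R j) (v 0%R k)) v =
  \int[lebR]_a \int[lebR]_b \int[lebR]_c f a b c.
Proof.
move=> ij ik jk; rewrite /pints/= /pint.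
apply: eq_integral => a _; apply: eq_integral => b _; apply: eq_integral => c _.
by rewrite !updE !eqxx (negbTE ij) (negbTE ik) (negbTE jk).
Qed.

(** The triple integral is read as a coordinate integral over R^3, where [pints_perm] exchanges the
    variables. The two permutations are those that move the distinguished last variable in
    [trilinear_bound]. *)
Lemma nn3_perm (f : R -> R -> R -> \bar R) : nn3 f ->
  \int[lebR]_a \int[lebR]_b \int[lebR]_c f a c b =
    \int[lebR]_a \int[lebR]_b \int[lebR]_c f a b c /\
  \int[lebR]_a \int[lebR]_b \int[lebR]_c f b c a =
    \int[lebR]_a \int[lebR]_b \int[lebR]_c f a b c.
Proof.
move=> mf.
pose i0 : 'I_3 := inord 0; pose i1 : 'I_3 := inord 1; pose i2 : 'I_3 := inord 2.
have i01 : i0 != i1 by rewrite -val_eqE /= !inordK.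
have i02 : i0 != i2 by rewrite -val_eqE /= !inordK.
have i12 : i1 != i2 by rewrite -val_eqE /= !inordK.
have i10 : i1 != i0 by rewrite eq_sym.
have i20 : i2 != i0 by rewrite eq_sym.
have i21 : i2 != i1 by rewrite eq_sym.
split.
  apply: (eq_trans (esym (pints3E (fun a b c => f a c b) 0%R i01 i02 i12))).
  rewrite (@pints_perm _ _ _ [:: i0; i2; i1]); first exact: pints3E.
    exact: nn3_env.
  by rewrite perm_cons; apply/permP => P /=; rewrite addnCA.
apply: (eq_trans (esym (pints3E (fun a b c => f b c a) 0%R i01 i02 i12))).
rewrite (@pints_perm _ _ _ [:: i1; i2; i0]); first exact: pints3E.
  exact: nn3_env.
by rewrite perm_sym; exact: (permEl (perm_rot 1 [:: i0; i1; i2])).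
Qed.

Lemma nn3_swap f : nn3 f -> nn3 (fun a b c => f a c b).
Proof.
apply: (nnmeasurable_comp (h := fun z : R * R * R => ((z.1.1, z.2), z.1.2))).
apply: measurable_fun_pair; last exact: measurableT_comp measurable_snd measurable_fst.
apply: measurable_fun_pair; last exact: measurable_snd.
exact: measurableT_comp measurable_fst measurable_fst.
Qed.

Lemma nn3_rot f : nn3 f -> nn3 (fun a b c => f b c a).
Proof.
apply: (nnmeasurable_comp (h := fun z : R * R * R => ((z.1.2, z.2), z.1.1))).
apply: measurable_fun_pair; last exact: measurableT_comp measurable_fst measurable_fst.
apply: measurable_fun_pair; last exact: measurable_snd.
exact: measurableT_comp measurable_snd measurable_fst.
Qed.

Lemma nn3_add f g : nn3 f -> nn3 g -> nn3 (fun a b c => f a b c + g a b c).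
Proof. exact: nnmeasurableD. Qed.

Lemma nn3_env3 :
  exists i j k : 'I_3, forall f : R -> R -> R -> \bar R,
  \int[lebR]_a \int[lebR]_b \int[lebR]_c f a b c =
  pints [:: i; j; k] (fun v : 'rV[R]_3 => f (v 0%R i) (v 0%R j) (v 0%R k)) 0%R.
Proof.
exists (inord 0), (inord 1), (inord 2) => g.
by rewrite pints3E// -val_eqE /= !inordK.
Qed.

Lemma nn3D f g : nn3 f -> nn3 g ->
  \int[lebR]_a \int[lebR]_b \int[lebR]_c (f a b c + g a b c) =
  \int[lebR]_a \int[lebR]_b \int[lebR]_c f a b c +
  \int[lebR]_a \int[lebR]_b \int[lebR]_c g a b c.
Proof.
move=> mf mg; have [i [j [k E]]] := nn3_env3.
rewrite (E f) (E g) (E (fun a b c => f a b c + g a b c)).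
by rewrite pintsD//; exact: nn3_env.
Qed.

Lemma le_nn3 f g : nn3 f -> (forall a b c, f a b c <= g a b c) ->
  \int[lebR]_a \int[lebR]_b \int[lebR]_c f a b c <=
  \int[lebR]_a \int[lebR]_b \int[lebR]_c g a b c.
Proof.
move=> mf fg; have [i [j [k E]]] := nn3_env3.
by rewrite (E f) (E g); apply: le_pints => //; exact: nn3_env.
Qed.

End three_variables.

Lemma le_addeD3 (R : realType) (x y z : \bar R) : 0 <= x -> 0 <= y -> 0 <= z ->
  [/\ x <= x + y + z, y <= x + y + z & z <= x + y + z].
Proof.
move=> x0 y0 z0; split.
- by rewrite -addeA leeDl// adde_ge0.
- by rewrite addeAC leeDr// adde_ge0.
- by rewrite leeDr// adde_ge0.
Qed.

(** * The trilinear form with the product kernel *)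

Section trilinear.
Variables (R : realType) (G : R -> \bar R).
Hypotheses (mG : nnmeasurable G) (G1 : \int[lebR]_c G c <= 1).

Let C := @hconst R.

Let kk (a b c : R) : R := (rkernel (b - a) * rkernel (c - a) * rkernel (c - b))%R.

Let S a b c := G a `^ (2 / 3) * G b `^ (2 / 3) * G c `^ (2 / 3) * (kk a b c)%:E.

(* By symmetry it suffices to integrate where [G c] is the smallest value. *)
Let S3 a b c := if G c <= G a then if G c <= G b then S a b c else 0 else 0.

(** Up to a constant, this bounds [S3] integrated in c, where G b <= G a: the integration produces
    min(G a, G b)^(1/3), which completes G b^(2/3) to G b. *)
Let T2 a b := if G b <= G a then G a `^ (2 / 3) * (G b * (rkernel (b - a))%:E) else 0.

(** The square of the kernel appears because the product k(c - a) k(c - b) is bounded by k(c - a)^2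
    + k(c - b)^2, which separates a from b. *)
Let U M a c := if G c <= M then G c `^ (2 / 3) * (rkernel (c - a) ^+ 2)%:E else 0.

Let k0 (r : R) : (0 <= rkernel r)%R. Proof. exact: rkernel_ge0. Qed.

Let nn_real d (T : measurableType d) (f : T -> R) : measurable_fun setT f ->
  (forall x, (0 <= f x)%R) -> nnmeasurable (fun x => (f x)%:E).
Proof. by move=> mf f0; split => [|x]; [exact/measurable_EFinP|rewrite lee_fin]. Qed.

Let mk d (T : measurableType d) (f : T -> R) : measurable_fun setT f ->
  measurable_fun setT (fun x => rkernel (f x)).
Proof. by move=> mf; apply: measurableT_comp => //; exact: measurable_rkernel. Qed.

Let nnS : nn3 S.
Proof.
have m11 : measurable_fun setT (fun z : R * R * R => z.1.1).
  exact: measurableT_comp measurable_fst measurable_fst.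
have m12 : measurable_fun setT (fun z : R * R * R => z.1.2).
  exact: measurableT_comp measurable_snd measurable_fst.
have m2 : measurable_fun setT (fun z : R * R * R => z.2) by exact: measurable_snd.
apply: nnmeasurableM; last first.
  apply: nn_real; last by move=> z; rewrite /kk !mulr_ge0.
  by apply: measurable_funM; [apply: measurable_funM|]; apply: mk; exact: measurable_funB.
by apply: nnmeasurableM; [apply: nnmeasurableM|]; apply: nnmeasurable_poweR;
  apply: nnmeasurable_comp mG.
Qed.

Let nnS3 : nn3 S3.
Proof.
have m11 : measurable_fun setT (fun z : R * R * R => z.1.1).
  exact: measurableT_comp measurable_fst measurable_fst.
have m12 : measurable_fun setT (fun z : R * R * R => z.1.2).
  exact: measurableT_comp measurable_snd measurable_fst.
have m2 : measurable_fun setT (fun z : R * R * R => z.2) by exact: measurable_snd.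
apply: (nnmeasurable_if_le (nnmeasurable_comp m2 mG) (nnmeasurable_comp m11 mG)).
exact: (nnmeasurable_if_le (nnmeasurable_comp m2 mG) (nnmeasurable_comp m12 mG)).
Qed.

Let nnT2 : nnmeasurable (fun z : R * R => T2 z.1 z.2).
Proof.
have mG1 := nnmeasurable_comp (@measurable_fst _ _ R R) mG.
have mG2 := nnmeasurable_comp (@measurable_snd _ _ R R) mG.
apply: (nnmeasurable_if_le mG2 mG1).
apply: nnmeasurableM; first exact: nnmeasurable_poweR.
apply: nnmeasurableM => //; apply: nn_real => //; apply: mk.
by apply: measurable_funB; [exact: measurable_snd|exact: measurable_fst].
Qed.

Let nnU M a : 0 <= M -> nnmeasurable (U M a).
Proof.
move=> M0; have mM : nnmeasurable (fun _ : R => M) by exact: nnmeasurable_cst.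
apply: (nnmeasurable_if_le mG mM).
apply: nnmeasurableM; first exact: nnmeasurable_poweR.
apply: nn_real; last by move=> x; rewrite exprn_ge0.
by apply: measurable_funX; apply: mk; exact: measurable_funB.
Qed.

Let C0 : 0 <= C. Proof. by rewrite (le_trans _ (hconst_ge1 _)). Qed.

Let poweR3 x : 0 <= x -> x `^ (2 / 3) * x `^ (3^-1) = x :> \bar R.
Proof.
move=> x0; rewrite -poweRD_ge0//.
by rewrite (_ : 2 / 3 + 3^-1 = 1)%R ?poweRe1//; field.
Qed.

(** With M = G a, [hkernel_integral1] bounds the integral in b by C G a^(1/3). Together with G
    a^(2/3) this gives C G a, whose integral is at most C. *)
Let int_T2 : \int[lebR]_a \int[lebR]_b T2 a b <= C.
Proof.
apply: (@le_trans _ _ (\int[lebR]_a (C * G a))); last first.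
  rewrite nnintegralZl//.
  by apply: le_trans (lee_wpmul2l C0 G1) _; rewrite mule1.
apply: le_ge0_integral => a.
  apply: nnintegral_ge0.
  exact: (nnmeasurable_comp (@measurable_pair1 _ _ R R a) nnT2).
have -> : \int[lebR]_b T2 a b = \int[lebR]_b (G a `^ (2 / 3) *
    (if G b <= G a then G b * (rkernel (b - a))%:E else 0)).
  by apply: eq_integral => b _; rewrite /T2; case: ifP => //; rewrite mule0.
rewrite nnintegralZl ?poweR_ge0//; last first.
  have mM : nnmeasurable (fun _ : R => G a) by apply: nnmeasurable_cst; exact: mG.2.
  apply: (nnmeasurable_if_le mG mM).
  by apply: nnmeasurableM => //; apply: nn_real => //; apply: mk; exact: measurable_funB.
apply: (le_trans (lee_wpmul2l (poweR_ge0 _ _) (hkernel_integral1 a mG G1 (mG.2 a)))).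
by rewrite muleCA poweR3 ?mG.2.
Qed.

(** The integral in c is estimated by [hkernel_integral2] with M = min(G a, G b). One factor C + C
    comes from the two squares of the kernel, the other from the two possible orders of G a and G
    b. *)
Let int_S3 : \int[lebR]_a \int[lebR]_b \int[lebR]_c S3 a b c <= (C + C) * (C + C).
Proof.
have nnT2' : nnmeasurable (fun z : R * R => T2 z.2 z.1).
  apply: (nnmeasurable_comp (h := fun z : R * R => (z.2, z.1)) _ nnT2).
  by apply: measurable_fun_pair; [exact: measurable_snd|exact: measurable_fst].
have nnT a : nnmeasurable (fun b => T2 a b).
  exact: (nnmeasurable_comp (@measurable_pair1 _ _ R R a) nnT2).
have nnT' a : nnmeasurable (fun b => T2 b a).
  exact: (nnmeasurable_comp (@measurable_pair1 _ _ R R a) nnT2').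
have nnI : nnmeasurable (fun a => \int[lebR]_b T2 a b).
  split; last by move=> a; apply: nnintegral_ge0; exact: nnT.
  exact: (measurable_fun_fubini_tonelli_F (m2 := lebR) (fun z => T2 z.1 z.2) nnT2.1 nnT2.2).
have nnI' : nnmeasurable (fun a => \int[lebR]_b T2 b a).
  split; last by move=> a; apply: nnintegral_ge0; exact: nnT'.
  exact: (measurable_fun_fubini_tonelli_F (m2 := lebR) (fun z => T2 z.2 z.1) nnT2'.1 nnT2'.2).
have CC0 : 0 <= C + C by exact: adde_ge0.
have nnS3c a b : nnmeasurable (S3 a b).
  exact: (nnmeasurable_comp (@measurable_pair1 _ _ (R * R)%type R (a, b)) nnS3).
apply: (@le_trans _ _ (\int[lebR]_a ((C + C) * (\int[lebR]_b T2 a b + \int[lebR]_b T2 b a)))); last first.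
  rewrite nnintegralZl//; last exact: nnmeasurableD.
  apply: lee_wpmul2l => //; rewrite nnintegralD//; apply: leeD; first exact: int_T2.
  by rewrite (nnfubini lebR lebR (f := fun a b => T2 b a) nnT2'); exact: int_T2.
apply: le_ge0_integral => a.
  by apply: integral_ge0 => b _; exact: nnintegral_ge0.
rewrite -(nnintegralD _ (nnT a) (nnT' a)) -(nnintegralZl _ CC0 (nnmeasurableD (nnT a) (nnT' a))).
apply: le_ge0_integral => b; first exact: nnintegral_ge0.
pose M := mine (G a) (G b).
have M0 : 0 <= M by rewrite le_min !mG.2.
pose Q := G a `^ (2 / 3) * G b `^ (2 / 3) * (rkernel (b - a))%:E.
have Q0 : 0 <= Q by rewrite !mule_ge0 ?poweR_ge0 ?lee_fin.
apply: (@le_trans _ _ (\int[lebR]_c (Q * (U M a c + U M b c)))).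
  apply: le_ge0_integral => c; first exact: (nnS3c a b).2.
  rewrite /S3; have U0 x : 0 <= U M x c by exact: (nnU x M0).2.
  case: ifPn => [ca|_]; last by rewrite mule_ge0// adde_ge0.
  case: ifPn => [cb|_]; last by rewrite mule_ge0// adde_ge0.
  have cM : G c <= M by rewrite le_min ca.
  rewrite /U cM -ge0_muleDr ?lee_fin ?exprn_ge0//.
  rewrite /S /Q [leRHS]muleA -!muleA; do 2 (apply: lee_wpmul2l; first exact: poweR_ge0).
  rewrite [leRHS]muleCA; apply: lee_wpmul2l; first exact: poweR_ge0.
  rewrite -EFinD -EFinM lee_fin /kk -mulrA ler_wpM2l//.
  by have := sqr_ge0 (rkernel (c - a) - rkernel (c - b))%R;
    have := sqr_ge0 (rkernel (c - a) + rkernel (c - b))%R; nra.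
rewrite nnintegralZl//; last by apply: nnmeasurableD; exact: nnU.
rewrite nnintegralD; [|exact: nnU|exact: nnU].
apply: (@le_trans _ _ (Q * (C * M `^ (3^-1) + C * M `^ (3^-1)))).
  by apply: lee_wpmul2l => //; apply: leeD; exact: hkernel_integral2.
rewrite -ge0_muleDl// muleCA; apply: lee_wpmul2l => //.
have T20 x y : 0 <= T2 x y by exact: nnT2.2 (x, y).
have [ba|ab] := leP (G b) (G a).
  apply: (@le_trans _ _ (T2 a b)); last by rewrite leeDl.
  rewrite /T2 ba /Q /M min_r// muleAC -!muleA lee_wpmul2l ?poweR_ge0// muleA.
  by rewrite poweR3 ?mG.2.
apply: (@le_trans _ _ (T2 b a)); last by rewrite leeDr.
rewrite /T2 (ltW ab) /Q /M (min_l (ltW ab)) muleAC [_ * G b `^ _]muleC -!muleA.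
rewrite lee_wpmul2l ?poweR_ge0//.
by rewrite muleA poweR3 ?mG.2// -rkernelN opprB.
Qed.

(** The integrand is symmetric, and at each point one of the three values of [G] is the smallest, so
    it is bounded by the sum of three copies of [S3] with permuted variables, all with the same
    integral. *)
Lemma trilinear_bound : \int[lebR]_a \int[lebR]_b \int[lebR]_c
  (G a `^ (2 / 3) * G b `^ (2 / 3) * G c `^ (2 / 3) *
    (rkernel (b - a) * rkernel (c - a) * rkernel (c - b))%:E)
  <= (hconst R + hconst R) * (hconst R + hconst R) +
     (hconst R + hconst R) * (hconst R + hconst R) +
     (hconst R + hconst R) * (hconst R + hconst R).
Proof.
have Ssym a b c : S a c b = S a b c.
  rewrite /S [_ * G c `^ _ * _]muleAC; congr (_ * _%:E).
  by rewrite /kk -[X in (_ * X)%R]rkernelN opprB mulrC [(_ * rkernel (b - a))%R]mulrC mulrC.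
have Ssym' a b c : S b c a = S a b c.
  rewrite /S [X in X * _ = _]muleC muleA; congr (_ * _%:E).
  rewrite /kk -(rkernelN (a - b)) -(rkernelN (a - c)) !opprB; ring.
have S3E a b c : G c <= G a -> G c <= G b -> S3 a b c = S a b c.
  by move=> ca cb; rewrite /S3 ca cb.
have nnS3b : nn3 (fun a b c => S3 a c b) by exact: nn3_swap.
have nnS3a : nn3 (fun a b c => S3 b c a) by exact: nn3_rot.
have [swapE rotE] := nn3_perm nnS3.
apply: (@le_trans _ _ (\int[lebR]_a \int[lebR]_b \int[lebR]_c
    (S3 a b c + S3 a c b + S3 b c a))).
  apply: le_nn3; first exact: nnS.
  move=> a b c; rewrite -[leLHS]/(S a b c).
  have S30 x y z : 0 <= S3 x y z by exact: nnS3.2 (x, y, z).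
  have [le1 le2 le3] := le_addeD3 (S30 a b c) (S30 a c b) (S30 b c a).
  have [ca|ac] := leP (G c) (G a); have [cb|bc] := leP (G c) (G b).
  - by rewrite -(S3E _ _ _ ca cb); exact: le1.
  - by rewrite -Ssym -(S3E _ _ _ (le_trans (ltW bc) ca) (ltW bc)); exact: le2.
  - by rewrite -Ssym' -(S3E _ _ _ (le_trans (ltW ac) cb) (ltW ac)); exact: le3.
  - have [ab|ba] := leP (G a) (G b).
      by rewrite -Ssym' -(S3E _ _ _ ab (ltW ac)); exact: le3.
    by rewrite -Ssym -(S3E _ _ _ (ltW ba) (ltW bc)); exact: le2.
have eq_lee (x y : \bar R) : x = y -> x <= y by move=> ->.
have D1 := eq_lee _ _ (nn3D (nn3_add nnS3 nnS3b) nnS3a).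
have D2 := eq_lee _ _ (nn3D nnS3 nnS3b).
have I2 := le_trans (eq_lee _ _ swapE) int_S3.
have I3 := le_trans (eq_lee _ _ rotE) int_S3.
exact: (le_trans D1 (leeD (le_trans D2 (leeD int_S3 I2)) I3)).
Qed.

End trilinear.

(** Finite sets are null. This discards the diagonals, where [rkernel] has its junk value, and later
    the two angles of lines without a slope. *)
Lemma le_nnintegral_lebR_except (R : realType) (L : seq R) (f g : R -> \bar R) :
  nnmeasurable f -> nnmeasurable g -> (forall s, s \notin L -> f s <= g s) ->
  \int[lebR]_s f s <= \int[lebR]_s g s.
Proof.
move=> [mf f0] [mg g0] fg; apply: ae_ge0_le_integral => //.
have cL : countable [set` L].
  by apply: finite_set_countable; exact: finite_seq.
exists [set` L]; split.
- exact: countable_measurable.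
- exact: countable_lebesgue_measure0.
- move=> s /= /not_implyP[_ fgs]; apply/negPn/negP => sL.
  by apply: fgs; exact: fg.
Qed.

Lemma nnmeasurable_affine2 (R : realType) (a : R -> \bar R) (y : R) :
  nnmeasurable a -> nnmeasurable (fun z : R * R => a (z.2 + z.1 * y)%R).
Proof.
apply: (nnmeasurable_comp (h := fun z : R * R => z.2 + z.1 * y)%R).
apply: measurable_funD; first exact: measurable_snd.
by apply: measurable_funM => //; exact: measurable_fst.
Qed.

(** The map from (x, t) to (t + x y1, t + x y2) has Jacobian |y2 - y1|, which is the source of the
    kernel of the trilinear form. It is performed as a translation in t followed by an affine
    substitution in x. *)
Lemma integral_two_lines (R : realType) (a b : R -> \bar R) (y1 y2 : R) :
  nnmeasurable a -> nnmeasurable b -> y1 != y2 ->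
  \int[lebR]_x \int[lebR]_t (a (t + x * y1)%R * b (t + x * y2)%R) =
  (`|y2 - y1|^-1)%:E * (\int[lebR]_s a s * \int[lebR]_s b s).
Proof.
move=> ma mb y12.
have nz : (y2 - y1 != 0)%R by rewrite subr_eq0 eq_sym.
have mab : nnmeasurable (fun z : R * R => a z.2 * b (z.2 + z.1 * (y2 - y1))%R).
  apply: nnmeasurableM; last exact: nnmeasurable_affine2.
  by apply: nnmeasurable_comp ma; exact: measurable_snd.
transitivity (\int[lebR]_x \int[lebR]_t (a t * b (t + x * (y2 - y1))%R)).
  apply: eq_integral => x _.
  have [m0 m1] := nnmeasurable_comp (@measurable_pair1 _ _ R R x) mab.
  rewrite -(integral_lebR_shift (x * y1)%R m0 m1); apply: eq_integral => t _ /=.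
  by congr (_ * b _); ring.
rewrite (nnfubini lebR lebR (f := fun x t => a t * b (t + x * (y2 - y1))%R) mab).
transitivity (\int[lebR]_t (((`|y2 - y1|^-1)%:E * \int[lebR]_s b s) * a t)).
  apply: eq_integral => t _; rewrite nnintegralZl ?ma.2//; last first.
    apply: nnmeasurable_comp mb; apply: measurable_funD => //.
    exact: measurable_funM.
  rewrite [RHS]muleC; congr (_ * _).
  rewrite -(integral_lebR_affine t nz mb.1 mb.2).
  by apply: eq_integral => x _; congr b; ring.
rewrite nnintegralZl//; last by rewrite mule_ge0 ?nnintegral_ge0// lee_fin.
by rewrite -muleA [in RHS](muleC (\int[_]_s a s)).
Qed.

(** * The X-ray transform in slope-intercept form *)

Section xray_bound.
Variables (R : realType) (h : R -> R -> \bar R).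
Hypothesis mh : nnmeasurable (fun z : R * R => h z.1 z.2).

(** The integral of [h] along the line of slope x and intercept t, with respect to the first
    coordinate instead of arc length. *)
Definition xray (x t : R) : \bar R := \int[lebR]_y h y (t + x * y)%R.

Let mh1 y : nnmeasurable (h y).
Proof. exact: (nnmeasurable_comp (@measurable_pair1 _ _ R R y) mh). Qed.

Let G y : \bar R := \int[lebR]_u h y u `^ (3 / 2).

Let mhp : nnmeasurable (fun z : R * R => h z.1 z.2 `^ (3 / 2)).
Proof. exact: nnmeasurable_poweR. Qed.

Let mG : nnmeasurable G.
Proof.
split; last by move=> y; apply: nnintegral_ge0; exact: nnmeasurable_poweR.
exact: (measurable_fun_fubini_tonelli_F (m2 := lebR)
  (fun z => h z.1 z.2 `^ (3 / 2)) mhp.1 mhp.2).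
Qed.

(** The cube of the transform, integrated in (x, t), is an integral over five variables: x, t and
    one parameter for each of three copies of the line. They are made coordinates of one vector in
    order to be permuted. *)
Let X : 'I_5 := inord 0.
Let T : 'I_5 := inord 1.
Let Y1 : 'I_5 := inord 2.
Let Y2 : 'I_5 := inord 3.
Let Y3 : 'I_5 := inord 4.

Let A (i : 'I_5) (v : 'rV[R]_5) := h (v 0%R i) (v 0%R T + v 0%R X * v 0%R i)%R.

Let S (v : 'rV[R]_5) := xray (v 0%R X) (v 0%R T).

Let neqs : [/\ Y1 != X, Y1 != T, Y2 != X, Y2 != T & Y3 != X] /\
  [/\ Y3 != T, Y2 != Y1, Y3 != Y1, Y3 != Y2 & T != X].
Proof. by split; split; rewrite -val_eqE /= !inordK. Qed.

Let mA i : nnmeasurable (A i).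
Proof.
apply: (nnmeasurable_comp (h := fun v : 'rV[R]_5 =>
  (v 0%R i, v 0%R T + v 0%R X * v 0%R i)%R) _ mh).
apply: measurable_fun_pair; first exact: measurable_entry.
apply: measurable_funD; first exact: measurable_entry.
by apply: measurable_funM; exact: measurable_entry.
Qed.

Let pintA i : i != X -> i != T -> pint i (A i) = S.
Proof.
move=> iX iT; apply/funext => v; apply: eq_integral => s _.
by rewrite /A !updE eqxx eq_sym (negbTE iT) eq_sym (negbTE iX).
Qed.

Let indepA i j : i != j -> i != X -> i != T -> indep i (A j).
Proof.
move=> ij iX iT v s; rewrite /A !updE.
by rewrite ![_ == i]eq_sym (negbTE ij) (negbTE iT) (negbTE iX).
Qed.

Let indepS i : i != X -> i != T -> indep i S.
Proof.
by move=> iX iT v s; rewrite /S !updE ![_ == i]eq_sym (negbTE iX) (negbTE iT).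
Qed.

Let A3 v := A Y1 v * A Y2 v * A Y3 v.

Let mA3 : nnmeasurable A3.
Proof. by apply: nnmeasurableM => //; exact: nnmeasurableM. Qed.

Let cubeE : (fun v => S v * S v * S v) = pints [:: Y1; Y2; Y3] A3.
Proof.
have [[n1 n2 n3 n4 n5] [n6 n7 n8 n9 n10]] := neqs.
have mS : nnmeasurable S by rewrite -(pintA n1 n2); exact: nnmeasurable_pint.
rewrite !pints_cons /A3 /=.
rewrite (pintZl (C := fun v => A Y1 v * A Y2 v))//; first last.
- by move=> v; rewrite mule_ge0 ?(mA _).2.
- by move=> v s; rewrite !indepA.
rewrite (pintA n5 n6).
have -> : (fun v => A Y1 v * A Y2 v * S v) = (fun v => A Y1 v * (A Y2 v * S v)).
  by apply/funext => v; rewrite muleA.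
rewrite (pintZl (C := fun v => A Y1 v) (F := fun v => A Y2 v * S v)).
- rewrite (pint_indep_cst (F := S))//; last exact: indepS.
  rewrite (pintA n3 n4) (pint_indep_cst (F := fun v => S v * S v))//.
  + by rewrite (pintA n1 n2); apply/funext => v; rewrite muleA.
  + by move=> v s; rewrite !indepS.
  + exact: nnmeasurableM.
- exact: indepA.
- exact: (mA _).2.
- exact: nnmeasurableM.
Qed.

(** Each of the three factors of [A3] lies in two of the three pairs, so [A3] is the product of the
    square roots of the pairs. Hoelder with exponents 1/3 then calls for the power 3/2 of each pair,
    which [integral_two_lines] integrates exactly. *)
Let B i j v := (A i v * A j v) `^ (3 / 2).

Let mB i j : nnmeasurable (B i j).
Proof. by apply: nnmeasurable_poweR; exact: nnmeasurableM. Qed.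

Let A3E v : A3 v = B Y1 Y2 v `^ 3^-1 * (B Y1 Y3 v `^ 3^-1 * B Y2 Y3 v `^ 3^-1).
Proof.
rewrite /B -!poweRrM (_ : 3 / 2 / 3 = 2^-1)%R; last by field.
rewrite !poweRM ?(mA _).2//.
have sq i : A i v `^ 2^-1 * A i v `^ 2^-1 = A i v.
  rewrite -poweRD_ge0// (_ : 2^-1 + 2^-1 = 1)%R; last by field.
  by rewrite poweRe1// (mA _).2.
rewrite /A3 -[in LHS](sq Y1) -[in LHS](sq Y2) -[in LHS](sq Y3).
move: (A Y1 v `^ _) (A Y2 v `^ _) (A Y3 v `^ _) => a b c.
by rewrite [RHS](AC (2*(2*2)) ((1*3)*(2*5)*(4*6))).
Qed.

Let pintsB (i j : 'I_5) (v : 'rV[R]_5) : [/\ i != X, i != T, j != X & j != T] -> v 0%R i != v 0%R j ->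
  pints [:: X; T] (B i j) v =
  (`|v 0%R j - v 0%R i|^-1)%:E * (G (v 0%R i) * G (v 0%R j)).
Proof.
move=> [iX iT jX jT] vij; have [[_ _ _ _ _] [_ _ _ _ TX]] := neqs.
have E := integral_two_lines (nnmeasurable_poweR (3 / 2) (mh1 (v 0%R i)))
  (nnmeasurable_poweR (3 / 2) (mh1 (v 0%R j))) vij.
apply: eq_trans E.
apply: eq_integral => x _; apply: eq_integral => t _.
rewrite /B /A !updE !eqxx (negbTE iT) (negbTE iX) (negbTE jX) (negbTE jT).
by rewrite [X == T]eq_sym (negbTE TX) poweRM ?(mh1 _).2.
Qed.

Lemma xray_bound : \int[lebR]_y \int[lebR]_u h y u `^ (3 / 2) <= 1 ->
  \int[lebR]_x \int[lebR]_t (xray x t * xray x t * xray x t) <=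
  (hconst R + hconst R) * (hconst R + hconst R) +
  (hconst R + hconst R) * (hconst R + hconst R) +
  (hconst R + hconst R) * (hconst R + hconst R).
Proof.
move=> G1.
have eq_lee (x y : \bar R) : x = y -> x <= y by move=> ->.
have [[n1 n2 n3 n4 n5] [n6 n7 n8 n9 n10]] := neqs.
have -> : \int[lebR]_x \int[lebR]_t (xray x t * xray x t * xray x t) =
    pints [:: X; T] (fun v => S v * S v * S v) 0%R.
  apply: eq_integral => x _; apply: eq_integral => t _.
  by rewrite /S !updE !eqxx [X == T]eq_sym (negbTE n10).
rewrite cubeE -pints_cat.
have m7 : (Y1 == Y2) = false by rewrite eq_sym (negbTE n7).
have m8 : (Y1 == Y3) = false by rewrite eq_sym (negbTE n8).
have m9 : (Y2 == Y3) = false by rewrite eq_sym (negbTE n9).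
have pe : perm_eq ([:: X; T] ++ [:: Y1; Y2; Y3]) ([:: Y1; Y2; Y3] ++ [:: X; T]).
  by rewrite perm_catC.
rewrite (pints_perm mA3 pe).
rewrite pints_cat.
(* Hoelder puts the exponent 1/3 on each |y_i - y_j|^(-1) and on each product of two values of [G];
   every value occurs in two pairs, whence 2/3. *)
pose rho (v : 'rV[R]_5) : \bar R := G (v 0%R Y1) `^ (2 / 3) * G (v 0%R Y2) `^ (2 / 3) *
  G (v 0%R Y3) `^ (2 / 3) * (rkernel (v 0%R Y2 - v 0%R Y1) *
  rkernel (v 0%R Y3 - v 0%R Y1) * rkernel (v 0%R Y3 - v 0%R Y2))%:E.
have mrho : nnmeasurable rho.
  have me i : measurable_fun setT (fun v : 'rV[R]_5 => v 0%R i).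
    exact: measurable_entry.
  have mGe i : nnmeasurable (fun v : 'rV[R]_5 => G (v 0%R i) `^ (2 / 3)).
    by apply: nnmeasurable_poweR; exact: nnmeasurable_comp mG.
  have mk i j : measurable_fun setT (fun v : 'rV[R]_5 => rkernel (v 0%R i - v 0%R j)).
    apply: measurableT_comp; first exact: measurable_rkernel.
    exact: measurable_funB.
  apply: nnmeasurableM; first by apply: nnmeasurableM => //; exact: nnmeasurableM.
  split; last by move=> v; rewrite lee_fin !mulr_ge0 ?rkernel_ge0.
  by apply/measurable_EFinP; apply: measurable_funM => //; exact: measurable_funM.
have bound (v : 'rV[R]_5) : v 0%R Y1 != v 0%R Y2 -> v 0%R Y1 != v 0%R Y3 ->
    v 0%R Y2 != v 0%R Y3 -> pints [:: X; T] A3 v <= rho v.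
  move=> v12 v13 v23.
  have E := congr1 (fun F => pints [:: X; T] F v) (funext A3E).
  apply: (le_trans (eq_lee _ _ E)).
  have w1 : (3^-1 + 3^-1 + 3^-1 = 1 :> R)%R by field.
  have w0 : (0 <= 3^-1 :> R)%R by [].
  apply: (le_trans (hoelder_pints3 [:: X; T] v (mB Y1 Y2) (mB Y1 Y3) (mB Y2 Y3) w0 w0 w0 w1)).
  rewrite (pintsB (And4 n1 n2 n3 n4) v12) (pintsB (And4 n1 n2 n5 n6) v13).
  rewrite (pintsB (And4 n3 n4 n5 n6) v23).
  have G0 i : 0 <= G (v 0%R i) by exact: mG.2.
  have r0 (r : R) : 0 <= (`|r|^-1)%:E by rewrite lee_fin.
  rewrite !poweRM ?mule_ge0//.
  have rE (r : R) : (`|r|^-1)%:E `^ 3^-1 = (rkernel r)%:E.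
    by rewrite poweR_EFin /rkernel -mulN1r powRrM powR_inv1.
  rewrite !rE.
  have g2 i : G (v 0%R i) `^ (2 / 3) = G (v 0%R i) `^ 3^-1 * G (v 0%R i) `^ 3^-1.
    by rewrite -poweRD_ge0//; congr (_ `^ _); field.
  rewrite /rho !g2 !EFinM.
  move: (G _ `^ _) (G _ `^ _) (G _ `^ _) (_%:E) (_%:E) (_%:E) => a b c x y z.
  by rewrite le_eqVlt; apply/orP; left; apply/eqP;
    rewrite [LHS](AC ((1*2)*((1*2)*(1*2))) ((2*5)*(3*8)*(6*9)*(1*4*7))).
have -> : pints [:: Y1; Y2; Y3] (pints [:: X; T] A3) 0%R =
    pint Y1 (pint Y2 (pint Y3 (pints [:: X; T] A3))) 0%R by [].
have mL : nnmeasurable (pints [:: X; T] A3) by exact: nnmeasurable_pints.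
apply: (@le_trans _ _ (pint Y1 (pint Y2 (pint Y3 rho)) 0%R)).
  apply: le_pint => [|v]; first by do 2 apply: nnmeasurable_pint.
  apply: (@le_nnintegral_lebR_except _ [:: v 0%R Y1]).
  - by apply: nnmeasurable_upd; exact: nnmeasurable_pint.
  - by apply: nnmeasurable_upd; exact: nnmeasurable_pint.
  move=> s; rewrite inE => s1.
  apply: (@le_nnintegral_lebR_except _ [:: v 0%R Y1; s]).
  - exact: nnmeasurable_upd.
  - exact: nnmeasurable_upd.
  move=> r; rewrite !inE negb_or => /andP[r1 rs].
  by apply: bound; rewrite !updE ?eqxx ?m7 ?m8 ?m9 eq_sym.
have := @pints3E R 5 Y1 Y2 Y3 (fun a b c => G a `^ (2 / 3) * G b `^ (2 / 3) *
  G c `^ (2 / 3) * (rkernel (b - a) * rkernel (c - a) * rkernel (c - b))%:E) 0%R.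
rewrite m7 m8 m9 => /(_ isT isT isT) E.
exact: (le_trans (eq_lee _ _ E) (trilinear_bound mG G1)).
Qed.

End xray_bound.

(** * The Radon transform in slope-intercept form *)

Section weighted_change_of_variables.
Context d1 d2 (T1 : measurableType d1) (T2 : measurableType d2) (R : realType).
Variables (mu : {measure set T1 -> \bar R}) (nu : {measure set T2 -> \bar R}).
Variables (D : set T1) (g : T1 -> T2) (w : T1 -> R).
Hypotheses (mD : measurable D) (mg : measurable_fun setT g).
Hypotheses (mw : measurable_fun setT w) (w0 : forall x, (0 <= w x)%R).
Hypothesis nuE : forall A, measurable A ->
  \int[mu]_(x in D `&` g @^-1` A) (w x)%:E = nu A.

Import HBNNSimple.

(** By [nuE], [nu] is the image under [g] of the measure of density [w] on [D]. The formula passes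
    from indicators to simple functions by linearity and to [F] by monotone convergence. It serves
    for the tangent substitution and for arc length. *)
Lemma integral_weighted_comp (F : T2 -> \bar R) : nnmeasurable F ->
  \int[mu]_(x in D) ((w x)%:E * F (g x)) = \int[nu]_y F y.
Proof.
move=> [mF F0]; pose f_ := nnsfun_approx measurableT mF.
have mfg n : measurable_fun setT (fun x => f_ n (g x)) by exact: measurableT_comp.
transitivity (limn (fun n => \int[mu]_(x in D) ((w x)%:E * (f_ n (g x))%:E))).
  rewrite -monotone_convergence//.
  - apply: eq_integral => x _; apply/esym/cvg_lim => //.
    by apply: cvgeZl => //; exact: cvg_nnsfun_approx.
  - move=> n; apply: measurable_funTS; apply: emeasurable_funM.
      exact/measurable_EFinP.
    exact/measurable_EFinP.
  - by move=> n x _; rewrite mule_ge0// lee_fin.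
  - move=> x _ m n mn; rewrite lee_wpmul2l ?lee_fin//.
    exact/lefP/nd_nnsfun_approx.
transitivity (limn (fun n => \int[nu]_y (f_ n y)%:E)); last first.
  rewrite -monotone_convergence//.
  - apply: eq_integral => y _; apply/cvg_lim => //; exact: cvg_nnsfun_approx.
  - by move=> n; exact/measurable_EFinP.
  - by move=> n x _; rewrite lee_fin.
  - by move=> x _ m n mn; rewrite lee_fin; exact/lefP/nd_nnsfun_approx.
congr (limn _); apply/funext => n.
have mpre r : measurable (g @^-1` (f_ n @^-1` [set r])).
  by rewrite -[X in measurable X]setTI; exact: mg.
transitivity (\sum_(r \in range (f_ n))
    \int[mu]_(x in D) (r%:E * ((w x)%:E * (\1_(g @^-1` (f_ n @^-1` [set r])) x)%:E))).
  rewrite -ge0_integral_fsum//; last 2 first.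
  - move=> r; apply: measurable_funTS; apply: measurable_funeM.
    apply: emeasurable_funM; exact/measurable_EFinP.
  - move=> r x _; rewrite muleCA mule_ge0 ?lee_fin//.
    exact: (nnfun_muleindic_ge0 (f_ n) r (g x)).
  apply: eq_integral => x _; rewrite {1}fimfunE -fsumEFin// ge0_mule_fsumr.
    by apply: eq_fsbigr => r _; rewrite EFinM muleCA.
  by move=> r; exact: nnfun_muleindic_ge0.
rewrite integralT_nnsfun sintegralE; apply: eq_fsbigr => r /set_mem [y _ fy].
have r0 : (0 <= r)%R by rewrite -fy.
rewrite ge0_integralZl//; first last.
- by move=> x _; rewrite mule_ge0 ?lee_fin.
- by apply: measurable_funTS; apply: emeasurable_funM; exact/measurable_EFinP.
congr (_ * _); rewrite -nuE//.
rewrite integral_mkcondr; apply: eq_integral => x _.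
rewrite patchE indicE; case: ifP => _; first by rewrite mule1.
by rewrite mule0.
Qed.

End weighted_change_of_variables.

(** * The substitution by the tangent *)

Section tangent.
Variable R : realType.
Local Notation I := (`](- (pi / 2))%R, (pi / 2)%R[%classic : set R).

(** Together with [w], a version of tan and of its derivative that is measurable on the whole line;
    they agree with tan and cos^-2 on [I], where the cosine is positive. *)
Let tan' (x : R) : R := (sin x * (cos x) `^ (-1))%R.
Let w (x : R) : R := ((cos x) `^ (- 2))%R.

Let cosI (x : R) : I x -> (0 < cos x)%R.
Proof. by rewrite /= in_itv/= => ?; exact: cos_gt0_pihalf. Qed.

Let tanE (x : R) : I x -> tan' x = tan x.
Proof. by move=> /cosI c; rewrite /tan' powR_inv1 ?ltW. Qed.

Let wE (x : R) : I x -> w x = ((cos x) ^- 2)%R.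
Proof. by move=> /cosI c; rewrite /w powR_invn ?ltW. Qed.

Let msin : measurable_fun setT (@sin R).
Proof. by apply: continuous_measurable_fun; exact: continuous_sin. Qed.

Let mcos : measurable_fun setT (@cos R).
Proof. by apply: continuous_measurable_fun; exact: continuous_cos. Qed.

Let mpcos (a : R) : measurable_fun setT (fun x : R => (cos x) `^ a)%R.
Proof. by apply: (measurableT_comp (measurable_powR _)). Qed.

Let mtan : measurable_fun setT tan'.
Proof. exact: measurable_funM. Qed.

Let wtan_itv (a b : R) : (a < b)%R ->
  \int[lebR]_(x in I `&` tan' @^-1` `]a, b]%classic) (w x)%:E = (b - a)%:E.
Proof.
move=> ab.
have IE x : I (atan x) by rewrite /= in_itv/= atan_gtNpi2 atan_ltpi2.
have -> : I `&` tan' @^-1` `]a, b]%classic = `]atan a, atan b]%classic.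
  apply/seteqP; split => x /=.
    move=> [xI]; rewrite tanE//= !in_itv/= => /andP[ax xb].
    rewrite -(@tanK _ x); last by rewrite inE.
    by rewrite lt_atan// le_atan.
  rewrite !in_itv/= => /andP[ax xb].
  have xI : I x.
    by rewrite /= in_itv/= (lt_trans (atan_gtNpi2 a))// (le_lt_trans xb)// atan_ltpi2.
  split; first by move: xI; rewrite /= in_itv.
  rewrite tanE//= -{1}(atanK a) -{1}(atanK b).
  rewrite (ltr_tan (IE a) xI) ax/=; move: xb; rewrite le_eqVlt => /predU1P[->//|xb].
  by rewrite ltW// (ltr_tan xI (IE b)).
have mwI D : measurable_fun D (fun x => (w x)%:E).
  by apply/measurable_EFinP; apply: measurable_funTS; exact: mpcos.
rewrite ge0_integral_lebRE//; last by move=> x _; rewrite lee_fin powR_ge0.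
rewrite integral_itv_obnd_cbnd//.
have atI x : x \in `[atan a, atan b] -> I x.
  rewrite in_itv/= => /andP[ax xb]; rewrite /= in_itv/=.
  by rewrite (lt_le_trans (atan_gtNpi2 a))// (le_lt_trans xb)// atan_ltpi2.
have dtan x : I x -> derivable (@tan R) x 1.
  by move=> /cosI c; apply: derivable_tan; rewrite gt_eqF.
have ctan x : I x -> {for x, continuous (@tan R)}.
  by move=> /cosI c; apply: continuous_tan; rewrite gt_eqF.
rewrite (@continuous_FTC2 R w (@tan R) (atan a) (atan b)).
- by rewrite !atanK EFinB.
- by rewrite lt_atan.
- apply: continuous_in_subspaceT => x /set_mem /atI/cosI c.
  apply: (@continuous_comp _ _ _ (@cos R) (@powR R ^~ (- 2)%R)).
    exact: continuous_cos.
  apply: differentiable_continuous; apply/derivable1_diffP.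
  by apply: derivable_powR; rewrite in_itv/= andbT.
- split => [x xab|  |].
  + by apply: dtan; apply: atI; apply: subset_itv_oo_cc xab.
  + by apply: cvg_at_right_filter; apply: ctan.
  + by apply: cvg_at_left_filter; apply: ctan.
- move=> x xab.
  have xI : I x by apply: atI; exact: subset_itv_oo_cc xab.
  have c := cosI xI.
  have [_ dE] := @is_derive_tan R x (lt0r_neq0 c).
  by rewrite derive1E dE wE.
Qed.

(** The image under tan of the measure of density cos^-2 on [I] gives ]a, b] the mass b - a, by the
    fundamental theorem of calculus, so it is [lebR]. *)
Lemma integral_tan_substitution (F : R -> \bar R) : nnmeasurable F ->
  \int[lebR]_(x in I) (((cos x) ^- 2)%:E * F (tan x)) = \int[lebR]_y F y.
Proof.
move=> mF.
have mI : measurable I by [].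
have mw : measurable_fun setT w by exact: mpcos.
have w0 x : (0 <= w x)%R by exact: powR_ge0.
have mIt A : measurable A -> measurable (I `&` tan' @^-1` A).
  by move=> mA; apply: measurableI => //; rewrite -[X in measurable X]setTI; exact: mtan.
pose nu A := \int[lebR]_(x in I `&` tan' @^-1` A) (w x)%:E.
have nu0 : nu set0 = 0 by rewrite /nu preimage_set0 setI0 integral_set0.
have nu_ge0 A : 0 <= nu A by apply: integral_ge0 => x _; rewrite lee_fin.
have nu_sa : semi_sigma_additive nu.
  move=> A mA tA mUA; rewrite /nu preimage_bigcup setI_bigcupr.
  rewrite ge0_integral_bigcup//.
  - by apply: is_cvg_ereal_nneg_natsum_cond => n _ _; exact: nu_ge0.
  - by move=> k; exact: mIt.
  - by apply/measurable_EFinP; exact: measurable_funTS.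
  - by move=> x _; rewrite lee_fin.
  - apply/trivIsetP => i j _ _ ij; rewrite setIACA setIid -preimage_setI.
    by move/trivIsetP : tA => -> //; rewrite preimage_set0 setI0.
pose nuM := isMeasure.Build _ _ _ nu nu0 nu_ge0 nu_sa.
pose nu' : {measure set R -> \bar R} := HB.pack nu nuM.
have nuE A : measurable A -> nu' A = lebR A.
  by move=> mA; apply: lebR_unique => // a b ab; exact: wtan_itv.
rewrite -(integral_weighted_comp (mu := lebR) (nu := lebR) mI mtan mw w0 nuE mF).
by apply: eq_integral => x /set_mem xI; rewrite -wE// tanE.
Qed.

End tangent.

Lemma nn_EFin d (T : measurableType d) (R : realType) (f : T -> R) :
  measurable_fun setT f -> (forall x, (0 <= f x)%R) ->
  nnmeasurable (fun x => (f x)%:E).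
Proof. by move=> mf f0; split => [|x]; [exact/measurable_EFinP|rewrite lee_fin]. Qed.

Section radon_xray.
Variables (R : realType) (h : R * R -> R).
Hypotheses (mh : measurable_fun setT h) (h0 : forall z, (0 <= h z)%R).

Let H (y u : R) : \bar R := (h (y, u))%:E.

Let mH : nnmeasurable (fun z : R * R => H z.1 z.2).
Proof.
apply: (nn_EFin (f := fun z : R * R => h (z.1, z.2))) => //.
by apply: (measurableT_comp mh); apply: measurable_fun_pair.
Qed.

Let Phi (x : R) : \bar R := \int[lebR]_t (xray H x t * xray H x t * xray H x t).

Let mxray : nnmeasurable (fun z : R * R => xray H z.1 z.2).
Proof.
have m3 : nnmeasurable (fun z : R * R * R => H z.2 (z.1.2 + z.1.1 * z.2)%R).
  apply: (nnmeasurable_comp (h := fun z : R * R * R => (z.2, z.1.2 + z.1.1 * z.2)%R) _ mH).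
  apply: measurable_fun_pair; first exact: measurable_snd.
  apply: measurable_funD; first exact: (measurableT_comp measurable_snd measurable_fst).
  apply: measurable_funM; last exact: measurable_snd.
  exact: (measurableT_comp measurable_fst measurable_fst).
split.
  exact: (measurable_fun_fubini_tonelli_F (m2 := lebR)
    (fun z : R * R * R => H z.2 (z.1.2 + z.1.1 * z.2)%R) m3.1 m3.2).
by move=> z; apply: nnintegral_ge0; exact: (nnmeasurable_comp (@measurable_pair1 _ _ _ _ z) m3).
Qed.

Let mxray3 : nnmeasurable (fun z : R * R =>
  xray H z.1 z.2 * xray H z.1 z.2 * xray H z.1 z.2).
Proof. by apply: nnmeasurableM => //; exact: nnmeasurableM. Qed.

Let mPhi : nnmeasurable Phi.
Proof.
split; last first.
  move=> x; apply: nnintegral_ge0.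
  exact: (nnmeasurable_comp (@measurable_pair1 _ _ R R x) mxray3).
exact: (measurable_fun_fubini_tonelli_F (m2 := lebR) _ mxray3.1 mxray3.2).
Qed.

Lemma nnmeasurable_radon : nnmeasurable (fun w : (R * R) * R => radon h w).
Proof.
have m4 : measurable_fun setT (fun z : ((R * R) * R) * R =>
    h (z.1.2 * z.1.1.1 - z.2 * z.1.1.2, z.1.2 * z.1.1.2 + z.2 * z.1.1.1)%R).
  apply: (measurableT_comp mh).
  have ms : measurable_fun setT (fun z : ((R * R) * R) * R => z.1.2).
    exact: (measurableT_comp measurable_snd measurable_fst).
  have mr : measurable_fun setT (fun z : ((R * R) * R) * R => z.2) by exact: measurable_snd.
  have m1 : measurable_fun setT (fun z : ((R * R) * R) * R => z.1.1.1).
    apply: (measurableT_comp measurable_fst).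
    exact: (measurableT_comp measurable_fst measurable_fst).
  have m2 : measurable_fun setT (fun z : ((R * R) * R) * R => z.1.1.2).
    apply: (measurableT_comp measurable_snd).
    exact: (measurableT_comp measurable_fst measurable_fst).
  apply: measurable_fun_pair.
    by apply: measurable_funB; exact: measurable_funM.
  by apply: measurable_funD; exact: measurable_funM.
have nn4 := nn_EFin m4 (fun z => h0 _).
split; last by move=> w; apply: integral_ge0 => r _; rewrite lee_fin.
exact: (measurable_fun_fubini_tonelli_F (m2 := lebR) _ nn4.1 nn4.2).
Qed.

Let P (w : (R * R) * R) := radon h w * radon h w * radon h w.

Let mP : nnmeasurable P.
Proof.
have m := nnmeasurable_radon.
by apply: (nnmeasurableM (f := fun w => radon h w * radon h w)) => //; exact: nnmeasurableM.
Qed.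

(* The line of normal direction [phi + pi / 2] is the graph of slope [tan phi]
   over the first axis; [e] is the orientation of the normal. *)
Lemma radon_tan (phi e s : R) : (0 < cos phi)%R -> (e * e = 1)%R ->
  radon h ((- e * sin phi)%R, (e * cos phi)%R, s) =
  ((cos phi)^-1)%:E * xray H (tan phi) (e / cos phi * s)%R.
Proof.
move=> c e1; have cn0 : (cos phi != 0)%R by rewrite gt_eqF.
have en0 : (e != 0)%R by apply: contra_eq_neq e1 => ->; rewrite mul0r eq_sym oner_eq0.
have ne : (`|e| = 1)%R.
  have : (`|e| * `|e| = 1)%R by rewrite -normrM e1 normr1.
  by have := normr_ge0 e; nra.
have a0 : (- e * cos phi != 0)%R by rewrite mulf_neq0// oppr_eq0.
pose f y := H y (e / cos phi * s + tan phi * y)%R.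
have mf : nnmeasurable f.
  apply: (nnmeasurable_comp (h := fun y : R => (y, e / cos phi * s + tan phi * y)%R) _ mH).
  by apply: measurable_fun_pair => //; apply: measurable_funD => //; exact: measurable_funM.
have kE : ((cos phi)^-1 = `|- e * cos phi|^-1)%R.
  by rewrite normrM normrN ne mul1r gtr0_norm.
rewrite [X in X%:E * _]kE.
apply: (eq_trans _ (integral_lebR_affine (- e * s * sin phi)%R a0 mf.1 mf.2)).
apply: eq_integral => r _; rewrite /f /H /=; congr (h (_, _))%:E; first by ring.
have := cos2Dsin2 phi => cs; rewrite /tan.
have s2 : (sin phi ^+ 2 = 1 - cos phi ^+ 2)%R by rewrite -cs; ring.
apply: (mulfI cn0); rewrite mulrDr.
rewrite [RHS](_ : _ = e * s + sin phi * (- e * cos phi * r) - e * s * sin phi ^+ 2)%R; last by field.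
rewrite s2; ring.
Qed.

Let Psi (sg : R * R) := \int[lebR]_s P (sg, s).

Let mPsi : nnmeasurable Psi.
Proof.
split; last first.
  by move=> sg; apply: nnintegral_ge0; exact: (nnmeasurable_comp (@measurable_pair1 _ _ _ _ sg) mP).
exact: (measurable_fun_fubini_tonelli_F (m2 := lebR) _ mP.1 mP.2).
Qed.

(** The cube of [radon_tan] gives cos^-3 and the dilation in s gives back one cosine. The remaining
    cos^-2 is exactly the derivative of tan, so with the exponent 3 arc length on normals turns into
    Lebesgue measure on slopes. *)
Let Psi_tan (phi e : R) : (0 < cos phi)%R -> (e * e = 1)%R ->
  Psi ((- e * sin phi)%R, (e * cos phi)%R) = ((cos phi) ^- 2)%:E * Phi (tan phi).
Proof.
move=> c e1; have cn0 : (cos phi != 0)%R by rewrite gt_eqF.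
have ne : (`|e| = 1)%R.
  have : (`|e| * `|e| = 1)%R by rewrite -normrM e1 normr1.
  by have := normr_ge0 e; nra.
have a0 : (e / cos phi != 0)%R.
  rewrite mulf_neq0 ?invr_eq0//.
  by apply: contra_eq_neq e1 => ->; rewrite mul0r eq_sym oner_eq0.
have mx := nnmeasurable_comp (@measurable_pair1 _ _ R R (tan phi)) mxray3.
pose k := ((cos phi)^-1)%R.
have k0 : (0 <= k)%R by rewrite invr_ge0 ltW.
transitivity (\int[lebR]_s ((k * k * k)%:E * (fun t => xray H (tan phi) t *
    xray H (tan phi) t * xray H (tan phi) t) (e / cos phi * s)%R)).
  apply: eq_integral => s _; rewrite /P radon_tan// -/k.
  rewrite !EFinM; move: (xray _ _ _) => a.
  by rewrite [LHS](AC (2*2*2) ((1*3*5)*(2*4*6))).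
have kkk0 : (0 <= k * k * k)%R by rewrite !mulr_ge0.
have mxs : nnmeasurable (fun s => (fun t => xray H (tan phi) t *
    xray H (tan phi) t * xray H (tan phi) t) (e / cos phi * s)%R).
  by apply: (nnmeasurable_comp (h := fun s : R => (e / cos phi * s)%R) _ mx); exact: measurable_funM.
rewrite -lee_fin in kkk0.
apply: (eq_trans (nnintegralZl lebR kkk0 mxs)).
rewrite (integral_lebR_scale a0 mx.1 mx.2) muleA -EFinM; congr (_%:E * _).
by rewrite normrM ne mul1r gtr0_norm ?invr_gt0// invrK /k; field.
Qed.

Local Notation I := (`](- (pi / 2))%R, (pi / 2)%R[%classic : set R).
Local Notation Q := (fun theta : R => Psi (unit_circle_pt theta)).

Let mQ : nnmeasurable Q.
Proof. by apply: nnmeasurable_comp mPsi; exact: measurable_unit_circle_pt. Qed.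

Let nn_restrict (D : set R) (f : R -> \bar R) : measurable D -> nnmeasurable f ->
  nnmeasurable (f \_ D).
Proof.
move=> mD [mf f0]; split; last by move=> x; apply: erestrict_ge0.
by apply/(measurable_restrictT _ _).1 => //; exact: measurable_funTS.
Qed.

(** [a] is the middle angle of an open half circle of normals and [e] its orientation. The slope is
    tan phi for the normal of angle phi + a, and the weight of [Psi_tan] is absorbed by the tangent
    substitution. *)
Let half (a e : R) : (e * e = 1)%R ->
  (forall phi, unit_circle_pt (phi + a) = (- e * sin phi, e * cos phi)%R) ->
  \int[lebR]_theta (Q \_ `](a - pi / 2)%R, (a + pi / 2)%R[%classic) theta =
  \int[lebR]_x Phi x.
Proof.
move=> e1 ptE; set D := `]_, _[%classic.
have [m1 m2] := nn_restrict (D := D) (measurable_itv _) mQ.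
rewrite -(integral_lebR_shift a m1 m2) -(integral_tan_substitution mPhi).
rewrite [RHS]integral_mkcond; apply: eq_integral => phi _; rewrite !patchE.
have -> : ((phi + a)%R \in D) = (phi \in I).
  by apply/idP/idP; rewrite !inE /D /= !in_itv/= => /andP[u v]; apply/andP; split; lra.
case: ifP => // /set_mem phiI; rewrite ptE Psi_tan//.
by apply: cos_gt0_pihalf; move: phiI; rewrite /= in_itv.
Qed.

Let circleE : \int[@circle_line_measure R]_w P w =
  \int[lebR]_theta (Q \_ `[0%R, (2 * pi)%R[%classic) theta.
Proof.
have sf : sigma_finite setT (@arc_length R).
  exists (fun=> setT); first by rewrite bigcup_const.
  move=> n; split => //.
  rewrite [arc_length _](_ : _ = lebR `[0%R, (2 * pi)%R[%classic); last first.
    by rewrite /arc_length /pushforward preimage_setT /mrestr setTI.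
  rewrite [lebR _]lebesgue_measure_itv/=; case: ifP => _ //.
  by rewrite ?oppe0 ?adde0 -?EFinB ltry.
have [nu nuE] := sigma_finite_measureP sf.
transitivity (\int[(nu \x lebR)%E]_w P w).
  apply: eq_measure_integral => A mA _.
  change ((@arc_length R \x lebR)%E A = (nu \x lebR)%E A).
  by rewrite /product_measure1 nuE.
rewrite (fubini_tonelli1 P mP.1 mP.2).
rewrite -integral_mkcond.
have mone : measurable_fun setT (fun _ : R => 1%R : R) by [].
have muE A : measurable A -> \int[lebR]_(x in `[0%R, (2 * pi)%R[%classic `&`
    (@unit_circle_pt R) @^-1` A) 1%:E = nu A.
  move=> mA; rewrite integral_cst; last first.
    apply: measurableI => //; rewrite -[X in measurable X]setTI.
    exact: measurable_unit_circle_pt.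
  by rewrite mul1e -nuE /arc_length /pushforward /mrestr setIC.
have := integral_weighted_comp (mu := lebR) (nu := nu) (measurable_itv _)
  (@measurable_unit_circle_pt R) mone (fun=> ler01) muE mPsi.
by move=> <-; apply: eq_integral => x _; rewrite mul1e.
Qed.

Let pi0 : (0 < pi :> R)%R. Proof. exact: pi_gt0. Qed.

Let half1 : \int[lebR]_theta (Q \_ `]0%R, pi%R[%classic) theta = \int[lebR]_x Phi x.
Proof.
rewrite -(half (a := (pi / 2)%R) (e := 1%R)) ?mulr1//.
  by rewrite subrr -splitr.
by move=> phi; rewrite /unit_circle_pt cosDpihalf sinDpihalf mul1r mulN1r.
Qed.

Let half2 : \int[lebR]_theta (Q \_ `]pi%R, (2 * pi)%R[%classic) theta = \int[lebR]_x Phi x.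
Proof.
rewrite -(half (a := (pi + pi / 2)%R) (e := (-1)%R)) ?mulrNN ?mulr1//.
  have -> : (pi + pi / 2 - pi / 2 = pi :> R)%R by lra.
  by have -> : (pi + pi / 2 + pi / 2 = 2 * pi :> R)%R by lra.
move=> phi; rewrite /unit_circle_pt addrA cosDpihalf sinDpihalf sinDpi cosDpi.
by rewrite !opprK mul1r mulN1r.
Qed.

(** Every line has two unit normals. Keeping only the half circle of angles in ]0, pi[ gives the
    lower bound. *)
Lemma le_xray_radon : \int[lebR]_x Phi x <= \int[@circle_line_measure R]_w P w.
Proof.
rewrite circleE -half1; apply: le_ge0_integral => theta.
  exact: (nn_restrict (measurable_itv _) mQ).2.
rewrite !patchE; case: ifPn => [|_]; last by case: ifP => // _; rewrite mQ.2.
rewrite inE /= in_itv/= => /andP[t0 tpi]; rewrite mem_set//= in_itv/= ltW//=.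
by rewrite (lt_trans tpi)// ltr_pMl// ltr1n.
Qed.

(** Two open half circles cover the circle up to the angles 0 and pi, the normals of the lines
    without a slope, which form a null set. *)
Lemma radon_le_xray : \int[@circle_line_measure R]_w P w <=
  \int[lebR]_x Phi x + \int[lebR]_x Phi x.
Proof.
rewrite circleE -{1}half1 -half2 -nnintegralD; [|exact: nn_restrict..].
apply: (@le_nnintegral_lebR_except _ [:: 0%R; pi]).
- exact: nn_restrict.
- by apply: nnmeasurableD; exact: nn_restrict.
move=> t; rewrite !inE negb_or => /andP[t0 tpi].
have Q0 : 0 <= Q t by exact: mQ.2.
rewrite !patchE; case: ifPn => [|_]; last by rewrite adde_ge0//; case: ifP.
rewrite inE /= in_itv/= => /andP[t_ge0 t2pi].
have [tp|tp|tp] := ltgtP t pi.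
- have t_gt0 : (0 < t)%R by rewrite lt_neqAle eq_sym t0.
  rewrite [t \in _]mem_set/=; last by rewrite in_itv/= t_gt0 tp.
  by rewrite leeDl//; case: ifP.
- rewrite [X in _ <= _ + X]ifT; last by rewrite mem_set//= in_itv/= tp.
  by rewrite leeDr//; case: ifP.
- by rewrite tp eqxx in tpi.
Qed.

End radon_xray.

Lemma nnintegral_cvg d (T : measurableType d) (R : realType)
    (mu : {measure set T -> \bar R}) (g : nat -> T -> \bar R) (G : T -> \bar R) :
  (forall n, nnmeasurable (g n)) ->
  (forall x, {homo g ^~ x : m n / (m <= n)%N >-> m <= n}) ->
  (forall x, g n x @[n --> \oo] --> G x) ->
  \int[mu]_x g n x @[n --> \oo] --> \int[mu]_x G x.
Proof.
move=> mg ndg gG.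
have -> : \int[mu]_x G x = \int[mu]_x limn (g ^~ x).
  by apply: eq_integral => x _; apply/esym/cvg_lim => //; exact: gG.
apply: cvg_monotone_convergence => //.
- by move=> n; exact: (mg n).1.
- by move=> n x _; exact: (mg n).2.
Qed.

Lemma nnintegral_leb2 (R : realType) (f : R * R -> \bar R) : nnmeasurable f ->
  \int[@leb2 R]_z f z = \int[lebR]_x \int[lebR]_y f (x, y).
Proof. by move=> [mf f0]; exact: (fubini_tonelli1 f mf f0). Qed.

Lemma poweR_cube (R : realType) (x : \bar R) : 0 <= x -> x `^ 3 = x * x * x.
Proof.
move=> x0; rewrite (_ : 3 = 1 + 1 + 1)%R; last by ring.
by rewrite !poweRD_ge0 ?addr_ge0// poweRe1.
Qed.

(** * The operator norm of the Radon transform *)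

Section radon_operator.
Variable R : realType.
Notation rho := (radon_norm R).

Let Lnorm3E (F : (R * R) * R -> \bar R) : (forall w, 0 <= F w) ->
  'N[@circle_line_measure R]_(3%:E)[F] =
  (\int[@circle_line_measure R]_w (F w * F w * F w)) `^ 3^-1.
Proof.
move=> F0; rewrite unlock /Lnorm; congr (_ `^ _); apply: eq_integral => w _.
by rewrite gee0_abs// poweR_cube.
Qed.

Let Lnorm32_le1 (h : R * R -> R) : measurable_fun setT h -> (forall z, (0 <= h z)%R) ->
  ('N[@leb2 R]_((3 / 2)%:E)[EFin \o h] <= 1) =
  (\int[lebR]_y \int[lebR]_u (h (y, u))%:E `^ (3 / 2) <= 1).
Proof.
move=> mh h0.
have -> : 'N[@leb2 R]_((3 / 2)%:E)[EFin \o h] =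
   (\int[lebR]_y \int[lebR]_u (h (y, u))%:E `^ (3 / 2)) `^ (3 / 2)^-1.
  rewrite unlock /Lnorm -(nnintegral_leb2 (f := fun z => (h z)%:E `^ (3 / 2))); last first.
    by apply: nnmeasurable_poweR; exact: nn_EFin.
  congr (_ `^ _); apply: eq_integral => z _ /=.
  by rewrite ger0_norm.
set I := \int[lebR]_y _.
have I0 : 0 <= I.
  by apply: integral_ge0 => y _; apply: integral_ge0 => u _; exact: poweR_ge0.
have e0 : (0 < (3 / 2 : R)^-1)%R by rewrite invr_gt0 divr_gt0.
apply/idP/idP => [I1|I1].
  have := le_poweR (a := 3 / 2) _ (poweR_ge0 I (3 / 2)^-1) I1.
  have h32 : (3 / 2 != 0 :> R)%R by rewrite gt_eqF// divr_gt0.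
  by rewrite -poweRrM (mulVf h32) poweRe1// poweR1r; apply; rewrite divr_ge0.
by have := le_poweR (ltW e0) I0 I1; rewrite poweR1r.
Qed.

Lemma radon_norm_ge0 : 0 <= rho.
Proof.
apply: ereal_sup_ubound => /=; exists (cst 0%R).
  have z : 'N[@leb2 R]_((3 / 2)%:E)[EFin \o cst 0%R] = 0.
    by apply: Lnorm0; rewrite eqe gt_eqF// divr_gt0.
  split; last by rewrite z.
  apply/andP; split; rewrite inE /=; first exact: measurable_cst.
  by rewrite /finite_norm z ltry.
rewrite Lnorm3E; last by move=> w; apply: integral_ge0.
rewrite integral0_eq ?poweR0r ?invr_neq0//.
by move=> w _; rewrite [radon _ w]integral0 !mul0e.
Qed.

(** Replacing [f] by its absolute value keeps the L^(3/2) norm and can only increase the modulus of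
    the transform, on non-integrable lines as well. For nonnegative functions [radon_le_xray] and
    [xray_bound] give the constant. *)
Lemma radon_norm_lty : rho < +oo.
Proof.
set J := (hconst R + hconst R) * (hconst R + hconst R).
have [hc0 hcoo] : 0 <= hconst R /\ hconst R < +oo.
  by split; [exact: le_trans (hconst_ge1 _)|exact: hconst_lty].
have J0 : 0 <= J by rewrite mule_ge0// adde_ge0.
have Joo : J < +oo.
  apply: lte_mul_pinfty; [exact: adde_ge0| |exact: lte_add_pinfty].
  by rewrite ge0_fin_numE; [exact: lte_add_pinfty|exact: adde_ge0].
apply: (@le_lt_trans _ _ (((J + J + J) + (J + J + J)) `^ 3^-1)); last first.
  by rewrite poweR_lty// !lte_add_pinfty.
apply: ge_ereal_sup => x /= [f [/andP[+ _] f1] <-]; rewrite inE/= => mf.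
pose h z := `|f z|%R.
have mh : measurable_fun setT h by apply: measurableT_comp => //; exact: measurable_normr.
have h0 z : (0 <= h z)%R by exact: normr_ge0.
have mRh := nnmeasurable_radon mh h0.
have h1 : 'N[@leb2 R]_((3 / 2)%:E)[EFin \o h] <= 1.
  apply: le_trans f1; rewrite unlock /Lnorm le_eqVlt; apply/orP; left; apply/eqP.
  by congr (_ `^ _); apply: eq_integral => z _ /=; rewrite normr_id.
rewrite Lnorm32_le1// in h1.
have mH : nnmeasurable (fun z : R * R => (fun y u => (h (y, u))%:E) z.1 z.2).
  apply: (nn_EFin (f := fun z : R * R => h (z.1, z.2))) => //.
  by apply: (measurableT_comp mh); apply: measurable_fun_pair.
have X := xray_bound mH h1.
rewrite unlock /Lnorm; apply: le_poweR => //.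
  by apply: integral_ge0 => w _; exact: poweR_ge0.
apply: (@le_trans _ _ (\int[@circle_line_measure R]_w (radon h w * radon h w * radon h w))).
  apply: le_ge0_integral => w; first exact: poweR_ge0.
  rewrite -poweR_cube ?mRh.2//; apply: le_poweR => //.
  apply: (le_trans (le_abse_integral _ _ _)) => //.
  apply/measurable_EFinP; apply: (measurableT_comp mf).
  apply: measurable_fun_pair.
    by apply: measurable_funB => //; exact: measurable_funM.
  by apply: measurable_funD => //; exact: measurable_funM.
by apply: (le_trans (radon_le_xray mh h0)); rewrite leeD.
Qed.

Let Phi (H : R -> R -> \bar R) :=
  \int[lebR]_x \int[lebR]_t (xray H x t * xray H x t * xray H x t).

Let nnmeasurable_xray3 (H : R -> R -> \bar R) :
  nnmeasurable (fun z : R * R => H z.1 z.2) ->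
  nnmeasurable (fun z : (R * R) * R => H z.2 (z.1.2 + z.1.1 * z.2)%R).
Proof.
move=> mH.
apply: (nnmeasurable_comp (h := fun z : R * R * R => (z.2, z.1.2 + z.1.1 * z.2)%R) _ mH).
apply: measurable_fun_pair; first exact: measurable_snd.
apply: measurable_funD; first exact: (measurableT_comp measurable_snd measurable_fst).
apply: measurable_funM; last exact: measurable_snd.
exact: (measurableT_comp measurable_fst measurable_fst).
Qed.

Lemma nnmeasurable_xray (H : R -> R -> \bar R) :
  nnmeasurable (fun z : R * R => H z.1 z.2) ->
  nnmeasurable (fun z : R * R => xray H z.1 z.2).
Proof.
move=> mH; have m3 := nnmeasurable_xray3 mH; split.
  exact: (measurable_fun_fubini_tonelli_F (m2 := lebR)
    (fun z : R * R * R => H z.2 (z.1.2 + z.1.1 * z.2)%R) m3.1 m3.2).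
by move=> z; apply: nnintegral_ge0; exact: (nnmeasurable_comp (@measurable_pair1 _ _ _ _ z) m3).
Qed.

Let nnmeasurable_cube (H : R -> R -> \bar R) :
  nnmeasurable (fun z : R * R => H z.1 z.2) ->
  nnmeasurable (fun z : R * R => xray H z.1 z.2 * xray H z.1 z.2 * xray H z.1 z.2).
Proof.
by move=> /nnmeasurable_xray mx; apply: nnmeasurableM => //; exact: nnmeasurableM.
Qed.

Let nnmeasurable_Phi1 (H : R -> R -> \bar R) :
  nnmeasurable (fun z : R * R => H z.1 z.2) ->
  nnmeasurable (fun x => \int[lebR]_t (xray H x t * xray H x t * xray H x t)).
Proof.
move=> /nnmeasurable_cube m; split.
  exact: (measurable_fun_fubini_tonelli_F (m2 := lebR) _ m.1 m.2).
by move=> x; apply: nnintegral_ge0; exact: (nnmeasurable_comp (@measurable_pair1 _ _ R R x) m).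
Qed.

Let xrayZ (H : R -> R -> \bar R) (c : \bar R) x t : 0 <= c ->
  nnmeasurable (fun z : R * R => H z.1 z.2) ->
  xray (fun y u => c * H y u) x t = c * xray H x t.
Proof.
move=> c0 /nnmeasurable_xray3 m.
exact: (nnintegralZl lebR c0 (nnmeasurable_comp (@measurable_pair1 _ _ _ _ (x, t)) m)).
Qed.

Let PhiZ (H : R -> R -> \bar R) (c : \bar R) : 0 <= c ->
  nnmeasurable (fun z : R * R => H z.1 z.2) ->
  Phi (fun y u => c * H y u) = c * c * c * Phi H.
Proof.
move=> c0 mH; have ccc0 : 0 <= c * c * c by rewrite !mule_ge0.
rewrite /Phi -(nnintegralZl lebR ccc0 (nnmeasurable_Phi1 mH)).
apply: eq_integral => x _.
have m := nnmeasurable_comp (@measurable_pair1 _ _ R R x) (nnmeasurable_cube mH).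
rewrite -(nnintegralZl lebR ccc0 m).
apply: eq_integral => t _; rewrite xrayZ//; move: (xray H x t) => a /=.
by rewrite [LHS](AC (2*2*2) ((1*3*5)*(2*4*6))).
Qed.

Let radon_bound_unit (h : R * R -> R) : measurable_fun setT h -> (forall z, (0 <= h z)%R) ->
  \int[lebR]_y \int[lebR]_u (h (y, u))%:E `^ (3 / 2) <= 1 ->
  Phi (fun y u => (h (y, u))%:E) <= rho * rho * rho.
Proof.
move=> mh h0 h1; have mR := nnmeasurable_radon mh h0.
apply: (le_trans (le_xray_radon mh h0)).
set P := \int[_]_w _.
have P0 : 0 <= P by apply: integral_ge0 => w _; rewrite !mule_ge0// mR.2.
have : P `^ 3^-1 <= rho.
  rewrite -Lnorm3E; last exact: mR.2.
  apply: ereal_sup_ubound => /=; exists h => //; rewrite Lnorm32_le1//; split => //.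
  apply/andP; split; rewrite inE //=.
  rewrite /finite_norm; apply: (@le_lt_trans _ _ 1); last by rewrite ltry.
  by rewrite Lnorm32_le1.
move=> /(le_poweR (a := 3) _ (poweR_ge0 _ _)) -/(_ (ler0n _ 3)).
by rewrite -poweRrM mulVf// poweRe1// poweR_cube// radon_norm_ge0.
Qed.

(** Homogeneity reduces to [radon_bound_unit]: [Phi] is cubic, and I^2 is the cube of the L^(3/2)
    norm. As I may be 0, the function is normalized with I + e, and e then tends to 0. *)
Let radon_bound_fin (h : R * R -> R) (I : R) : measurable_fun setT h ->
  (forall z, (0 <= h z)%R) ->
  \int[lebR]_y \int[lebR]_u (h (y, u))%:E `^ (3 / 2) = I%:E ->
  Phi (fun y u => (h (y, u))%:E) <= rho * rho * rho * (I%:E * I%:E).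
Proof.
move=> mh h0 hI.
have I0 : (0 <= I)%R.
  rewrite -lee_fin -hI; apply: integral_ge0 => y _; apply: integral_ge0 => u _.
  exact: poweR_ge0.
have rf : rho \is a fin_num by rewrite ge0_fin_numE ?radon_norm_lty// radon_norm_ge0.
have r0 : (0 <= fine rho)%R by rewrite fine_ge0// radon_norm_ge0.
pose r := (fine rho * fine rho * fine rho)%R.
have rr0 : (0 <= r)%R by rewrite !mulr_ge0.
have rE : rho * rho * rho = r%:E by rewrite !EFinM fineK.
have mH : nnmeasurable (fun z : R * R => (fun y u => (h (y, u))%:E) z.1 z.2).
  apply: (nn_EFin (f := fun z : R * R => h (z.1, z.2))) => //.
  by apply: (measurableT_comp mh); apply: measurable_fun_pair.
have step e : (0 < e)%R -> Phi (fun y u => (h (y, u))%:E) <= (r * ((I + e) * (I + e)))%:E.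
  move=> e0; have Ie0 : (0 < I + e)%R by rewrite ltr_wpDl.
  (* The factor c below is (I + e)^(-2/3), so that c^(3/2) = 1 / (I + e) and c^3 = (I + e)^(-2). *)
  pose k := ((I + e) `^ (3^-1))%R.
  have k0 : (0 < k)%R by rewrite powR_gt0.
  have k3 : (k * k * k = I + e)%R.
    rewrite /k -!powRD; [|by rewrite gt_eqF ?implybT..].
    by rewrite (_ : 3^-1 + 3^-1 + 3^-1 = 1)%R ?powRr1 ?ltW//; lra.
  pose c := ((k * k)^-1)%R.
  have c0 : (0 < c)%R by rewrite invr_gt0 mulr_gt0.
  have mch : measurable_fun setT (fun z => c * h z)%R by exact: measurable_funM.
  have ch0 z : (0 <= c * h z)%R by rewrite mulr_ge0// ltW.
  have c32 : (c%:E `^ (3 / 2) = ((I + e)^-1)%:E).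
    rewrite poweR_EFin; congr (_%:E).
    rewrite /c /k -powRD; last by rewrite gt_eqF ?implybT.
    rewrite -powRN -powRrM -[RHS]powR_inv1 ?ltW//; congr (_ `^ _)%R.
    by field.
  have := @radon_bound_unit (fun z => c * h z)%R mch ch0.
  have -> : \int[lebR]_y \int[lebR]_u (c * h (y, u))%:E `^ (3 / 2) = ((I + e)^-1 * I)%:E.
    have i0 : 0 <= ((I + e)^-1)%:E by rewrite lee_fin invr_ge0 ltW.
    have m := nnmeasurable_poweR (3 / 2) mH.
    rewrite EFinM -hI -(nnintegralZl lebR i0); last first.
      split; first exact: (measurable_fun_fubini_tonelli_F (m2 := lebR) _ m.1 m.2).
      by move=> y; apply: integral_ge0 => u _; exact: poweR_ge0.
    apply: eq_integral => y _.
    rewrite -(nnintegralZl lebR i0 (nnmeasurable_comp (@measurable_pair1 _ _ R R y) m)).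
    by apply: eq_integral => u _; rewrite EFinM poweRM ?lee_fin ?h0 ?ltW// c32.
  rewrite lee_fin mulrC ler_pdivrMr// mul1r lerDl ltW// => /(_ isT).
  have := PhiZ (H := fun y u => (h (y, u))%:E) (c := c%:E) (ltW c0) mH; rewrite /= => PhiE.
  have -> : (fun y u => (c * h (y, u))%:E) = (fun y u => c%:E * (h (y, u))%:E) by [].
  rewrite PhiE rE.
  have -> : c%:E * c%:E * c%:E = (((I + e) * (I + e))^-1)%:E.
    rewrite -!EFinM -k3; congr (_%:E); rewrite /c; field; exact: lt0r_neq0.
  by rewrite lee_pdivrMl ?mulr_gt0// -EFinM mulrC.
rewrite rE; apply/lee_addgt0Pr => e e0.
pose A := (r * (2 * I + 1))%R; have A0 : (0 <= A)%R by rewrite mulr_ge0// addr_ge0// mulr_ge0.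
(* For d <= 1, (I + d)^2 <= I^2 + d (2 I + 1), so the error is at most d A; the 1 added to A avoids
   a zero denominator. *)
pose d := Num.min 1%R (e / (A + 1))%R.
have A1 : (0 < A + 1)%R by rewrite ltr_wpDl.
have d0 : (0 < d)%R by rewrite lt_min ltr01 divr_gt0.
apply: (le_trans (step d d0)); rewrite -!EFinM -EFinD lee_fin.
have d1 : (d <= 1)%R by rewrite ge_min lexx.
have dA : (d * (A + 1) <= e)%R by rewrite -ler_pdivlMr// ge_min lexx orbT.
apply: (@le_trans _ _ (r * (I * I) + d * A)%R); last by rewrite lerD2l (le_trans _ dA)// ler_pM2l// lerDl.
rewrite /A [X in (_ <= _ + X)%R]mulrCA -mulrDr ler_wpM2l//.
by nra.
Qed.

(** [radon_norm] only tests real-valued functions of finite norm. Cutting [H] off at height n on the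
    square [-n, n]^2 produces such functions, and monotone convergence recovers [H]. *)
Lemma xray_radon_norm (H : R -> R -> \bar R) (J : \bar R) :
  nnmeasurable (fun z : R * R => H z.1 z.2) ->
  \int[lebR]_y \int[lebR]_u H y u `^ (3 / 2) <= J ->
  Phi H <= rho * rho * rho * (J * J).
Proof.
move=> mH HJ.
pose B (n : nat) : set (R * R) := `[(- n%:R)%R, n%:R]%classic `*` `[(- n%:R)%R, n%:R]%classic.
have mB n : measurable (B n) by apply: measurableX.
pose h n z := ((fun z => mine (H z.1 z.2) n%:R%:E) \_ (B n)) z.
have mmin n : nnmeasurable (fun z => mine (H z.1 z.2) n%:R%:E).
  split; first by apply: measurable_mine => //; exact: mH.1.
  by move=> z; rewrite le_min (mH.2 z) lee_fin ler0n.
have mh n : nnmeasurable (h n).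
  split; last by move=> z; apply: erestrict_ge0 => w _; exact: (mmin n).2.
  apply: (measurable_restrictT (fun z => mine (H z.1 z.2) n%:R%:E) (mB n)).1.
  by apply: measurable_funTS; exact: (mmin n).1.
have hn n z : h n z <= n%:R%:E.
  by rewrite /h patchE; case: ifP => _; rewrite ?ge_min ?lexx ?orbT// lee_fin ler0n.
have hH n z : h n z <= H z.1 z.2.
  by rewrite /h patchE; case: ifP => _; rewrite ?ge_min ?lexx// (mH.2 z).
have hf n z : h n z \is a fin_num.
  by rewrite ge0_fin_numE ?(mh n).2// (le_lt_trans (hn n z))// ltry.
have Bnd n m : (n <= m)%N -> B n `<=` B m.
  move=> nm z [/=]; rewrite !in_itv/= => /andP[a b] /andP[c d].
  have nm' : (n%:R <= m%:R :> R)%R by rewrite ler_nat.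
  by split => /=; rewrite in_itv/=; apply/andP; split; lra.
have hnd n m z : (n <= m)%N -> h n z <= h m z.
  move=> nm; rewrite /h !patchE; case: ifPn => [|_]; last first.
    by case: ifP => // _; exact: (mmin m).2.
  rewrite inE => /(Bnd _ _ nm) zm; rewrite mem_set//.
  by rewrite le_min !ge_min lexx/= lee_fin ler_nat nm orbT.
have hcvg z : h n z @[n --> \oo] --> H z.1 z.2.
  have zB : \forall n \near \oo, z \in B n.
    near=> n; rewrite inE; split => /=; rewrite in_itv/= -ler_norml.
      by near: n; exact: nbhs_infty_ger.
    by near: n; exact: nbhs_infty_ger.
  case HE : (H z.1 z.2) => [x| |].
  - apply: cvg_near_cst; near=> n.
    have nB : z \in B n by near: n.
    rewrite /h patchE nB HE min_l// lee_fin (le_trans (ler_norm _))//.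
    by near: n; exact: nbhs_infty_ger.
  - apply/cvgeyPge => M; near=> n.
    have nB : z \in B n by near: n.
    rewrite /h patchE nB HE min_r ?leey// lee_fin (le_trans (ler_norm _))//.
    by near: n; exact: nbhs_infty_ger.
  - by have := mH.2 z; rewrite HE.
pose hr n z := fine (h n z).
have mhr n : measurable_fun setT (hr n).
  by apply: (measurableT_comp _ (mh n).1); exact: fine_measurable.
have hr0 n z : (0 <= hr n z)%R by rewrite fine_ge0// (mh n).2.
pose Hn n y u := h n (y, u).
have mHn n : nnmeasurable (fun z : R * R => Hn n z.1 z.2).
  by apply: (nnmeasurable_comp (h := fun z : R * R => (z.1, z.2)) _ (mh n)); apply: measurable_fun_pair.
have bound n : Phi (Hn n) <= rho * rho * rho * (J * J).
  pose I := \int[lebR]_y \int[lebR]_u Hn n y u `^ (3 / 2).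
  have m32 := nnmeasurable_poweR (3 / 2) (mHn n).
  have I0 : 0 <= I by apply: integral_ge0 => y _; apply: integral_ge0 => u _; exact: poweR_ge0.
  have IJ : I <= J.
    apply: (le_trans _ HJ); apply: le_ge0_integral => y.
      by apply: integral_ge0 => u _; exact: poweR_ge0.
    apply: le_ge0_integral => u; first exact: poweR_ge0.
    by apply: le_poweR; rewrite ?divr_ge0// ?(mh n).2// (hH n (y, u)).
  have Ioo : I < +oo.
    have -> : I = \int[@leb2 R]_z (h n z `^ (3 / 2)).
      by rewrite nnintegral_leb2//; exact: nnmeasurable_poweR (mh n).
    have nb : measurable_fun (B n) (fun z => h n z `^ (3 / 2)).
      by apply: measurable_funTS; exact: (nnmeasurable_poweR (3 / 2) (mh n)).1.
    apply: (@le_lt_trans _ _ (\int[@leb2 R]_(z in B n) (cst (n%:R%:E `^ (3 / 2)) z))).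
      rewrite [leRHS]integral_mkcond; apply: le_ge0_integral => z; first exact: poweR_ge0.
      rewrite patchE; case: ifPn => zB.
        by apply: le_poweR; rewrite ?divr_ge0// (mh n).2.
      by rewrite /h patchE (negbTE zB) poweR0r// gt_eqF// divr_gt0.
    rewrite integral_cst//= /leb2 product_measure1E//.
    apply: lte_mul_pinfty; rewrite ?poweR_ge0// ?poweR_EFin//.
    have lf : lebR `[(- n%:R)%R, (n%:R : R)]%classic < +oo.
      rewrite [lebR _]lebesgue_measure_itv/=; case: ifP => _ //.
      by rewrite -EFinB ltry.
    by apply: lte_mul_pinfty => //; rewrite ge0_fin_numE.
  have HrE : (fun y u => (hr n (y, u))%:E) = Hn n.
    by apply/funext => y; apply/funext => u; rewrite /hr fineK.
  have /= := @radon_bound_fin (hr n) (fine I) (mhr n) (hr0 n).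
  rewrite HrE => b; apply: (le_trans (b _)).
    rewrite fineK ?ge0_fin_numE//; apply: eq_integral => y _; apply: eq_integral => u _.
    by rewrite -poweR_EFin /hr fineK.
  apply: lee_wpmul2l; first by rewrite !mule_ge0// radon_norm_ge0.
  by rewrite fineK ?ge0_fin_numE//; apply: lee_pmul.
have xnd n m x t : (n <= m)%N -> xray (Hn n) x t <= xray (Hn m) x t.
  by move=> nm; apply: le_ge0_integral => y; [exact: (mh n).2|exact: hnd].
have x0 n x t : 0 <= xray (Hn n) x t by exact: (nnmeasurable_xray (mHn n)).2 (x, t).
have x3nd n m x t : (n <= m)%N ->
    xray (Hn n) x t * xray (Hn n) x t * xray (Hn n) x t <=
    xray (Hn m) x t * xray (Hn m) x t * xray (Hn m) x t.
  by move=> nm; rewrite !lee_pmul ?mule_ge0//; exact: xnd.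
have xcvg x t : xray (Hn n) x t @[n --> \oo] --> xray H x t.
  apply: nnintegral_cvg.
  - by move=> n; exact: (nnmeasurable_comp (@measurable_pair1 _ _ _ _ (x, t)) (nnmeasurable_xray3 (mHn n))).
  - by move=> y n m; exact: hnd.
  - by move=> y; exact: (hcvg (y, (t + x * y)%R)).
have x3cvg x t : xray (Hn n) x t * xray (Hn n) x t * xray (Hn n) x t @[n --> \oo] -->
    xray H x t * xray H x t * xray H x t.
  have a0 : 0 <= xray H x t by exact: (nnmeasurable_xray mH).2 (x, t).
  move: (xcvg x t) a0; set a := xray H x t => ca a0.
  apply: cvgeM => //; last apply: cvgeM => //.
  - by case: a a0 {ca} => // a a0.
  - by case: a a0 {ca} => // a a0.
have Phicvg : Phi (Hn n) @[n --> \oo] --> Phi H.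
  apply: nnintegral_cvg.
  - by move=> n; exact: nnmeasurable_Phi1.
  - move=> x n m nm; apply: le_ge0_integral => t; last exact: x3nd.
    by rewrite !mule_ge0.
  - move=> x; apply: nnintegral_cvg => //.
    + by move=> n; exact: (nnmeasurable_comp (@measurable_pair1 _ _ R R x) (nnmeasurable_cube (mHn n))).
    + by move=> t n m; exact: x3nd.
by apply: cvge_to_le Phicvg _; near=> n; exact: bound.
Unshelve. all: by end_near.
Qed.

End radon_operator.

(** * Mixed-norm Loomis-Whitney and Finner inequalities *)

Lemma poweR_sqrtK (R : realType) (x : \bar R) : 0 <= x -> (x `^ 2^-1) `^ 2 = x.
Proof. by move=> x0; rewrite -poweRrM mulVf// poweRe1. Qed.

Lemma poweR_sqrK (R : realType) (x : \bar R) : 0 <= x -> (x `^ 2) `^ 2^-1 = x.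
Proof. by move=> x0; rewrite -poweRrM mulfV// poweRe1. Qed.

Lemma poweR_sqr (R : realType) (x : \bar R) : 0 <= x -> x `^ 2 = x * x.
Proof.
move=> x0; rewrite (_ : 2 = 1 + 1)%R; last by ring.
by rewrite poweRD_ge0// poweRe1.
Qed.

(* Expanding the square of the inner integral into a double integral avoids
   dividing by the left-hand side, which may be infinite. *)
Lemma minkowski_L2 d1 d2 (T1 : measurableType d1) (T2 : measurableType d2)
    (R : realType) (m1 : {sigma_finite_measure set T1 -> \bar R})
    (m2 : {sigma_finite_measure set T2 -> \bar R}) (G : T1 -> T2 -> \bar R) :
  nnmeasurable (fun z => G z.1 z.2) ->
  \int[m1]_a (\int[m2]_b G a b) `^ 2 <=
  (\int[m2]_b (\int[m1]_a G a b `^ 2) `^ 2^-1) `^ 2.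
Proof.
move=> mG.
have mG1 a : nnmeasurable (G a).
  exact: (nnmeasurable_comp (@measurable_pair1 _ _ T1 T2 a) mG).
have mG2 b : nnmeasurable (G ^~ b).
  exact: (nnmeasurable_comp (@measurable_pair2 _ _ T1 T2 b) mG).
pose L a := \int[m2]_b G a b; pose N b := (\int[m1]_a G a b `^ 2) `^ 2^-1.
have mL : nnmeasurable L.
  split; last by move=> a; exact: nnintegral_ge0.
  exact: (measurable_fun_fubini_tonelli_F (m2 := m2) (fun z => G z.1 z.2) mG.1 mG.2).
have mG22 := nnmeasurable_poweR 2 mG.
have mN : nnmeasurable N.
  apply: (nnmeasurable_poweR 2^-1); split; last first.
    by move=> b; apply: nnintegral_ge0; exact: nnmeasurable_poweR.
  exact: (measurable_fun_fubini_tonelli_G (m1 := m1) (fun z => G z.1 z.2 `^ 2) mG22.1 mG22.2).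
have IN0 : 0 <= \int[m2]_b N b by exact: nnintegral_ge0.
rewrite [leRHS]poweR_sqr// -(nnintegralZl m2 IN0 mN).
have -> : \int[m1]_a L a `^ 2 = \int[m1]_a \int[m2]_b (L a * G a b).
  apply: eq_integral => a _; rewrite poweR_sqr ?mL.2//.
  exact/esym/(nnintegralZl m2 (mL.2 a) (mG1 a)).
rewrite (nnfubini m1 m2 (f := fun a b => L a * G a b)); last first.
  by apply: nnmeasurableM => //; exact: (nnmeasurable_comp measurable_fst mL).
apply: le_ge0_integral => b.
  apply: nnintegral_ge0; exact: nnmeasurableM.
have -> : \int[m1]_a (L a * G a b) = \int[m1]_a \int[m2]_b' (G a b * G a b').
  apply: eq_integral => a _; rewrite muleC.
  exact/esym/(nnintegralZl m2 (mG.2 (a, b)) (mG1 a)).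
rewrite (nnfubini m1 m2 (f := fun a b' => G a b * G a b')); last first.
  by apply: nnmeasurableM => //; exact: (nnmeasurable_comp measurable_fst (mG2 b)).
rewrite muleC -(nnintegralZl m2 (mN.2 b) mN).
apply: le_ge0_integral => b'.
  by apply: nnintegral_ge0; exact: nnmeasurableM.
have h0 : (0 < 2^-1 :> R)%R by rewrite invr_gt0.
have h1 : (2^-1 + 2^-1 = 1 :> R)%R by field.
have := hoelder_poweR m1 (nnmeasurable_poweR 2 (mG2 b)) (nnmeasurable_poweR 2 (mG2 b')) h0 h0 h1.
apply: le_trans; rewrite le_eqVlt; apply/orP; left; apply/eqP.
apply: eq_integral => a _.
by rewrite !poweR_sqrK ?(mG.2 (_, _)).
Qed.

Section mixed_norms.
Variables (R : realType) (N : nat).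
Implicit Types (F G : 'rV[R]_N -> \bar R) (i b : 'I_N) (X L : seq 'I_N).

Let nnmeasurable_upd2 i b F v : nnmeasurable F ->
  nnmeasurable (fun z : R * R => F (upd (upd v i z.1) b z.2)).
Proof.
move=> mF; apply: (nnmeasurable_comp (h := fun z : R * R => upd (upd v i z.1) b z.2) _ mF).
apply: (measurableT_comp (measurable_upd b) (g := fun z : R * R => (upd v i z.1, z.2))).
apply: measurable_fun_pair; last exact: measurable_snd.
exact: (measurableT_comp (measurable_updr v i) measurable_fst).
Qed.

Let minkowski1 i b F v : i != b -> nnmeasurable F ->
  pint i (fun v => pint b F v `^ 2) v <=
  pint b (fun v => pint i (fun v => F v `^ 2) v `^ 2^-1) v `^ 2.
Proof.
move=> ib mF.
have h := minkowski_L2 lebR lebR (G := fun s s' => F (upd (upd v i s) b s')) (nnmeasurable_upd2 i b v mF).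
have -> : pint b (fun v => pint i (fun v => F v `^ 2) v `^ 2^-1) v =
    \int[lebR]_s' (\int[lebR]_s F (upd (upd v i s) b s') `^ 2) `^ 2^-1.
  apply: eq_integral => s' _; congr (_ `^ _).
  by apply: eq_integral => s _; rewrite updC// eq_sym.
exact: h.
Qed.

Let sq F := fun v => F v `^ 2.
Let sr F := fun v => F v `^ 2^-1.

Let minkowski_list X b F v : b \notin X -> nnmeasurable F ->
  pints X (sq (pint b F)) v <= sq (pint b (sr (pints X (sq F)))) v.
Proof.
elim: X v => [|i X IH] v /=.
  move=> _ mF; rewrite /sq /sr le_eqVlt; apply/orP; left; apply/eqP; congr (_ `^ 2).
  by congr (pint b _ v); apply/funext => w; rewrite poweR_sqrK ?mF.2.
rewrite inE negb_or => /andP[bi bX] mF.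
have mG : nnmeasurable (sr (pints X (sq F))).
  by apply: nnmeasurable_poweR; apply: nnmeasurable_pints; exact: nnmeasurable_poweR.
apply: (@le_trans _ _ (pint i (sq (pint b (sr (pints X (sq F))))) v)).
  apply: le_pint; last by move=> w; exact: IH.
  by apply: nnmeasurable_pints; apply: nnmeasurable_poweR; exact: nnmeasurable_pint.
apply: (le_trans (minkowski1 v _ mG)); first by rewrite eq_sym.
rewrite /sq /sr le_eqVlt; apply/orP; left; apply/eqP; congr (_ `^ 2).
congr (pint b _ v); apply/funext => w; congr (_ `^ _); congr (pint i _ w).
apply/funext => w'; rewrite poweR_sqrtK//.
by apply: pints_ge0; exact: nnmeasurable_poweR.
Qed.

Lemma minkowski_pints X L F v : (forall i, i \in L -> i \notin X) -> nnmeasurable F ->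
  pints X (fun v => pints L F v `^ 2) v `^ 2^-1 <=
  pints L (fun v => pints X (fun v => F v `^ 2) v `^ 2^-1) v.
Proof.
move=> LX mF; elim: L v LX => //= b L IH v LX.
have mL := nnmeasurable_pints L mF.
have bX : b \notin X by apply: LX; rewrite mem_head.
have msq : nnmeasurable (sr (pints X (sq (pints L F)))).
  by apply: nnmeasurable_poweR; apply: nnmeasurable_pints; exact: nnmeasurable_poweR.
apply: (@le_trans _ _ (pint b (sr (pints X (sq (pints L F)))) v)); last first.
  apply: le_pint => // w; apply: IH => i iL.
  by apply: LX; rewrite inE iL orbT.
have h := le_poweR (a := 2^-1) _ (pints_ge0 X v (nnmeasurable_poweR 2 (nnmeasurable_pint b mL)))
  (minkowski_list v bX mL).
apply: (le_trans (h _)); first by rewrite invr_ge0.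
by rewrite /sq poweR_sqrK// (nnmeasurable_pint b msq).2.
Qed.

Section loomis_whitney.
Variables (I : eqType) (W : I -> seq 'I_N) (s : seq I) (c : R).
Hypotheses (us : uniq s) (c0 : (0 <= c)%R) (cs : ((size s)%:R * c - c / 2 = 1)%R).
Hypothesis disjW : forall j k, j \in s -> k \in s -> j != k ->
  forall i, i \in W j -> i \notin W k.

Let flatW (r : seq I) := flatten [seq W j | j <- r].

(** The mixed norm that iterated Hoelder produces for the k-th function: the blocks are integrated
    in the order of the list, in L^2 for the block [W k] and in L^1 for the others. *)
Let M (k : I) : seq I -> ('rV[R]_N -> \bar R) -> 'rV[R]_N -> \bar R :=
  fix M r F := match r with
  | [::] => F
  | j :: r' => if j == k then sr (pints (W j) (sq (M r' F))) else pints (W j) (M r' F)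
  end.

Let mM k r F : nnmeasurable F -> nnmeasurable (M k r F).
Proof.
move=> mF; elim: r => //= j r IH; case: ifP => _; last exact: nnmeasurable_pints.
by apply: nnmeasurable_poweR; apply: nnmeasurable_pints; exact: nnmeasurable_poweR.
Qed.

Let M_notin k r F : k \notin r -> M k r F = pints (flatW r) F.
Proof.
elim: r => //= j r IH; rewrite inE negb_or => /andP[kj kr].
by rewrite eq_sym (negbTE kj) IH// /flatW /= pints_cat.
Qed.

Let M_in k r F v : uniq r -> k \in r -> {subset r <= s} -> nnmeasurable F ->
  M k r F v <= pints (flatW [seq j <- r | j != k]) (sr (pints (W k) (sq F))) v.
Proof.
move=> ur kr rs mF; elim: r v ur kr rs => //= j r IH v /andP[jr ur] kr rs.
have msq : nnmeasurable (sr (pints (W k) (sq F))).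
  by apply: nnmeasurable_poweR; apply: nnmeasurable_pints; exact: nnmeasurable_poweR.
have [jk|jk] := eqVneq j k.
  rewrite -jk M_notin//.
  have -> : [seq x <- r | x != j] = r.
    by apply/all_filterP/allP => x xr; apply: contraNneq jr => <-.
  apply: minkowski_pints => // i /flatten_mapP[x xr ix].
  apply: (disjW _ _ _ ix); [| |]; first by apply: rs; rewrite inE xr orbT.
    by apply: rs; rewrite mem_head.
  by apply: contraNneq jr => <-.
rewrite /flatW /= pints_cat; apply: le_pints; first exact: mM.
move=> w; apply: IH => //.
  by move: kr; rewrite inE eq_sym (negbTE jk).
by move=> x xr; apply: rs; rewrite inE xr orbT.
Qed.

Let hoelder_step (V : I -> 'rV[R]_N -> \bar R) r v : (forall k, nnmeasurable (V k)) ->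
  {subset r <= s} ->
  pints (flatW r) (fun v => \big[mule/1]_(k <- s) (V k v `^ c)) v <=
  \big[mule/1]_(k <- s) (M k r (V k) v `^ c).
Proof.
move=> mV; elim: r v => [|j r IH] v rs //=.
rewrite /flatW /= pints_cat.
have mp : nnmeasurable (fun v => \big[mule/1]_(k <- s) (V k v `^ c)).
  by apply: nnmeasurable_prod => k _; exact: nnmeasurable_poweR.
apply: (@le_trans _ _ (pints (W j) (fun v => \big[mule/1]_(k <- s) (M k r (V k) v `^ c)) v)).
  apply: le_pints; first exact: nnmeasurable_pints.
  by move=> w; apply: IH => x xr; apply: rs; rewrite inE xr orbT.
pose G k := if j == k then sq (M k r (V k)) else M k r (V k).
(* In the block [W j] the j-th function enters as its square with exponent c / 2, the others with
   exponent c; [cs] says that these add up to 1. *)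
pose e k := (if j == k then c / 2 else c)%R.
have mG k : nnmeasurable (G k).
  by rewrite /G; case: ifP => _; [apply: nnmeasurable_poweR|]; exact: mM.
have e0 k : (0 <= e k)%R by rewrite /e; case: ifP => _ //; rewrite divr_ge0.
have e1 : (\sum_(k <- s) e k = 1)%R.
  have js : j \in s by apply: rs; rewrite mem_head.
  rewrite (bigD1_seq j)//= /e eqxx.
  rewrite (eq_bigr (fun=> c)); last by move=> k kj; rewrite eq_sym (negbTE kj).
  have := cs; have -> : ((size s)%:R * c = \sum_(k <- s) c)%R.
    by rewrite big_const_seq count_predT iter_addr_0 mulr_natl.
  by rewrite (bigD1_seq j)//= => E; rewrite -[RHS]E; field.
have := @hoelder_pints _ _ (W j) _ s xpredT e G v (fun k _ => mG k) (fun k _ => e0 k) e1.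
rewrite (_ : (fun v => _) = (fun v => \big[mule/1]_(k <- s) (M k r (V k) v `^ c))); last first.
  apply/funext => w; apply: eq_bigr => k _; rewrite /G /e; case: ifP => _ //.
  rewrite /sq -poweRrM; congr (_ `^ _); by field.
move=> h; apply: (le_trans h); rewrite le_eqVlt; apply/orP; left; apply/eqP.
apply: eq_bigr => k _; rewrite /G /e; case: ifP => _ //.
by rewrite /sr -poweRrM; congr (_ `^ _); field.
Qed.

(* Iterated Hoelder, in which the square norm in the block [W k] of [V k] is
   then moved innermost by Minkowski. *)
Lemma mixed_loomis_whitney (V : I -> 'rV[R]_N -> \bar R) v :
  (forall k, nnmeasurable (V k)) ->
  pints (flatten [seq W j | j <- s]) (fun v => \big[mule/1]_(k <- s) (V k v `^ c)) v <=
  \big[mule/1]_(k <- s) (pints (flatten [seq W j | j <- [seq j <- s | j != k]])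
     (fun v => pints (W k) (fun v => V k v `^ 2) v `^ 2^-1) v `^ c).
Proof.
move=> mV; apply: (le_trans (hoelder_step v mV _)) => //.
rewrite !big_seq; apply: le_prode => k ks; first exact: poweR_ge0.
by apply: le_poweR => //; [exact: (mM k s (mV k)).2|exact: M_in].
Qed.

End loomis_whitney.

(** [S j i] marks a coordinate of which [g j] is independent. Coordinate by coordinate, those
    functions leave the integral and Hoelder applies to the others, whose exponents add up to 1. *)
Lemma finner (I : finType) (S : I -> pred 'I_N) (w : I -> R) z
    (g : I -> 'rV[R]_N -> \bar R) v :
  (forall j, nnmeasurable (g j)) -> (forall j, 0 <= w j)%R ->
  (forall j i, i \in z -> S j i -> indep i (g j)) ->
  (forall i, i \in z -> \sum_(j | ~~ S j i) w j = 1)%R ->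
  pints z (fun v => \big[mule/1]_j (g j v `^ w j)) v <=
  \big[mule/1]_j (pints [seq i <- z | ~~ S j i] (g j) v `^ w j).
Proof.
move=> mg w0; elim: z v => [//|i z IH] v ig w1.
have mG j : nnmeasurable (pints [seq i <- z | ~~ S j i] (g j)).
  exact: nnmeasurable_pints.
apply: (@le_trans _ _ (pint i (fun v =>
    \big[mule/1]_j (pints [seq i <- z | ~~ S j i] (g j) v `^ w j)) v)).
  apply: le_pint.
    apply: nnmeasurable_pints; apply: nnmeasurable_prod => j _.
    exact: nnmeasurable_poweR.
  move=> u; apply: IH.
    by move=> j k kz; apply: ig; rewrite inE kz orbT.
  by move=> k kz; apply: w1; rewrite inE kz orbT.
under eq_fun do rewrite (bigID (fun j => S j i)) /=.
pose C u := \big[mule/1]_(j | S j i) (pints [seq i <- z | ~~ S j i] (g j) u `^ w j).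
have C0 u : 0 <= C u by apply: prode_ge0 => j _; exact: poweR_ge0.
have mH : nnmeasurable (fun u => \big[mule/1]_(j | ~~ S j i)
    (pints [seq i <- z | ~~ S j i] (g j) u `^ w j)).
  by apply: nnmeasurable_prod => j _; exact: nnmeasurable_poweR.
rewrite (pintZl (C := C) _ C0 mH); last first.
  move=> u s; apply: eq_bigr => j Sji; congr (_ `^ _).
  by apply: indep_pints; apply: ig => //; rewrite mem_head.
rewrite [leRHS](bigID (fun j => S j i)) /=.
have h := @hoelder_pint _ _ i _ (index_enum I) (fun j => ~~ S j i) w
  (fun j => pints [seq i <- z | ~~ S j i] (g j)) v (fun j _ => mG j) (fun j _ => w0 j)
  (w1 i (mem_head _ _)).
apply: (@le_trans _ _ (C v * \big[mule/1]_(j | ~~ S j i)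
  (pint i (pints [seq i <- z | ~~ S j i] (g j)) v `^ w j))).
  by apply: lee_wpmul2l.
rewrite le_eqVlt; apply/orP; left; apply/eqP; congr (_ * _).
  by apply: eq_bigr => j ->.
by apply: eq_bigr => j /negbTE ->.
Qed.

End mixed_norms.

(** * The case of one column *)

Lemma big_option (S : Type) (idx : S) (op : Monoid.com_law idx) (I : finType)
    (F : option I -> S) :
  \big[op/idx]_o F o = op (F None) (\big[op/idx]_i F (Some i)).
Proof.
rewrite (bigD1 None)//=; congr (op _ _).
rewrite (reindex_omap Some id)/=; last by case.
by apply: eq_bigl => k; rewrite /= eqxx.
Qed.

Lemma sqrt_cube_sqr (R : realType) (a b : \bar R) : 0 <= a -> 0 <= b ->
  (a * a * a * (b * b)) `^ 2^-1 = a `^ (3 / 2) * b.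
Proof.
move=> a0 b0; rewrite poweRM ?mule_ge0// -poweR_cube// -poweRrM.
by rewrite -[b * b]poweR_sqr// poweR_sqrK.
Qed.

Lemma perm_flatten_pair (I : Type) (A : eqType) (f g : I -> A) r :
  perm_eq (flatten [seq [:: f k; g k] | k <- r]) (map f r ++ map g r).
Proof.
elim: r => //= k r IH; rewrite perm_cons -[g k :: map g r]cat1s.
by rewrite perm_sym perm_catCA /= perm_cons perm_sym.
Qed.

Section central_vectors.
Variables (R : realType) (N q : nat) (T : 'I_q -> 'I_N).
Hypothesis injT : injective T.
Implicit Types (v w : 'rV[R]_N) (s : 'I_q -> R).

Definition tvec s : 'rV[R]_N :=
  \row_i (if [pick k | T k == i] is Some k then s k else 0%R).

Lemma tvecE s k : tvec s 0%R (T k) = s k.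
Proof.
rewrite mxE; case: pickP => [k' /eqP/injT -> //|/(_ k)].
by rewrite eqxx.
Qed.

Lemma tvec_out s i : (forall k, i != T k) -> tvec s 0%R i = 0%R.
Proof.
by move=> iT; rewrite mxE; case: pickP => // k; rewrite eq_sym (negbTE (iT k)).
Qed.

Lemma tvecD s s' : (tvec s + tvec s' = tvec (fun k => s k + s' k))%R.
Proof. by apply/rowP => i; rewrite !mxE; case: pickP => // _; rewrite addr0. Qed.

Lemma tvec0 s : (forall k, s k = 0%R) -> tvec s = 0%R.
Proof. by move=> s0; apply/rowP => i; rewrite !mxE; case: pickP => // k _. Qed.

Lemma eq_tvec s s' : s =1 s' -> tvec s = tvec s'.
Proof. by move=> /funext ->. Qed.

Lemma measurable_addtvec (s : 'I_q -> 'rV[R]_N -> R) :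
  (forall k, measurable_fun setT (s k)) ->
  measurable_fun setT (fun v => v + tvec (fun k => s k v))%R.
Proof.
move=> ms; apply: measurable_fun_mx => i j; rewrite ord1.
have mj := @measurable_entry _ R 1 N 0%R j.
under eq_fun do rewrite !mxE.
case: pickP => [k _|_]; first exact: measurable_funD.
by under eq_fun do rewrite addr0.
Qed.

Lemma upd_addtvec v i x s : (forall k, i != T k) ->
  (upd v i x + tvec s = upd (v + tvec s) i x)%R.
Proof.
move=> iT; apply/rowP => j; rewrite updE mxE updE [in RHS]mxE.
by case: eqP => // ->; rewrite tvec_out// addr0.
Qed.

End central_vectors.

Section core.
Variables (R : realType) (N q : nat).
Variables (X T : 'I_q -> 'I_N) (Y : 'I_N).
Hypotheses (q0 : (0 < q)%N) (injX : injective X) (injT : injective T).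
Hypotheses (XT : forall k k', X k != T k') (XY : forall k, X k != Y).
Hypothesis (YT : forall k, Y != T k).

Notation env := 'rV[R]_N.
Notation rho := (radon_norm R).
Notation tvec := (@tvec R N q T).

Let m (k : 'I_q) (v : env) : R := (v 0 (X k) * v 0 Y / 2)%R.

(** The displacement of t in the projections for a single column: [Some k] is the one that deletes
    x_k, [None] the one that deletes y. *)
Definition central_shift (o : option 'I_q) (v : env) : env :=
  if o is Some k then tvec (fun k' => if k' == k then m k v else 0%R)
  else tvec (fun k' => - m k' v)%R.

(** Numerators of the exponents for p = 1, where the denominator D equals 3q. *)
Definition column_weight (o : option 'I_q) : R :=
  if o is Some _ then 2 else (q%:R + 1)%R.

Definition column_coord (o : option 'I_q) : 'I_N := if o is Some k then X k else Y.

Definition column_coords : seq 'I_N :=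
  map X (enum 'I_q) ++ Y :: map T (enum 'I_q).

Lemma mem_column_coords i : (i \in column_coords) =
  [exists k, i == X k] || (i == Y) || [exists k, i == T k].
Proof.
rewrite mem_cat inE -orbA; congr (_ || (_ || _)).
all: apply/mapP/existsP => [[k _ ->]|[k /eqP ->]]; exists k => //.
all: by rewrite mem_enum.
Qed.

Lemma uniq_column_coords : uniq column_coords.
Proof.
rewrite cat_uniq /= (map_inj_uniq injX) (map_inj_uniq injT) enum_uniq /= andbT; apply/andP; split.
  rewrite negb_or; apply/andP; split.
    by apply/mapP => -[k _ /eqP]; rewrite eq_sym (negbTE (XY k)).
  apply/hasPn => _ /mapP[k _ ->]; apply/mapP => -[k' _ /eqP].
  by rewrite eq_sym (negbTE (XT _ _)).
by apply/mapP => -[k _ /eqP]; rewrite (negbTE (YT k)).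
Qed.

Let W (k : 'I_q) := [:: X k; T k].
Let xt := flatten [seq W k | k <- enum 'I_q].

Let perm_xt : perm_eq column_coords (xt ++ [:: Y]).
Proof.
rewrite /column_coords /xt perm_sym.
apply: (@perm_trans _ ((map X (enum 'I_q) ++ map T (enum 'I_q)) ++ [:: Y])).
  by rewrite perm_cat2r; exact: perm_flatten_pair.
by rewrite -catA perm_cat2l perm_catC.
Qed.

Let perm_Y : perm_eq [seq i <- column_coords | i != Y] xt.
Proof.
have -> : [seq i <- column_coords | i != Y] = map X (enum 'I_q) ++ map T (enum 'I_q).
  rewrite /column_coords filter_cat /= eqxx /=; congr (_ ++ _); apply/all_filterP/allP.
    by move=> _ /mapP[k _ ->].
  by move=> _ /mapP[k _ ->]; rewrite eq_sym.
by rewrite perm_sym; exact: perm_flatten_pair.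
Qed.

Let filterX k : [seq i <- column_coords | i != X k] =
  map X [seq j <- enum 'I_q | j != k] ++ Y :: map T (enum 'I_q).
Proof.
rewrite /column_coords filter_cat /= eq_sym XY; congr (_ ++ _ :: _).
  rewrite filter_map; congr (map _ _); apply: eq_filter => j /=.
  by rewrite (inj_eq injX).
by apply/all_filterP/allP => _ /mapP[j _ ->]; rewrite eq_sym.
Qed.

Let perm_X k : perm_eq [seq i <- column_coords | i != X k]
  (flatten [seq W j | j <- [seq j <- enum 'I_q | j != k]] ++ [:: Y; T k]).
Proof.
rewrite filterX.
apply: (@perm_trans _ (map X [seq j <- enum 'I_q | j != k] ++
    (map T [seq j <- enum 'I_q | j != k] ++ [:: Y; T k]))); last first.
  by rewrite catA perm_cat2r perm_sym; exact: perm_flatten_pair.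
rewrite perm_cat2l perm_sym perm_catC /= perm_cons -(map_cons T k) perm_sym.
apply: perm_map; rewrite -rem_filter ?enum_uniq//.
by apply: perm_to_rem; rewrite mem_enum.
Qed.

Variable P : option 'I_q -> env -> \bar R.
Hypothesis mP : forall o, nnmeasurable (P o).
Hypothesis indepP : forall o, indep (column_coord o) (P o).

Let entryD (v : env) s i : (forall k, i != T k) -> (v + tvec s)%R 0%R i = v 0%R i.
Proof. by move=> iT; rewrite mxE tvec_out// addr0. Qed.

Let mD (v : env) s k : m k (v + tvec s) = m k v.
Proof. by rewrite /m !entryD. Qed.

Let mm k : measurable_fun setT (m k).
Proof.
apply: measurable_funM => //; apply: measurable_funM; exact: measurable_entry.
Qed.

Let shear (s : 'I_q -> env -> R) (F : env -> \bar R) (L : seq 'I_N) : (forall k, measurable_fun setT (s k)) ->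
  (forall k (v v' : env), (forall i, (forall k', i != T k') -> v 0%R i = v' 0%R i) -> s k v = s k v') ->
  nnmeasurable F ->
  pints (L ++ map T (enum 'I_q)) (fun v => F (v + tvec (fun k => s k v))%R) =
  pints (L ++ map T (enum 'I_q)) F.
Proof.
move=> ms sE mF; rewrite !pints_cat; congr (pints L _).
apply: (pints_shear (a := fun v => tvec (fun k => s k v))) => //.
  move=> v j /mapP jT; apply: tvec_out => k; apply/eqP => jk; apply: jT.
  by exists k => //; rewrite mem_enum.
move=> v w vw; apply: eq_tvec => k; apply: sE => i iT; apply: vw.
by apply/mapP => -[k' _ /eqP]; rewrite (negbTE (iT k')).
Qed.

(* Absorbs the shears by the other [x_j y / 2]; the remaining shear of [Q k] is
   by [x_k y]. *)
Let Q k (w : env) := P (Some k) (w + tvec (fun k' => if k' == k then 0%R else m k' w))%R.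

Let mQ k : nnmeasurable (Q k).
Proof.
apply: (nnmeasurable_comp _ (mP (Some k))).
apply: (@measurable_addtvec R N q T (fun k' w => if k' == k then 0%R else m k' w)).
by move=> k'; case: (k' == k).
Qed.

Let indepQ k : indep (X k) (Q k).
Proof.
move=> v s; rewrite /Q upd_addtvec// (indepP (Some k)); congr (P _ (_ + _)%R).
apply: eq_tvec => k'; case: eqP => // /eqP kk'.
by rewrite /m !updE (inj_eq injX) (negbTE kk') [Y == _]eq_sym (negbTE (XY _)).
Qed.

Let K k (v : env) : env := tvec (fun k' => if k' == k then v 0 (X k) * v 0 Y else 0)%R.

Let QK k v := Q k (v + K k v)%R.

Let mQK k : nnmeasurable (QK k).
Proof.
apply: (nnmeasurable_comp _ (mQ k)).
apply: (@measurable_addtvec R N q T (fun k' v => if k' == k then v 0 (X k) * v 0 Y else 0)%R).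
by move=> k'; case: (k' == k) => //; apply: measurable_funM; exact: measurable_entry.
Qed.

(** In the variables (x_k, t_k) this is the X-ray transform of [Q k] to the power 2/3; with this
    power the L^(3/2) norm becomes an integral of [Q k] itself. *)
Let U k := pint Y (fun v => QK k v `^ (2 / 3)).

Let mU k : nnmeasurable (U k).
Proof. by apply: nnmeasurable_pint; exact: (nnmeasurable_poweR _ (mQK k)). Qed.

Let qR0 : (0 < q%:R :> R)%R. Proof. by rewrite ltr0n. Qed.
Let qR1 : (1 <= q%:R :> R)%R. Proof. by rewrite ler1n. Qed.
Let q3 : (0 < 3 * q%:R :> R)%R. Proof. by rewrite mulr_gt0. Qed.
Let q21 : (0 < 2 * q%:R - 1 :> R)%R. Proof. by have := qR1; lra. Qed.

Let sum_qV : (\sum_(k < q) q%:R^-1 = 1 :> R)%R.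
Proof. by rewrite sumr_const card_ord -(mulr_natr q%:R^-1) mulVf// gt_eqF. Qed.

Let integrand v := \big[mule/1]_o (P o (v + central_shift o v)%R `^ (column_weight o / (3 * q%:R))).

Let mpointwise : nnmeasurable integrand.
Proof.
apply: nnmeasurable_prod => o _; apply: nnmeasurable_poweR.
apply: (nnmeasurable_comp _ (mP o)); case: o => [k|].
  apply: (@measurable_addtvec R N q T (fun k' v => if k' == k then m k v else 0)%R).
  by move=> k'; case: (k' == k).
apply: (@measurable_addtvec R N q T (fun k' v => - m k' v)%R) => k'.
exact: measurableT_comp.
Qed.

Let sheared v := P None v `^ ((q%:R + 1) / (3 * q%:R)) *
  \big[mule/1]_k (QK k v `^ (2 / (3 * q%:R))).

(** The shear by all the x_k y / 2 cancels the displacement of the function attached to y. In the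
    function attached to x_k it doubles the component x_k y / 2 to x_k y and creates the other
    components, which [Q] absorbs. *)
Let step1 : pints column_coords integrand = pints xt (pint Y sheared).
Proof.
rewrite -[column_coords]/(map X (enum 'I_q) ++ [:: Y] ++ map T (enum 'I_q)) catA.
rewrite -(shear (s := m))//; last first.
  by move=> k v v' vv'; rewrite /m !vv'.
have -> : (fun v => integrand (v + tvec (m ^~ v))%R) = sheared.
  apply/funext => v; rewrite /integrand big_option /=; congr (_ * _).
    congr (P _ _ `^ _); rewrite -addrA tvecD tvec0 ?addr0// => k.
    by rewrite mD subrr.
  apply: eq_bigr => k _; congr (P _ _ `^ _); rewrite -!addrA !tvecD; congr (_ + _)%R.
  apply: eq_tvec => k'; rewrite !mD; case: eqP => [->|_]; last by rewrite addr0 add0r.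
  by rewrite addr0 /m; field.
have ms : nnmeasurable sheared.
  apply: nnmeasurableM; first exact: nnmeasurable_poweR.
  by apply: nnmeasurable_prod => k _; exact: nnmeasurable_poweR.
by rewrite -catA (pints_perm ms perm_xt) pints_cat.
Qed.

Let step2 v : pint Y sheared v <=
  P None v `^ ((q%:R + 1) / (3 * q%:R)) * \big[mule/1]_k (U k v `^ (q%:R^-1)).
Proof.
have m23 k : nnmeasurable (fun v => QK k v `^ (2 / 3)) by exact: nnmeasurable_poweR.
rewrite (pintZl (C := fun v => P None v `^ ((q%:R + 1) / (3 * q%:R)))
  (F := fun v => \big[mule/1]_k (QK k v `^ (2 / (3 * q%:R))))); first last.
- by apply: nnmeasurable_prod => k _; exact: nnmeasurable_poweR.
- by move=> w; exact: poweR_ge0.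
- by move=> w s; rewrite (indepP None).
apply: lee_wpmul2l; first exact: poweR_ge0.
have := @hoelder_pint R N Y _ (index_enum 'I_q) xpredT (fun=> (q%:R^-1)%R)
  (fun k v => QK k v `^ (2 / 3)) v (fun k _ => m23 k).
move=> h; apply: le_trans (h _ _).
- rewrite le_eqVlt; apply/orP; left; apply/eqP; congr (pint _ _ _).
  apply/funext => w; apply: eq_bigr => k _; rewrite -poweRrM; congr (_ `^ _).
  by field; rewrite gt_eqF.
- by move=> k _; rewrite invr_ge0 ltW.
- exact: sum_qV.
Qed.

(** The square of [V k] is the cube of [U k], so the L^2 norm in the block (x_k, t_k) is the L^3
    norm of the X-ray transform to the power 3/2. *)
Let V k v := U k v `^ (3 / 2).

Let mV k : nnmeasurable (V k).
Proof. exact: nnmeasurable_poweR. Qed.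

(** The solution of q c - c / 2 = 1, the balance of exponents in [mixed_loomis_whitney] for q
    blocks. *)
Let c : R := (2 / (2 * q%:R - 1))%R.

Let step3 v : pints xt (fun v => P None v `^ ((q%:R + 1) / (3 * q%:R)) *
    \big[mule/1]_k (U k v `^ (q%:R^-1))) v <=
  pints xt (P None) v `^ ((q%:R + 1) / (3 * q%:R)) *
  pints xt (fun v => \big[mule/1]_(k <- enum 'I_q) (V k v `^ c)) v `^ ((2 * q%:R - 1) / (3 * q%:R)).
Proof.
have mVV : nnmeasurable (fun v => \big[mule/1]_(k <- enum 'I_q) (V k v `^ c)).
  by apply: nnmeasurable_prod => k _; exact: nnmeasurable_poweR.
(* Hoelder for two functions, with exponents (q + 1) / (3q) and (2q - 1) / (3q); the third exponent
   is 0. The second one turns V^c into U^(1/q). *)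
have h := @hoelder_pints3 R N xt _ _ _ v ((q%:R + 1) / (3 * q%:R))%R
  ((2 * q%:R - 1) / (3 * q%:R))%R 0%R (mP None) mVV (mP None).
apply: le_trans (le_trans (h _ _ _ _) _).
- rewrite le_eqVlt; apply/orP; left; apply/eqP; congr (pints _ _ _).
  apply/funext => w; congr (_ * _); rewrite poweRe0 mule1 poweR_prod; last first.
    by move=> k _; exact: poweR_ge0.
  rewrite big_enum /=; apply: eq_bigr => k _; rewrite /V -!poweRrM; congr (_ `^ _).
  by rewrite /c; field; rewrite !gt_eqF.
- by rewrite divr_ge0 ?ltW// addr_ge0// ltW.
- by rewrite divr_ge0 ?ltW.
- by [].
- by field; rewrite gt_eqF.
- by rewrite poweRe0 mule1.
Qed.

(** For fixed values of the other coordinates this is the X-ray bound in the plane (x_k, t_k): the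
    integral of U^3 is at most rho^3 J^2, and the square root is taken. *)
Let step5 k v : pints (W k) (fun v => V k v `^ 2) v `^ 2^-1 <=
  rho `^ (3 / 2) * pints [:: Y; T k] (Q k) v.
Proof.
pose H y u := Q k (upd (upd v Y y) (T k) u) `^ (2 / 3).
pose J := pints [:: Y; T k] (Q k) v.
have J0 : 0 <= J by exact: pints_ge0.
have mH : nnmeasurable (fun z : R * R => H z.1 z.2).
  apply: (nnmeasurable_comp (h := fun z : R * R => upd (upd v Y z.1) (T k) z.2) _
    (nnmeasurable_poweR (2 / 3) (mQ k))).
  apply: (measurableT_comp (measurable_upd (T k)) (g := fun z : R * R => (upd v Y z.1, z.2))).
  apply: measurable_fun_pair; last exact: measurable_snd.
  exact: (measurableT_comp (measurable_updr v Y) measurable_fst).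
have HJ : \int[lebR]_y \int[lebR]_u H y u `^ (3 / 2) <= J.
  rewrite le_eqVlt; apply/orP; left; apply/eqP.
  apply: eq_integral => y _; apply: eq_integral => u _.
  rewrite /H -poweRrM (_ : 2 / 3 * (3 / 2) = 1)%R; last by field.
  by rewrite poweRe1// (mQ k).2.
have h := xray_radon_norm mH HJ.
have rho0 := radon_norm_ge0 R.
have E : pints (W k) (fun v => V k v `^ 2) v =
    \int[lebR]_x \int[lebR]_t (xray H x t * xray H x t * xray H x t).
  apply: eq_integral => x _; apply: eq_integral => t _.
  have -> : xray H x t = U k (upd (upd v (X k) x) (T k) t).
    apply: eq_integral => y _; rewrite /H /QK; congr (_ `^ _).
    (* [Q k] does not see x_k, so the slope x may be written into that coordinate; only its effect
       on t_k through the shear [K] remains. *)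
    rewrite -(indepQ k _ x); congr (Q k _); apply/rowP => i.
    set w := upd (upd (upd v (X k) x) (T k) t) Y y.
    have -> : K k w = tvec (fun k' => if k' == k then (x * y)%R else 0%R).
      apply: eq_tvec => k'; case: eqP => // _.
      by rewrite /w !updE !eqxx (negbTE (XY _)) (negbTE (XT _ _)).
    rewrite [RHS]mxE /w !updE.
    have [->|iT] := eqVneq i (T k).
      by rewrite tvecE// eqxx eq_sym (negbTE (XT _ _)) eq_sym (negbTE (YT _)).
    have -> : tvec (fun k' => if k' == k then (x * y)%R else 0%R) 0%R i = 0%R.
      rewrite mxE; case: pickP => // k' /eqP; case: eqP => // -> Ti.
      by rewrite Ti eqxx in iT.
    rewrite addr0; case: (eqVneq i (X k)) => [->|iX]; first by rewrite (negbTE (XY _)).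
    by case: eqP.
  rewrite /V -poweRrM (_ : 3 / 2 * 2 = 3)%R; last by field.
  by rewrite poweR_cube// (mU k).2.
rewrite E; apply: le_trans (le_poweR _ _ h) _.
- by rewrite invr_ge0.
- apply: integral_ge0 => x _; apply: integral_ge0 => t _.
  have x0 := (nnmeasurable_xray mH).2 (x, t).
  exact: (mule_ge0 (mule_ge0 x0 x0) x0).
- by rewrite sqrt_cube_sqr.
Qed.

(** Here all the t coordinates are integrated, so the shear by the other x_j y / 2 in the definition
    of [Q k] can be undone and [P (Some k)] reappears. *)
Let step6 k v : pints (flatten [seq W j | j <- [seq j <- enum 'I_q | j != k]])
     (fun v => pints (W k) (fun v => V k v `^ 2) v `^ 2^-1) v <=
  rho `^ (3 / 2) * pints [seq i <- column_coords | i != X k] (P (Some k)) v.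
Proof.
apply: (@le_trans _ _ (pints (flatten [seq W j | j <- [seq j <- enum 'I_q | j != k]])
    (fun v => rho `^ (3 / 2) * pints [:: Y; T k] (Q k) v) v)).
  apply: le_pints; last by move=> w; exact: step5.
  by apply: nnmeasurable_poweR; apply: nnmeasurable_pints; exact: nnmeasurable_poweR.
rewrite (pintsZl (C := fun=> rho `^ (3 / 2)) (F := pints [:: Y; T k] (Q k))) //; first last.
- exact: nnmeasurable_pints.
- by move=> _; exact: poweR_ge0.
rewrite -pints_cat -(pints_perm (mQ k) (perm_X k)) filterX -[Y :: _]cat1s catA.
rewrite (shear (s := fun k' w => if k' == k then 0%R else m k' w))//.
- by move=> k'; case: (k' == k).
- by move=> k' w w' ww'; case: (k' == k) => //; rewrite /m !ww'.
Qed.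

Lemma core_estimate v :
  pints column_coords (fun v => \big[mule/1]_o (P o (v + central_shift o v)%R
    `^ (column_weight o / (3 * q%:R)))) v <=
  rho * \big[mule/1]_o (pints [seq i <- column_coords | i != column_coord o] (P o) v
    `^ (column_weight o / (3 * q%:R))).
Proof.
rewrite step1; have rho0 := radon_norm_ge0 R.
have mF : nnmeasurable (pint Y sheared).
  apply: nnmeasurable_pint; apply: nnmeasurableM; first exact: nnmeasurable_poweR.
  by apply: nnmeasurable_prod => k _; exact: nnmeasurable_poweR.
apply: (le_trans (le_pints xt mF step2 v)); apply: (le_trans (step3 v)).
rewrite big_option muleCA /= -(pints_perm (mP None) perm_Y).
apply: lee_wpmul2l; first exact: poweR_ge0.
have c0 : (0 <= c)%R by rewrite divr_ge0// ltW.
have cs : ((size (enum 'I_q))%:R * c - c / 2 = 1)%R.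
  by rewrite size_enum_ord /c; field; rewrite gt_eqF.
have disjW j k : j \in enum 'I_q -> k \in enum 'I_q -> j != k ->
    forall i, i \in W j -> i \notin W k.
  move=> _ _ jk i; rewrite /W !inE => /orP[]/eqP ->; rewrite negb_or.
    by rewrite (inj_eq injX) jk XT.
  by rewrite (inj_eq injT) jk andbT eq_sym XT.
have := mixed_loomis_whitney (enum_uniq 'I_q) c0 cs disjW v mV.
set LW := \big[mule/1]_(k <- enum 'I_q) _ => hLW.
have hLW' : LW <= \big[mule/1]_(k <- enum 'I_q)
    ((rho `^ (3 / 2) * pints [seq i <- column_coords | i != X k] (P (Some k)) v) `^ c).
  apply: le_prode => k _; first exact: poweR_ge0.
  apply: (le_poweR c0 _ (step6 k v)).
  apply: pints_ge0; apply: nnmeasurable_poweR; apply: nnmeasurable_pints.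
  exact: nnmeasurable_poweR.
have e0 : (0 <= (2 * q%:R - 1) / (3 * q%:R) :> R)%R by rewrite divr_ge0 ?ltW.
have pp0 : 0 <= pints (flatten [seq W j | j <- enum 'I_q])
    (fun v => \big[mule/1]_(k <- enum 'I_q) (V k v `^ c)) v.
  by apply: pints_ge0; apply: nnmeasurable_prod => k _; exact: nnmeasurable_poweR.
apply: (le_trans (le_poweR e0 pp0 (le_trans hLW hLW'))).
rewrite poweR_prod; last by move=> k _; exact: poweR_ge0.
rewrite big_enum /=.
under eq_bigr => k _.
  rewrite -poweRrM poweRM; [|exact: poweR_ge0|exact: pints_ge0].
  (* Each of the q functions contributes rho to the power 1/q, in all rho to the power 1. *)
  rewrite -poweRrM (_ : 3 / 2 * (c * ((2 * q%:R - 1) / (3 * q%:R))) = q%:R^-1)%R; last first.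
    by rewrite /c; field; rewrite !gt_eqF.
  rewrite (_ : c * ((2 * q%:R - 1) / (3 * q%:R)) = 2 / (3 * q%:R))%R; last first.
    by rewrite /c; field; rewrite !gt_eqF.
  over.
rewrite big_split /= poweR_sum//.
by rewrite sum_qV poweRe1.
Qed.

End core.

(** * Extreme exponents and their average *)

Lemma big_fst (S : Type) (idx : S) (op : Monoid.com_law idx) (I J : finType)
    (i : I) (F : I * J -> S) :
  \big[op/idx]_(z | z.1 == i) F z = \big[op/idx]_j F (i, j).
Proof.
rewrite (reindex_onto (fun j => (i, j)) snd) /=; last by case=> a b /= /eqP ->.
by apply: eq_bigl => j; rewrite !eqxx.
Qed.

Section vertices.
Variables (R : realType) (N q p : nat).
Notation J := ('I_p * option 'I_q)%type.
Notation env := 'rV[R]_N.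
Notation rho := (radon_norm R).
Variables (c : J -> 'I_N) (T : 'I_q -> 'I_N).
Hypotheses (q0 : (0 < q)%N) (p0 : (0 < p)%N) (injc : injective c) (injT : injective T).
Hypothesis cT : forall j k, c j != T k.
Hypothesis covered : forall i, [exists j, i == c j] || [exists k, i == T k].

Let X (l : 'I_p) (k : 'I_q) := c (l, Some k).
Let Y (l : 'I_p) := c (l, None).

Definition rh_shift (j : J) : env -> env := central_shift (X j.1) T (Y j.1) j.2.

Definition rh_dim : R := (q%:R * p%:R + p%:R + 2 * q%:R - 1)%R.
Notation D := rh_dim.

Let qR1 : (1 <= q%:R :> R)%R. Proof. by rewrite ler1n. Qed.
Let pR1 : (1 <= p%:R :> R)%R. Proof. by rewrite ler1n. Qed.
Let q3 : (0 < 3 * q%:R :> R)%R. Proof. by have := qR1; lra. Qed.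

Lemma rh_dim_gt0 : (0 < D)%R.
Proof.
rewrite /D; have := qR1; have := pR1 => p1 q1.
have : (0 <= q%:R * p%:R :> R)%R by rewrite mulr_ge0 ?ler0n.
lra.
Qed.
Let D0 := rh_dim_gt0.

Let cw0 (o : option 'I_q) : (0 <= column_weight R o)%R.
Proof. by case: o => [k|] /=; rewrite ?addr_ge0// ler0n. Qed.

Let w (l : 'I_p) (j : J) : R :=
  (if j.1 == l then column_weight R j.2 / D else D^-1)%R.

Let w0 l j : (0 <= w l j)%R.
Proof.
rewrite /w; case: ifP => _; last by rewrite invr_ge0 ltW.
exact: divr_ge0 (cw0 _) (ltW D0).
Qed.

Let sum_column_weight : (\sum_(o : option 'I_q) column_weight R o = 3 * q%:R + 1)%R.
Proof.
rewrite big_option /= sumr_const card_ord -(mulr_natr 2 q); ring.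
Qed.

(** The sum exceeds 1 by the exponent 1/D of a single function outside the column l; this determines
    D. *)
Let sum_w l : (\sum_j w l j = 1 + D^-1)%R.
Proof.
have Dn0 := lt0r_neq0 D0.
have -> : (\sum_j w l j = \sum_l' \sum_o w l (l', o))%R.
  by rewrite pair_bigA /=; apply: eq_bigr => -[].
rewrite (bigD1 l)//= /w /=.
have -> : (\sum_(o : option 'I_q) (if l == l then column_weight R o / D else D^-1) = (3 * q%:R + 1) / D)%R.
  by rewrite -sum_column_weight mulr_suml; apply: eq_bigr => o _; rewrite eqxx.
have -> : (\sum_(l' < p | l' != l) \sum_(o : option 'I_q)
    (if l' == l then column_weight R o / D else D^-1) = (p%:R - 1) * ((q%:R + 1) / D))%R.
  rewrite (eq_bigr (fun=> (q%:R + 1) / D)%R); last first.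
    move=> l' /negbTE ->; rewrite sumr_const card_option card_ord.
    by rewrite -(mulr_natr D^-1) -natr1 mulrC.
  rewrite sumr_const cardC1 card_ord -(mulr_natr ((q%:R + 1) / D)) mulrC; congr (_ * _)%R.
  by rewrite -subn1 natrB.
rewrite mulrA -mulrDl (_ : 3 * q%:R + 1 + _ = D + 1)%R; last by rewrite /D; ring.
by rewrite mulrDl mulfV// div1r.
Qed.

Let entry_measurable (i : 'I_N) : measurable_fun setT (fun v : env => v 0%R i).
Proof. exact: measurable_entry. Qed.

Lemma measurable_rh_shift j : measurable_fun setT (fun v : env => v + rh_shift j v)%R.
Proof.
case: j => l [k|].
  apply: (@measurable_addtvec R N q T (fun k' v =>
    if k' == k then (v 0 (X l k) * v 0 (Y l) / 2)%R else 0%R)) => k'.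
  by case: (k' == k) => //; apply: measurable_funM => //; exact: measurable_funM.
apply: (@measurable_addtvec R N q T (fun k' v =>
  (- (v 0 (X l k') * v 0 (Y l) / 2))%R)) => k'.
by apply: measurableT_comp => //; apply: measurable_funM => //; exact: measurable_funM.
Qed.

Variable P : J -> env -> \bar R.
Hypothesis mP : forall j, nnmeasurable (P j).
Hypothesis indepP : forall j, indep (c j) (P j).

Let sP j (v : env) := P j (v + rh_shift j v)%R.

Let msP j : nnmeasurable (sP j).
Proof. exact: nnmeasurable_comp (measurable_rh_shift j) (mP j). Qed.

Section vertex.
Variable l : 'I_p.

Let U := column_coords (X l) T (Y l).
Let Z := [seq c j | j <- enum {: J} & j.1 != l].

Let mem_U i : (i \in U) = [exists o, i == c (l, o)] || [exists k, i == T k].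
Proof.
rewrite mem_column_coords; congr (_ || _).
apply/orP/existsP => [[/existsP[k ik]|iY]|[[k|] ik]].
- by exists (Some k).
- by exists None.
- by left; apply/existsP; exists k.
- by right.
Qed.

Let cU j : (c j \in U) = (j.1 == l).
Proof.
rewrite mem_U; case: (existsP (P := fun k => c j == T k)) => [[k]|_].
  by rewrite (negbTE (cT _ _)).
rewrite orbF; apply/existsP/eqP => [[s]| <-].
  by rewrite (inj_eq injc) => /eqP ->.
by exists j.2; rewrite -surjective_pairing.
Qed.

Let TU k : T k \in U.
Proof. by rewrite mem_U; apply/orP; right; apply/existsP; exists k. Qed.

Let perm_ZU : perm_eq (enum 'I_N) (Z ++ U).
Proof.
apply: uniq_perm; first exact: enum_uniq.
  rewrite cat_uniq (map_inj_uniq injc) filter_uniq ?enum_uniq//=; apply/andP; split.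
    apply/hasPn => i; apply: contraL => /mapP[j].
    by rewrite mem_filter => /andP[jl _] ->; rewrite cU.
  apply: uniq_column_coords => //.
  - by move=> k k' /injc[].
  - by move=> k k'; exact: cT.
  - by move=> k; apply/eqP => /injc.
  - by move=> k; exact: cT.
move=> i; rewrite mem_enum mem_cat; apply/esym/orP.
have [/existsP[j /eqP ->]|/existsP[k /eqP ->]] := orP (covered i); last by right.
rewrite cU; case: eqP => jl; [by right|left].
by apply: map_f; rewrite mem_filter mem_enum andbT; apply/eqP.
Qed.

Let core v := \big[mule/1]_o (sP (l, o) v `^ (column_weight R o / (3 * q%:R))).

Let mcore : nnmeasurable core.
Proof. by apply: nnmeasurable_prod => o _; exact: nnmeasurable_poweR. Qed.

Let splitE (G : J -> \bar R) : (forall j, 0 <= G j) ->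
  \big[mule/1]_j (G j `^ w l j) =
  (\big[mule/1]_o (G (l, o) `^ (column_weight R o / (3 * q%:R)))) `^ (3 * q%:R / D)
  * \big[mule/1]_(j | j.1 != l) (G j `^ D^-1).
Proof.
move=> G0; rewrite (bigID (fun j => j.1 == l)) /= big_fst; congr (_ * _).
  rewrite poweR_prod; last by move=> o _; exact: poweR_ge0.
  apply: eq_bigr => o _; rewrite -poweRrM /w eqxx; congr (_ `^ _).
  by field; rewrite !lt0r_neq0//; rewrite ltr0n.
by apply: eq_bigr => j /negbTE jl; rewrite /w jl.
Qed.

(** Hoelder over the variables of [U], with exponent 3q/D on the whole block [core] and 1/D on each
    function of another column. The block is bounded by [core_estimate]; the displacements of the
    other functions depend only on coordinates outside [U], so they are constant translations in
    t. *)
Let inner v : pints U (fun v => \big[mule/1]_j (sP j v `^ w l j)) v <=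
  rho `^ (3 * q%:R / D) *
  \big[mule/1]_j (pints [seq i <- U | i != c j] (P j) v `^ w l j).
Proof.
have Dn0 := lt0r_neq0 D0.
pose r := None :: [seq Some j | j <- index_enum J & j.1 != l].
pose f o := if o is Some j then sP j else core.
pose e (o : option J) : R := (if o is Some _ then D^-1 else 3 * q%:R / D)%R.
have mf o : nnmeasurable (f o) by case: o.
have e0 o : (0 <= e o)%R by case: o => [j|] /=; rewrite ?invr_ge0 ?divr_ge0 ?ltW.
have e1 : (\sum_(o <- r) e o = 1)%R.
  rewrite big_cons big_map big_filter /=.
  have := sum_w l; rewrite (bigID (fun j => j.1 == l)) /= big_fst.
  have -> : (\sum_o w l (l, o) = (3 * q%:R + 1) / D)%R.
    by rewrite -sum_column_weight mulr_suml; apply: eq_bigr => o _; rewrite /w eqxx.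
  have -> : (\sum_(j | j.1 != l) w l j = \sum_(j : J | j.1 != l) D^-1)%R.
    by apply: eq_bigr => j /negbTE jl; rewrite /w jl.
  by rewrite mulrDl mul1r; lra.
have h := @hoelder_pints R N U _ r xpredT e f v (fun o _ => mf o) (fun o _ => e0 o) e1.
have -> : (fun v => \big[mule/1]_j (sP j v `^ w l j)) =
    (fun v => \big[mule/1]_(o <- r) (f o v `^ e o)).
  apply/funext => u; rewrite splitE; last by move=> j; exact: (msP j).2.
  by rewrite big_cons big_map big_filter.
apply: (le_trans h); rewrite big_cons big_map big_filter /=.
rewrite splitE; last by move=> j; exact: pints_ge0.
rewrite muleA.
have cE := @core_estimate R N q (X l) T (Y l) q0.
have -> : \big[mule/1]_(j | j.1 != l) (pints U (sP j) v `^ D^-1) =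
    \big[mule/1]_(j | j.1 != l) (pints [seq i <- U | i != c j] (P j) v `^ D^-1).
  apply: eq_bigr => j jl; congr (_ `^ _).
  have -> : [seq i <- U | i != c j] = U.
    apply/all_filterP/allP => i iU; apply: contraNneq jl => ic.
    by rewrite -cU -ic.
  congr (_ v); apply: pints_shear => //.
  - move=> u i iU; case: j jl => l' [k|] jl; apply: tvec_out => k'.
      by apply: contraNneq iU => ->.
    by apply: contraNneq iU => ->.
  - move=> u u' uu'; have uc o : u' 0%R (c (j.1, o)) = u 0%R (c (j.1, o)).
      by apply: uu'; rewrite cU.
    case: j jl uc => l' [k|] jl uc; apply: eq_tvec => k'.
      by rewrite /= /X /Y !uc.
    by rewrite /= /X /Y !uc.
apply: lee_wpmul2r; first by apply: prode_ge0 => j _; exact: poweR_ge0.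
have rho0 := radon_norm_ge0 R.
have ed0 : (0 <= 3 * q%:R / D)%R by rewrite divr_ge0 ?ltW.
rewrite -poweRM//; last by apply: prode_ge0 => o _; exact: poweR_ge0.
apply: le_poweR => //; first exact: pints_ge0.
have injXl : injective (X l) by move=> k k' /injc[].
have XYl k : X l k != Y l by apply/eqP => /injc.
have indl o : indep (column_coord (X l) (Y l) o) (P (l, o)).
  by case: o => [k|]; exact: indepP.
have hc := cE injXl injT (fun k k' => cT _ _) XYl (fun k => cT _ _) (fun o => P (l, o))
  (fun o => mP (l, o)) indl v.
apply: (le_trans hc); rewrite le_eqVlt; apply/orP; left; apply/eqP.
by congr (_ * _); apply: eq_bigr => -[k|] _.
Qed.

(** After [inner] the displacements are gone, and Finner's inequality integrates the coordinates in
    [Z]: each is missed by one function, of exponent 1/D, so by [sum_w] the other exponents add up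
    to 1. *)
Lemma vertex_estimate v :
  pints (enum 'I_N) (fun v => \big[mule/1]_j (sP j v `^ w l j)) v <=
  rho `^ (3 * q%:R / D) *
  \big[mule/1]_j (pints [seq i <- enum 'I_N | i != c j] (P j) v `^ w l j).
Proof.
have Dn0 := lt0r_neq0 D0.
have mF : nnmeasurable (fun v => \big[mule/1]_j (sP j v `^ w l j)).
  by apply: nnmeasurable_prod => j _; exact: nnmeasurable_poweR.
rewrite (pints_perm mF perm_ZU) pints_cat.
apply: (le_trans (le_pints Z (nnmeasurable_pints U mF) inner v)).
pose G j := pints [seq i <- U | i != c j] (P j).
have mG j : nnmeasurable (G j) by exact: nnmeasurable_pints.
have mH : nnmeasurable (fun v => \big[mule/1]_j (G j v `^ w l j)).
  by apply: nnmeasurable_prod => j _; exact: nnmeasurable_poweR.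
rewrite (pintsZl (C := fun=> rho `^ (3 * q%:R / D))) //; last first.
  by move=> _; exact: poweR_ge0.
apply: lee_wpmul2l; first exact: poweR_ge0.
have ig (j : J) i : i \in Z -> i == c j -> indep i (G j).
  by move=> _ /eqP ->; apply: indep_pints; exact: indepP.
have w1 i : i \in Z -> (\sum_(j : J | ~~ (i == c j)) w l j = 1)%R.
  move=> /mapP[j0]; rewrite mem_filter => /andP[jl _] ->.
  have := sum_w l; rewrite (bigD1 j0)//= {1}/w (negbTE jl) => E.
  rewrite (eq_bigl (fun j => j != j0)); last by move=> j; rewrite (inj_eq injc) eq_sym.
  by move: E; lra.
apply: le_trans (finner (S := fun j i => i == c j) v mG (w0 l) ig w1) _.
rewrite le_eqVlt; apply/orP; left; apply/eqP; apply: eq_bigr => j _; congr (_ `^ _).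
by rewrite (pints_perm (mP j) (perm_filter _ perm_ZU)) filter_cat pints_cat.
Qed.

End vertex.

Let a (j : J) : R := ((column_weight R j.2 + p%:R - 1) / (p%:R * D))%R.

(* [a] is the mean over [l] of the exponents [w l]. *)
Let average (x : J -> \bar R) : (forall j, 0 <= x j) ->
  \big[mule/1]_(l < p) (\big[mule/1]_j (x j `^ w l j)) `^ (p%:R^-1) =
  \big[mule/1]_j (x j `^ a j).
Proof.
move=> x0.
transitivity (\big[mule/1]_(l < p) \big[mule/1]_j (x j `^ (w l j / p%:R))).
  apply: eq_bigr => l _; rewrite poweR_prod; last by move=> j _; exact: poweR_ge0.
  by apply: eq_bigr => j _; rewrite -poweRrM.
rewrite exchange_big; apply: eq_bigr => j _; rewrite poweR_sum//; last first.
  by move=> l _; rewrite divr_ge0 ?w0.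
congr (_ `^ _); rewrite -mulr_suml (bigD1 j.1)//= {1}/w eqxx.
have -> : (\sum_(l < p | l != j.1) w l j = (p%:R - 1) * D^-1)%R.
  rewrite (eq_bigr (fun=> (D^-1)%R)); last first.
    by move=> l lj; rewrite /w eq_sym (negbTE lj).
  rewrite sumr_const cardC1 card_ord -(mulr_natr D^-1) mulrC; congr (_ * _)%R.
  by rewrite -subn1 natrB.
by rewrite /a; field; rewrite !lt0r_neq0// ltr0n.
Qed.

(** The integrand is the geometric mean of the p integrands of [vertex_estimate]. Hoelder with
    exponents 1/p keeps the power of rho, which is the same for every l. *)
Lemma average_estimate v :
  pints (enum 'I_N) (fun v => \big[mule/1]_j (P j (v + rh_shift j v)%R
    `^ ((column_weight R j.2 + p%:R - 1) / (p%:R * D)))) v <=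
  rho `^ (3 * q%:R / D) *
  \big[mule/1]_j (pints [seq i <- enum 'I_N | i != c j] (P j) v
    `^ ((column_weight R j.2 + p%:R - 1) / (p%:R * D))).
Proof.
have rho0 := radon_norm_ge0 R.
have p1 : (\sum_(l < p) p%:R^-1 = 1 :> R)%R.
  by rewrite sumr_const card_ord -(mulr_natr p%:R^-1) mulVf// pnatr_eq0 -lt0n.
have pi0 (l : 'I_p) : (0 <= p%:R^-1 :> R)%R by rewrite invr_ge0.
pose f l v := \big[mule/1]_j (sP j v `^ w l j).
have mf l : nnmeasurable (f l).
  by apply: nnmeasurable_prod => j _; exact: nnmeasurable_poweR.
have -> : (fun v => \big[mule/1]_j (P j (v + rh_shift j v)%R `^ a j)) =
    (fun v => \big[mule/1]_(l < p) (f l v `^ p%:R^-1)).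
  by apply/funext => u; rewrite average// => j; exact: (msP j).2.
have := @hoelder_pints R N (enum 'I_N) _ (index_enum 'I_p) xpredT (fun=> (p%:R^-1)%R) f v
  (fun l _ => mf l) (fun l _ => pi0 l) p1.
move=> /le_trans; apply.
apply: (@le_trans _ _ (\big[mule/1]_(l < p) (rho `^ (3 * q%:R / D) *
    \big[mule/1]_j (pints [seq i <- enum 'I_N | i != c j] (P j) v `^ w l j)) `^ p%:R^-1)).
  apply: le_prode => l _; first exact: poweR_ge0.
  by apply: le_poweR => //; [exact: pints_ge0|exact: vertex_estimate].
under eq_bigr => l _.
  rewrite poweRM ?poweR_ge0//; last by apply: prode_ge0 => j _; exact: poweR_ge0.
  over.
rewrite big_split /= poweR_sum ?poweR_ge0// p1 poweRe1 ?poweR_ge0//.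
by rewrite average// => j; exact: pints_ge0.
Qed.

End vertices.

(** * From Lebesgue-measurable functions on the group to coordinates *)

(* [h] is [f] off a null Borel set [Z] and [+oo] on it; replacing [+oo] by [0]
   on [Z] does not change the integrals and gives a Borel minorant of [f]. *)
Lemma borel_majorant d (T : measurableType d) (R : realType)
    (mu : {measure set T -> \bar R}) (f : T -> \bar R) :
  completed_measurable_fun mu f -> (forall x, 0 <= f x) ->
  exists h, [/\ nnmeasurable h, forall x, f x <= h x &
    forall r : R, (0 < r)%R -> \int[mu]_x h x `^ r <= \int[mu]_x f x `^ r].
Proof.
move=> cf f0.
pose a (n : nat) : R := ratr (odflt 0%R (unpickle n : option rat)).
have aE (s : rat) : a (pickle s) = ratr s by rewrite /a pickleK.
pose F n := f @^-1` `](a n)%:E, +oo[%classic.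
have /choice[A HA] n : exists A, measurable A /\ A `<=` F n /\ mu.-negligible (F n `\` A).
  have [A mA [B nB ABF]] := cf _ (emeasurable_itv `](a n)%:E, +oo[).
  exists A; split=> //; rewrite /F -ABF; split; first exact: subsetUl.
  by apply: negligibleS nB => x [[]].
have [Z [mZ Z0 NZ]] : mu.-negligible (\bigcup_n (F n `\` A n)).
  by apply: negligible_bigcup => n; have [_ []] := HA n.
pose h x : \bar R := if x \in Z then +oo else f x.
pose h0 x : \bar R := if x \in Z then 0 else f x.
(* The superlevel sets of [h] at rational levels are Borel: off [Z] they agree with the Borel sets
   [A n], and [Z] is included since [h] is +oo there. *)
have hle n : [set x | (a n)%:E < h x] = (A n `\` Z) `|` Z.
  apply/seteqP; split => x /=; rewrite /h.
    case: ifPn => [|/negP xZ]; first by rewrite inE => xZ _; right.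
    move=> anf; left; split; last by move=> ?; apply: xZ; rewrite inE.
    apply: contra_notP xZ => nAx; rewrite inE; apply: NZ; exists n => //.
    by split => //; rewrite /F /= in_itv/= anf.
  move=> [[Anx xZ]|xZ]; last by rewrite mem_set// ltry.
  rewrite memNset//; have [_ [AF _]] := HA n.
  by have := AF _ Anx; rewrite /F /= in_itv/= andbT.
have mh : measurable_fun setT h.
  apply: (measurability _ (ErealGenOInfty.measurableE R)) => //.
  move=> _ [_ [r ->] <-]; rewrite setTI.
  have -> : h @^-1` `]r%:E, +oo[%classic =
      \bigcup_(n in [set n | (r <= a n)%R]) ((A n `\` Z) `|` Z).
    apply/seteqP; split => x /=; rewrite ?in_itv/= ?andbT.
      move=> rh.
      have [s rs sh] : exists2 s : rat, (r <= ratr s)%R & (ratr s)%:E < h x.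
        case: (h x) rh => [y| |//]; rewrite ?lte_fin => rh.
          have [s] := rat_in_itvoo rh; rewrite in_itv/= => /andP[rs sy].
          by exists s; rewrite ?lte_fin// ltW.
        have r1 : (r < r + 1)%R by rewrite ltrDl.
        have [s] := rat_in_itvoo r1; rewrite in_itv/= => /andP[rs sy].
        by exists s; rewrite ?ltry// ltW.
      exists (pickle s); first by rewrite /= aE.
      by rewrite -hle /= aE.
    move=> [n ran]; rewrite -hle => /= anh.
    by apply: le_lt_trans anh; rewrite lee_fin.
  apply: bigcup_measurable => n _.
  by apply: measurableU => //; apply: measurableD => //; have [] := HA n.
have mh0 : measurable_fun setT h0.
  have -> : h0 = h \_ (~` Z).
    apply/funext => x; rewrite patchE /h0 /h in_setC.
    by case: (x \in Z).
  apply: (measurable_restrictT h (measurableC mZ)).1.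
  exact: measurable_funTS.
have hh0 x : 0 <= h x by rewrite /h; case: ifP.
have h00 x : 0 <= h0 x by rewrite /h0; case: ifP.
exists h; split; first by split.
  by move=> x; rewrite /h; case: ifP => _; rewrite ?leey.
move=> r r0; apply: (@le_trans _ _ (\int[mu]_x h0 x `^ r)).
  rewrite (@ge0_ae_eq_integral _ _ _ mu setT (fun x => h x `^ r) (fun x => h0 x `^ r))//.
  - exact: (nnmeasurable_poweR r (conj mh hh0)).1.
  - exact: (nnmeasurable_poweR r (conj mh0 h00)).1.
  - by move=> x _; exact: poweR_ge0.
  - by move=> x _; exact: poweR_ge0.
  exists Z; split => // x /= xhh0; apply: contrapT => nZx; apply: xhh0 => _.
  by rewrite /h /h0 memNset.
apply: le_ge0_integral => x; first exact: poweR_ge0.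
by apply: le_poweR; [exact: ltW|exact: h00|rewrite /h0; case: ifP].
Qed.

Lemma eq_product_measure1 d1 d2 (T1 : measurableType d1) (T2 : measurableType d2)
    (R : realType) (m1 m1' : {measure set T1 -> \bar R})
    (m2 : {sigma_finite_measure set T2 -> \bar R}) A :
  m1 = m1' :> (set T1 -> \bar R) -> (m1 \x m2)%E A = (m1' \x m2)%E A.
Proof.
by move=> m11'; apply: eq_measure_integral => B mB _; rewrite m11'.
Qed.

(** * The group and its projections in coordinates *)

Section reiter_heisenberg_coordinates.
Variables (R : realType) (q p : nat).
Notation J := ('I_p * option 'I_q)%type.
Notation N := (p * q + p + q)%N.
Notation G := ('M[R]_(q, p) * 'cV[R]_p * 'cV[R]_q)%type.

Definition rh_index (j : J) : 'I_(p * q + p) :=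
  if j.2 is Some k then lshift p (entry_index k j.1) else rshift (p * q) j.1.

Definition rh_horizontal (j : J) : 'I_N := lshift q (rh_index j).
Definition rh_central (k : 'I_q) : 'I_N := rshift (p * q + p) k.

Notation c := rh_horizontal.
Notation T := rh_central.

Definition rh_index_inv (i : 'I_(p * q + p)) : J :=
  match fintype.split i with
  | inl e => (col_index e, Some (row_index e))
  | inr l => (l, None)
  end.

Lemma rh_indexK : cancel rh_index rh_index_inv.
Proof.
move=> [l [k|]]; rewrite /rh_index /rh_index_inv /=.
  by rewrite (unsplitK (inl _)) row_entry_index col_entry_index.
by rewrite (unsplitK (inr _)).
Qed.

Lemma rh_index_invK : cancel rh_index_inv rh_index.
Proof.
move=> i; rewrite /rh_index /rh_index_inv -[RHS]splitK.
by case: (fintype.split i) => [e|l] //=; rewrite entry_indexK.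
Qed.

Lemma rh_horizontal_inj : injective c.
Proof. by move=> i j /lshift_inj/(can_inj rh_indexK). Qed.

Lemma rh_central_inj : injective T.
Proof. exact: rshift_inj. Qed.

Lemma rh_horizontal_central j k : c j != T k.
Proof. by rewrite eq_lrshift. Qed.

Lemma rh_covered i : [exists j, i == c j] || [exists k, i == T k].
Proof.
rewrite -[i]splitK; case: (fintype.split i) => [e|k] /=; apply/orP.
  by left; apply/existsP; exists (rh_index_inv e); rewrite /c rh_index_invK.
by right; apply/existsP; exists k.
Qed.

Lemma rh_coordX (x : 'M[R]_(q, p)) y t l k : rh_coord x y t 0%R (c (l, Some k)) = x k l.
Proof. by rewrite /rh_coord !row_mxEl mxE row_entry_index col_entry_index. Qed.

Lemma rh_coordY (x : 'M[R]_(q, p)) y t l : rh_coord x y t 0%R (c (l, None)) = y l 0%R.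
Proof. by rewrite /rh_coord row_mxEl row_mxEr mxE. Qed.

Lemma rh_coordT (x : 'M[R]_(q, p)) y t k : rh_coord x y t 0%R (T k) = t k 0%R.
Proof. by rewrite /rh_coord row_mxEr mxE. Qed.

Lemma rh_coord_central (x : 'M[R]_(q, p)) (y : 'cV[R]_p) (t : 'cV[R]_q) (s : 'I_q -> R) (t' : 'cV[R]_q) :
  (forall k, t' k 0%R = t k 0%R + s k)%R ->
  rh_coord x y t' = (rh_coord x y t + tvec T s)%R.
Proof.
move=> ts; apply/rowP => i; rewrite [RHS]mxE.
have [/existsP[[l o] /eqP ->]|/existsP[k /eqP ->]] := orP (rh_covered i).
  rewrite tvec_out ?addr0; last by move=> k; exact: rh_horizontal_central.
  by case: o => [k|]; rewrite ?rh_coordX ?rh_coordY.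
by rewrite tvecE ?rh_coordT//; exact: rh_central_inj.
Qed.

Lemma rh_proj_shift (j : J) (g : G) :
  let v := rh_coord g.1.1 g.1.2 g.2 in
  rh_proj (rh_index j) g = col' (c j) (v + rh_shift c T j v)%R.
Proof.
case: g => [[x y] t]; case: j => l [k|] /=; congr (col' _ _); rewrite /rh_index /=.
  rewrite (unsplitK (inl _)) row_entry_index col_entry_index.
  apply: rh_coord_central => k' /=; rewrite rh_coordX rh_coordY !mxE eqxx andbT.
  by case: (k' == k); rewrite /= ?mulr1 ?mulr0.
rewrite (unsplitK (inr _)).
apply: rh_coord_central => k' /=; rewrite rh_coordX rh_coordY !mxE.
by congr (_ + _)%R; field.
Qed.

Let measurable_rh_coord :
  measurable_fun setT (fun g : G => rh_coord g.1.1 g.1.2 g.2).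
Proof.
apply: measurable_fun_mx => i0 i; rewrite ord1.
have [/existsP[[l [k|]] /eqP ->]|/existsP[k /eqP ->]] := orP (rh_covered i).
- under eq_fun do rewrite rh_coordX.
  apply: (measurableT_comp (measurable_entry k l)).
  exact: (measurableT_comp measurable_fst measurable_fst).
- under eq_fun do rewrite rh_coordY.
  apply: (measurableT_comp (measurable_entry l 0%R)).
  exact: (measurableT_comp measurable_snd measurable_fst).
- under eq_fun do rewrite rh_coordT.
  exact: (measurableT_comp (measurable_entry k 0%R) measurable_snd).
Qed.

Let integral_fubini (F : G -> \bar R) : nnmeasurable F ->
  \int[rh_measure R q p]_g F g =
  \int[lebesgue_mx q p]_x \int[lebesgue_mx p 1]_y \int[lebesgue_mx q 1]_t F (x, y, t).
Proof.
move=> mF.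
have [nu nuE] := sigma_finite_measureP
  (sigma_finite_product (@lebesgue_mx R q p) (@lebesgue_mx R p 1)).
transitivity (\int[(nu \x @lebesgue_mx R q 1)%E]_g F g).
  apply: eq_measure_integral => A mA _.
  change (((@lebesgue_mx R q p \x @lebesgue_mx R p 1) \x @lebesgue_mx R q 1)%E A =
    (nu \x @lebesgue_mx R q 1)%E A).
  exact: (eq_product_measure1 _ _ nuE).
rewrite (fubini_tonelli1 F mF.1 mF.2).
pose F1 (z : 'M[R]_(q, p) * 'cV[R]_p) := \int[lebesgue_mx q 1]_t F (z, t).
have mF1 : nnmeasurable F1.
  split; first exact: (measurable_fun_fubini_tonelli_F (m2 := lebesgue_mx q 1) F mF.1 mF.2).
  by move=> z; apply: integral_ge0 => t _; exact: mF.2.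
transitivity (\int[(@lebesgue_mx R q p \x @lebesgue_mx R p 1)%E]_z F1 z).
  apply: eq_measure_integral => A mA _.
  exact: (esym (congr1 (fun m : set _ -> \bar R => m A) nuE)).
exact: (fubini_tonelli1 F1 mF1.1 mF1.2).
Qed.

Let integral_mx m n (N' : nat) (h : 'I_(n * m) -> 'I_N') (phi : 'M[R]_(m, n) -> 'rV[R]_N')
    (v : 'rV[R]_N') (F : 'rV[R]_N' -> \bar R) :
  (forall x i, phi x 0%R (h i) = x (row_index i) (col_index i)) ->
  (forall x j, j \notin codom h -> phi x 0%R j = v 0%R j) ->
  measurable_fun setT phi -> nnmeasurable F ->
  \int[lebesgue_mx m n]_x F (phi x) = pints [seq h i | i <- enum 'I_(n * m)] F v.
Proof.
move=> phih phiv mphi mF.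
have mFphi := nnmeasurable_comp mphi mF.
rewrite (nnintegral_pushforward (lebesgue_rV (n * m)) (@measurable_mx_of_colvec R m n) mFphi).
apply: (integral_lebesgue_rV (phi := fun w => phi (mx_of_colvec w))) => //.
  by move=> w k; rewrite phih mxE entry_indexK.
by move=> w j jh; rewrite (phiv _ _ jh).
Qed.

(** The integrals in t, y and x each fill their own block of coordinates of a vector that is zero
    there, and the blocks together exhaust all coordinates. *)
Lemma integral_rh_measure (F : 'rV[R]_N -> \bar R) : nnmeasurable F ->
  \int[rh_measure R q p]_g F (rh_coord g.1.1 g.1.2 g.2) = pints (enum 'I_N) F 0%R.
Proof.
move=> mF.
have mFc := nnmeasurable_comp measurable_rh_coord mF.
rewrite integral_fubini//=.
pose hX (i : 'I_(p * q)) := c (col_index i, Some (row_index i)).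
pose hY (i : 'I_(1 * p)) := c (row_index i, None).
pose hT (i : 'I_(1 * q)) := T (row_index i).
pose LX := [seq hX i | i <- enum 'I_(p * q)].
pose LY := [seq hY i | i <- enum 'I_(1 * p)].
pose LT := [seq hT i | i <- enum 'I_(1 * q)].
have perm : perm_eq (enum 'I_N) (LX ++ (LY ++ LT)).
  have inj1 m (i i' : 'I_(1 * m)) : row_index i = row_index i' -> i = i'.
    by move=> ii'; rewrite -[i]entry_indexK -[i']entry_indexK ii' !ord1.
  have iX : injective hX.
    move=> i i' /rh_horizontal_inj E.
    have /= a := congr1 fst E; have /= b := congr1 (odflt (row_index i) \o snd) E.
    by rewrite -[i]entry_indexK -[i']entry_indexK a b.
  have iY : injective hY.
    by move=> i i' /rh_horizontal_inj E; apply: inj1; exact: (congr1 fst E).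
  have iT : injective hT by move=> i i' /rh_central_inj/inj1.
  apply: uniq_perm; first exact: enum_uniq.
    rewrite /LX /LY /LT cat_uniq (map_inj_uniq iX) enum_uniq cat_uniq (map_inj_uniq iY).
    rewrite enum_uniq (map_inj_uniq iT) enum_uniq /= andbT; apply/andP; split.
      apply/hasPn => i; rewrite mem_cat => /orP[]/mapP[i' _ ->]; apply/mapP => -[i2 _].
        by move=> /rh_horizontal_inj.
      by move/eqP; rewrite eq_sym (negbTE (rh_horizontal_central _ _)).
    apply/hasPn => _ /mapP[i' _ ->]; apply/mapP => -[i2 _].
    by move/eqP; rewrite eq_sym (negbTE (rh_horizontal_central _ _)).
  move=> i; rewrite mem_enum; apply/esym; rewrite !mem_cat.
  have [/existsP[[l [k|]] /eqP ->]|/existsP[k /eqP ->]] := orP (rh_covered i).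
  - apply/orP; left; apply/mapP; exists (entry_index k l); first by rewrite mem_enum.
    by rewrite /hX row_entry_index col_entry_index.
  - apply/orP; right; apply/orP; left; apply/mapP.
    by exists (entry_index l 0%R); rewrite ?mem_enum// /hY row_entry_index.
  - apply/orP; right; apply/orP; right; apply/mapP.
    by exists (entry_index k 0%R); rewrite ?mem_enum// /hT row_entry_index.
rewrite (pints_perm mF perm) !pints_cat.
have m1 x y : measurable_fun setT (fun t : 'cV[R]_q => rh_coord (x : 'M[R]_(q, p)) y t).
  exact: (measurableT_comp measurable_rh_coord (@measurable_pair1 _ _ _ _ (x, y))).
have m2 x : measurable_fun setT (fun y : 'cV[R]_p => rh_coord (x : 'M[R]_(q, p)) y 0%R).
  apply: (measurableT_comp measurable_rh_coord
    (g := fun y : 'cV[R]_p => ((x, y), 0%R : 'cV[R]_q))).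
  by apply: measurable_fun_pair => //; exact: measurable_pair1.
have m3 : measurable_fun setT (fun x : 'M[R]_(q, p) => rh_coord x 0%R 0%R).
  apply: (measurableT_comp measurable_rh_coord
    (g := fun x : 'M[R]_(q, p) => ((x, 0%R : 'cV[R]_p), 0%R : 'cV[R]_q))).
  by apply: measurable_fun_pair => //; exact: measurable_pair2.
have step1 (x : 'M[R]_(q, p)) y : \int[lebesgue_mx q 1]_t F (rh_coord x y t) =
    pints LT F (rh_coord x y 0%R).
  apply: (integral_mx (phi := rh_coord x y)) => //.
    by move=> t i; rewrite rh_coordT; congr (t _ _); rewrite ord1.
  move=> t i iT.
  have [/existsP[[l [k|]] /eqP ->]|/existsP[k /eqP ik]] := orP (rh_covered i).
  - by rewrite !rh_coordX.
  - by rewrite !rh_coordY.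
  - case/negP: iT; apply/codomP; exists (entry_index k 0%R).
    by rewrite /hT row_entry_index.
have step2 (x : 'M[R]_(q, p)) : \int[lebesgue_mx p 1]_y pints LT F (rh_coord x y 0%R) =
    pints LY (pints LT F) (rh_coord x 0%R 0%R).
  apply: (integral_mx (phi := fun y => rh_coord x y 0%R)) => //.
  - by move=> y i; rewrite rh_coordY; congr (y _ _); rewrite ord1.
  - move=> y i iY.
    have [/existsP[[l [k|]] /eqP il]|/existsP[k /eqP ->]] := orP (rh_covered i).
    + by rewrite il !rh_coordX.
    + case/negP: iY; apply/codomP; exists (entry_index l 0%R).
      by rewrite /hY row_entry_index.
    + by rewrite !rh_coordT.
  - exact: nnmeasurable_pints.
transitivity (\int[lebesgue_mx q p]_x pints LY (pints LT F) (rh_coord x 0%R 0%R)).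
  apply: eq_integral => x _; rewrite -step2.
  by apply: eq_integral => y _; exact: step1.
apply: (integral_mx (phi := fun x => rh_coord x 0%R 0%R)) => //.
- by move=> x i; rewrite rh_coordX.
- move=> x i iX.
  have [/existsP[[l [k|]] /eqP il]|/existsP[k /eqP ->]] := orP (rh_covered i).
  + case/negP: iX; apply/codomP; exists (entry_index k l).
    by rewrite /hX row_entry_index col_entry_index.
  + by rewrite il !rh_coordY !mxE.
  + by rewrite !rh_coordT !mxE.
- by do 2!apply: nnmeasurable_pints.
Qed.

End reiter_heisenberg_coordinates.

Lemma pints_col' (R : realType) n (i0 : 'I_n) (F : 'rV[R]_n.-1 -> \bar R) v :
  nnmeasurable F ->
  pints [seq i <- enum 'I_n | i != i0] (fun w => F (col' i0 w)) v =
  \int[lebesgue_rV n.-1]_w F w.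
Proof.
move=> mF.
have mcol' : measurable_fun setT (fun w : 'rV[R]_n => col' i0 w).
  apply: measurable_fun_mx => i j; under eq_fun do rewrite mxE.
  exact: measurable_entry.
have mG := nnmeasurable_comp mcol' mF.
have perm : perm_eq [seq i <- enum 'I_n | i != i0] [seq lift i0 k | k <- enum 'I_n.-1].
  apply: uniq_perm; first by rewrite filter_uniq// enum_uniq.
    by rewrite map_inj_uniq ?enum_uniq//; exact: lift_inj.
  move=> i; rewrite mem_filter mem_enum andbT; apply/idP/mapP.
    by rewrite eq_sym => /unlift_some[k -> _]; exists k => //; rewrite mem_enum.
  by move=> [k _ ->]; rewrite eq_sym neq_lift.
rewrite (pints_perm mG perm).
pose phi (w : 'rV[R]_n.-1) : 'rV[R]_n :=
  \row_i (if unlift i0 i is Some k then w 0%R k else v 0%R i).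
rewrite -(integral_lebesgue_rV (h := lift i0) (phi := phi) (v := v))//.
- apply: eq_integral => w _; congr F; apply/rowP => k.
  by rewrite !mxE liftK.
- by move=> w k; rewrite mxE liftK.
- move=> w j jh; rewrite mxE; case: unliftP => // k jk.
  by case/negP: jh; apply/codomP; exists k.
Qed.

Theorem theorem1 (R : realType) (q p : nat) (hq : (1 <= q)%N) (hp : (1 <= p)%N) :
  radon_norm R < +oo /\
  forall f : 'I_(p * q + p) -> 'rV[R]_(p * q + p + q).-1 -> \bar R,
    (forall j, lebesgue_measurable_fun (f j)) ->
    (forall j v, 0 <= f j v) ->
    let D : R := (q%:R * p%:R + p%:R + 2 * q%:R - 1)%R in
    \int[rh_measure R q p]_g
        \big[mule/1]_(j < p * q + p) f j (rh_proj j g)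
    <= poweR (radon_norm R) (3 * q%:R / D)%R
       * \big[mule/1]_(i < p * q)
           'N[lebesgue_rV (p * q + p + q).-1]_((p%:R * D / (1 + p%:R))%R%:E)
             [f (lshift p i)]
       * \big[mule/1]_(l < p)
           'N[lebesgue_rV (p * q + p + q).-1]_((p%:R * D / (q%:R + p%:R))%R%:E)
             [f (rshift (p * q) l)].
Proof.
split; first exact: radon_norm_lty.
move=> f cf f0; lazy zeta; set D : R := (_ - 1)%R.
have /choice[h Hh] j := borel_majorant (cf j) (f0 j).
have mh j : nnmeasurable (h j) by have [] := Hh j.
have D0 : (0 < D)%R := rh_dim_gt0 R hq hp.
have Dn0 : D != 0%R := lt0r_neq0 D0.
have p0 : (0 < p%:R :> R)%R by rewrite ltr0n.
have q0 : (0 < q%:R :> R)%R by rewrite ltr0n.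
have q1p n : (n%:R + p%:R != 0 :> R)%R by rewrite lt0r_neq0// ltr_wpDl// ler0n.
pose c := @rh_horizontal q p; pose T := @rh_central q p.
pose a (j : 'I_p * option 'I_q) : R :=
  ((column_weight R j.2 + p%:R - 1) / (p%:R * D))%R.
have a0 j : (0 < a j)%R.
  rewrite divr_gt0 ?mulr_gt0//; case: j => l [k|] /=; first by lra.
  by have := q0; lra.
pose P j (w : 'rV[R]_(p * q + p + q)) :=
  (h (rh_index j) (col' (c j) w)) `^ (a j)^-1.
have mcol' (i : 'I_(p * q + p + q)) :
    measurable_fun setT (fun w : 'rV[R]_(p * q + p + q) => col' i w).
  apply: measurable_fun_mx => i' j; under eq_fun do rewrite mxE.
  exact: measurable_entry.
have mP j : nnmeasurable (P j).
  by apply: nnmeasurable_poweR; exact: nnmeasurable_comp (mcol' _) (mh _).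
have indepP j : indep (c j) (P j).
  move=> w s; rewrite /P; congr (h _ _ `^ _); apply/rowP => k.
  by rewrite !mxE eq_sym (negbTE (neq_lift _ _)).
have PE j w : P j w `^ a j = h (rh_index j) (col' (c j) w).
  by rewrite -poweRrM mulVf ?lt0r_neq0// poweRe1// (mh _).2.
have mshift j : measurable_fun setT
    (fun w : 'rV[R]_(p * q + p + q) => w + rh_shift c T j w)%R.
  exact: measurable_rh_shift.
pose Phi w := \big[mule/1]_j (P j (w + rh_shift c T j w)%R `^ a j).
have mPhi : nnmeasurable Phi.
  apply: nnmeasurable_prod => j _; apply: nnmeasurable_poweR.
  exact: nnmeasurable_comp (mshift j) (mP j).
have bij_index : bijective (@rh_index q p).
  by eexists; [exact: rh_indexK|exact: rh_index_invK].
(* The functions are replaced by their Borel majorants through a pointwise comparison of the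
   integrands, before any integral is transformed. *)
apply: (@le_trans _ _ (\int[rh_measure R q p]_g Phi (rh_coord g.1.1 g.1.2 g.2))).
  apply: le_ge0_integral => g; first by apply: prode_ge0 => j _; exact: f0.
  rewrite (reindex (@rh_index q p)) /=; last exact: onW_bij.
  apply: le_prode => j _; first exact: f0.
  by rewrite PE rh_proj_shift; have [_ fh _] := Hh (rh_index j); exact: fh.
rewrite integral_rh_measure//.
have := average_estimate hq hp (@rh_horizontal_inj q p) (@rh_central_inj q p)
  (@rh_horizontal_central q p) (@rh_covered q p) mP indepP 0%R.
move=> /le_trans; apply; rewrite -muleA.
apply: lee_wpmul2l; first exact: poweR_ge0.
pose M i := match fintype.split i with
  | inl _ => 'N[lebesgue_rV (p * q + p + q).-1]_((p%:R * D / (1 + p%:R))%R%:E) [f i]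
  | inr _ => 'N[lebesgue_rV (p * q + p + q).-1]_((p%:R * D / (q%:R + p%:R))%R%:E) [f i]
  end.
rewrite (_ : _ * _ = \big[mule/1]_i M i); last first.
  rewrite big_split_ord /=; congr (_ * _); apply: eq_bigr => i _; rewrite /M.
    by rewrite (unsplitK (inl _)).
  by rewrite (unsplitK (inr _)).
rewrite [leRHS](reindex (@rh_index q p)) /=; last exact: onW_bij.
apply: le_prode => j _; first exact: poweR_ge0.
(* The inverse exponents match: the weights 2 and q + 1, increased by p - 1, give the numerators 1 +
   p and q + p. *)
have -> : M (rh_index j) =
    'N[lebesgue_rV (p * q + p + q).-1]_(((a j)^-1)%:E) [f (rh_index j)].
  case: j => l [k|]; rewrite /M /rh_index /=.
    rewrite (unsplitK (inl _)); congr ('N[_]_(_%:E)[_]); rewrite /a /= invf_div.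
    by congr (_ / _)%R; ring.
  rewrite (unsplitK (inr _)); congr ('N[_]_(_%:E)[_]); rewrite /a /= invf_div.
  by congr (_ / _)%R; ring.
rewrite unlock /Lnorm invrK; apply: (le_poweR (ltW (a0 j)) (pints_ge0 _ _ (mP j))).
have mF := nnmeasurable_poweR (a j)^-1 (mh (rh_index j)).
rewrite (pints_col' (c j) 0%R mF).
(* Here the comparison is reversed: passing to the majorant does not increase the integral of the
   power, since it differs from a Borel minorant only on a null set. *)
have [_ _ hle] := Hh (rh_index j); apply: (le_trans (hle _ _)); first by rewrite invr_gt0.
rewrite le_eqVlt; apply/orP; left; apply/eqP; apply: eq_integral => w _.
by rewrite gee0_abs.
Qed.
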